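(* Suppose $\mathbf{f}\in\mathcal{C}^{\gamma+1}([t_0,T]\times\mathcal{D},\mathbb{R}^d)$. Set $$\widetilde{\boldsymbol{\phi}}(t_n,\widetilde{\mathbf{y}}_n;h_n)=\mathbf{L}\left(\mathbf{P}_{p,q}(2^{-\kappa_n}\widetilde{\mathbf{D}}_nh_n)\right)^{2^{\kappa_n}}\mathbf{r},$$ where $\mathbf{P}_{p,q}(2^{-\kappa_n}\widetilde{\mathbf{D}}_nh_n)$ is the $(p,q)$-Padé approximation of $e^{2^{-\kappa_n}\widetilde{\mathbf{D}}_nh_n}$, $\kappa_n$ is the smallest non-negative integer such that $\Vert2^{-\kappa_n}\widetilde{\mathbf{D}}_nh_n\Vert\le\frac12$, and the matrices $\widetilde{\mathbf{D}}_n,\mathbf{L},\mathbf{r}$ are as defined in the context. Further, let $\widetilde{\boldsymbol{\rho}}$ be the numerical solution of the auxiliary ODE of the context given by an order $\gamma$ explicit Runge-Kutta scheme. Then, for $h$ small enough, the global error of the LLRK scheme $$\widetilde{\mathbf{y}}_{n+1}=\widetilde{\mathbf{y}}_n+\widetilde{\boldsymbol{\phi}}(t_n,\widetilde{\mathbf{y}}_n;h_n)+\widetilde{\boldsymbol{\rho}}(t_n,\widetilde{\mathbf{y}}_n;h_n),\qquad\widetilde{\mathbf{y}}_0=\mathbf{x}_0,$$ for the integration of $\mathbf{x}'(t)=\mathbf{f}(t,\mathbf{x}(t))$, $\mathbf{x}(t_0)=\mathbf{x}_0$, satisfies $$\Vert\mathbf{x}(t_n)-\widetilde{\mathbf{y}}_n\Vert\le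 Mh^{\min\{\gamma,p+q\}}$$ for all $t_n\in(t)_h$, where $M$ is a positive constant.
   Context: $\mathcal{D}\subset\mathbb{R}^d$ is open, $\mathbf{x}_0\in\mathcal{D}$, the ODE has a unique solution $\mathbf{x}$ on $[t_0,T]$ with values in $\mathcal{D}$, and $\gamma>2$ is an integer. $\mathbf{f}_{\mathbf{x}},\mathbf{f}_t$ are the partial derivatives of $\mathbf{f}$. For $0<h<1$, $(t)_h$ is a partition $t_0<\dots<t_N=T$ with $h_n=t_{n+1}-t_n\le h$. $M$ is independent of $h$ and of the partition. Matrices: for non-autonomous ODEs, $$\widetilde{\mathbf{D}}_n=\begin{bmatrix}\mathbf{f}_{\mathbf{x}}(t_n,\widetilde{\mathbf{y}}_n)&\mathbf{f}_t(t_n,\widetilde{\mathbf{y}}_n)&\mathbf{f}(t_n,\widetilde{\mathbf{y}}_n)\\0&0&1\\0&0&0\end{bmatrix}\in\mathbb{R}^{(d+2)\times(d+2)},$$ $\mathbf{L}=[\mathbf{I}_d\ \ \mathbf{0}_{d\times2}]$, $\mathbf{r}^\top=[\mathbf{0}_{1\times(d+1)}\ \ 1]$; for autonomous ODEs, $$\widetilde{\mathbf{D}}_n=\begin{bmatrix}\mathbf{f}_{\mathbf{x}}(\widetilde{\mathbf{y}}_n)&\mathbf{f}(\widetilde{\mathbf{y}}_n)\\0&0\end{bmatrix}\in\mathbb{R}^{(d+1)\times(d+1)},$$ $\mathbf{L}=[\mathbf{I}_d\ \ \mathbf{0}_{d\times1}]$, $\mathbf{r}^\top=[\mathbf{0}_{1\times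 d}\ \ 1]$. $\Vert\cdot\Vert$ is a matrix norm induced by a vector norm. Padé approximation: $\mathbf{P}_{p,q}(z)=\mathbf{N}_{p,q}(z)/\mathbf{D}_{p,q}(z)$ with numerator degree $p$ and denominator degree $q$, where $$\mathbf{N}_{p,q}(z)=1+\frac{p}{q+p}z+\frac{p(p-1)}{(q+p)(q+p-1)}\frac{z^2}{2!}+\dots+\frac{p(p-1)\cdots1}{(q+p)\cdots(q+1)}\frac{z^p}{p!},\qquad\mathbf{D}_{p,q}(z)=\mathbf{N}_{q,p}(-z).$$ Auxiliary ODE: $\mathbf{v}'(t)=\widetilde{\mathbf{q}}(t_n,\widetilde{\mathbf{y}}_n;t,\mathbf{v}(t))$, $\mathbf{v}(t_n)=\mathbf{0}$, $t\in[t_n,t_{n+1}]$, with $$\widetilde{\mathbf{q}}(t_n,\widetilde{\mathbf{y}}_n;s,\boldsymbol{\xi})=\mathbf{f}(s,\widetilde{\mathbf{y}}_n+\widetilde{\boldsymbol{\phi}}(t_n,\widetilde{\mathbf{y}}_n;s-t_n)+\boldsymbol{\xi})-\mathbf{f}_{\mathbf{x}}(t_n,\widetilde{\mathbf{y}}_n)\widetilde{\boldsymbol{\phi}}(t_n,\widetilde{\mathbf{y}}_n;s-t_n)-\mathbf{f}_t(t_n,\widetilde{\mathbf{y}}_n)(s-t_n)-\mathbf{f}(t_n,\widetilde{\mathbf{y}}_n),$$ where $\widetilde{\boldsymbol{\phi}}(t_n,\widetilde{\mathbf{y}}_n;\delta)$ is given by the same formula with $h_n$ replaced by $\delta$. For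 an explicit $s$-stage Runge-Kutta scheme of order $\gamma$ with coefficients $c_i,a_{ij},b_j$, $\widetilde{\boldsymbol{\rho}}(t_n,\widetilde{\mathbf{y}}_n;h_n)=h_n\sum_{j=1}^sb_j\widetilde{\mathbf{k}}_j$ with $\widetilde{\mathbf{k}}_i=\widetilde{\mathbf{q}}(t_n,\widetilde{\mathbf{y}}_n;t_n+c_ih_n,h_n\sum_{j=1}^{i-1}a_{ij}\widetilde{\mathbf{k}}_j)$; stage times $t_n+c_ih_n$ are understood to lie in $[t_0,T]$. *)

(* Defs.v *)
From mathcomp Require Import all_boot all_order all_algebra.
From mathcomp Require Import all_classical all_reals all_analysis.

Set Implicit Arguments.
Unset Strict Implicit.
Unset Printing Implicit Defensive.

Import Order.TTheory GRing.Theory Num.Theory.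
Import numFieldNormedType.Exports.

Local Open Scope classical_set_scope.
Local Open Scope ring_scope.

Section Calculus.
Context {R : realType}.

(* Derivative relative to I: on a closed interval it is the one-sided derivative
   at the two endpoints, so it never looks at u outside of I. *)
Definition derivable_within {V : normedModType R} (I : set R) (u : R -> V)
    (t : R) : Prop :=
  cvg ((s - t)^-1 *: (u s - u t) @[s --> within I t^']).

Definition derive_within {V : normedModType R} (I : set R) (u : R -> V)
    (t : R) : V :=
  lim ((s - t)^-1 *: (u s - u t) @[s --> within I t^']).

(* Partial derivatives of g on I x R^d: index None is the variable t (relative
   to I), index Some j is the j-th coordinate of y. *)
Definition pderivable {d : nat} (I : set R) (i : option 'I_d)
    (g : R -> 'cV[R]_d -> 'cV[R]_d) (t : R) (y : 'cV[R]_d) : Prop :=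
  if i is Some j then derivable (g t) y (delta_mx j 0)
  else derivable_within I (g^~ y) t.

Definition pderive {d : nat} (I : set R) (i : option 'I_d)
    (g : R -> 'cV[R]_d -> 'cV[R]_d) (t : R) (y : 'cV[R]_d) : 'cV[R]_d :=
  if i is Some j then 'D_(delta_mx j 0) (g t) y
  else derive_within I (g^~ y) t.

(* g is of class C^k on I x D (D open): all iterated partial derivatives of
   order at most k, in any order of differentiation, exist and are continuous
   on I x D. Values of g outside of I x D are irrelevant. *)
Definition classC {d : nat} (k : nat) (I : set R) (D : set 'cV[R]_d)
    (g : R -> 'cV[R]_d -> 'cV[R]_d) : Prop :=
  forall w : seq (option 'I_d), (size w <= k)%N ->
    {within I `*` D,
      continuous (fun z : R * 'cV[R]_d => foldr (pderive I) g w z.1 z.2)} /\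
    ((size w < k)%N -> forall (i : option 'I_d) (t : R) (y : 'cV[R]_d),
      I t -> D y -> pderivable I i (foldr (pderive I) g w) t y).

Definition ode_solution {d : nat} (g : R -> 'cV[R]_d -> 'cV[R]_d)
    (D : set 'cV[R]_d) (t0 T : R) (x0 : 'cV[R]_d) (x : R -> 'cV[R]_d) : Prop :=
  x t0 = x0 /\
  forall t, t0 <= t <= T ->
    [/\ D (x t), derivable_within `[t0, T] x t
      & derive_within `[t0, T] x t = g t (x t)].

Definition unique_ode_solution {d : nat} (g : R -> 'cV[R]_d -> 'cV[R]_d)
    (D : set 'cV[R]_d) (t0 T : R) (x0 : 'cV[R]_d) (x : R -> 'cV[R]_d) : Prop :=
  ode_solution g D t0 T x0 x /\
  forall z, ode_solution g D t0 T x0 z -> forall t, t0 <= t <= T -> z t = x t.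

Definition jacobian_x {d : nat} (g : R -> 'cV[R]_d -> 'cV[R]_d) (t : R)
    (y : 'cV[R]_d) : 'M[R]_d :=
  \matrix_(i, j) ('D_(delta_mx j 0) (g t) y) i 0.

End Calculus.

Section Norms.
Context {R : realType}.

Record vector_norm {m : nat} (nu : 'cV[R]_m -> R) : Prop := VectorNorm {
  vector_norm_triangle : forall u v, nu (u + v) <= nu u + nu v;
  vector_norm_scale : forall (c : R) v, nu (c *: v) = `|c| * nu v;
  vector_norm_eq0 : forall v, nu v = 0 -> v = 0 }.

Definition induced_norm {m : nat} (nu : 'cV[R]_m -> R) (A : 'M[R]_m) : R :=
  sup [set nu (A *m v) | v in [set v | nu v = 1]].

End Norms.

Section Pade.
Context {R : realType}.

(* The coefficient of z^j is
   p (p - 1) ... (p - j + 1) / ((q + p) ... (q + p - j + 1)) / j!. *)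
Definition pade_num (p q : nat) {m : nat} (A : 'M[R]_m) : 'M[R]_m :=
  \sum_(j < p.+1) ((p ^_ j)%:R / ((q + p) ^_ j)%:R / (j`!)%:R) *: A ^+ j.

Definition pade_den (p q : nat) {m : nat} (A : 'M[R]_m) : 'M[R]_m :=
  pade_num q p (- A).

Definition pade (p q : nat) {m : nat} (A : 'M[R]_m) : 'M[R]_m :=
  pade_num p q A *m invmx (pade_den p q A).

(* Smallest k with || 2^-k A || <= 1/2 in the matrix norm induced by nu; such a
   k always exists when nu is a norm. *)
Definition scaling {m : nat} (nu : 'cV[R]_m -> R) (A : 'M[R]_m) : nat :=
  xget 0%N [set k : nat | induced_norm nu (2%:R ^- k *: A) <= 2^-1 /\
    forall j : nat, induced_norm nu (2%:R ^- j *: A) <= 2^-1 -> (k <= j)%N].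

(* Approximation of e^A by scaling and squaring. *)
Definition pade_exp (p q : nat) {m : nat} (nu : 'cV[R]_m -> R)
    (A : 'M[R]_m) : 'M[R]_m :=
  let k := scaling nu A in pade p q (2%:R ^- k *: A) ^+ (2 ^ k).

End Pade.

Section LocalLinearization.
Context {R : realType} {d : nat}.
Implicit Types (f : R -> 'cV[R]_d -> 'cV[R]_d) (I : set R) (y : 'cV[R]_d).

Definition llD I f (t : R) y : 'M[R]_(d + (1 + 1)) :=
  block_mx (jacobian_x f t y) (row_mx (pderive I None f t y) (f t y))
           0 (block_mx 0 1 0 0).

Definition llL : 'M[R]_(d, d + (1 + 1)) := row_mx 1%:M 0.

Definition llr : 'cV[R]_(d + (1 + 1)) := col_mx 0 (col_mx 0 1).

(* The scaling exponent is that of the matrix D * delta, so it depends on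
   delta. *)
Definition phi (p q : nat) (nu : 'cV[R]_(d + (1 + 1)) -> R) I f (t : R) y
    (delta : R) : 'cV[R]_d :=
  llL *m pade_exp p q nu (delta *: llD I f t y) *m llr.

(* Variants for autonomous equations, where f does not depend on its first
   argument. *)
Definition llD_aut f (t : R) y : 'M[R]_(d + 1) :=
  block_mx (jacobian_x f t y) (f t y) 0 0.

Definition llL_aut : 'M[R]_(d, d + 1) := row_mx 1%:M 0.

Definition llr_aut : 'cV[R]_(d + 1) := col_mx 0 1.

Definition phi_aut (p q : nat) (nu : 'cV[R]_(d + 1) -> R) f (t : R) y
    (delta : R) : 'cV[R]_d :=
  llL_aut *m pade_exp p q nu (delta *: llD_aut f t y) *m llr_aut.

(* Right-hand side of the auxiliary equation attached to (t, y). *)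
Definition aux_rhs I f (ph : R -> 'cV[R]_d -> R -> 'cV[R]_d) (t : R) y (s : R)
    (xi : 'cV[R]_d) : 'cV[R]_d :=
  f s (y + ph t y (s - t) + xi) - jacobian_x f t y *m ph t y (s - t)
  - (s - t) *: pderive I None f t y - f t y.

End LocalLinearization.

Section RungeKutta.
Context {R : realType}.

(* Only the entries c_i, b_i, a_ij with j < i < stages are ever used. *)
Record explicit_rk := ExplicitRK {
  rk_stages : nat;
  rk_c : nat -> R;
  rk_a : nat -> nat -> R;
  rk_b : nat -> R }.

(* The first n stages [:: k_0; ...; k_(n-1)] of one step of size h from
   (t, v). *)
Fixpoint rk_k (rk : explicit_rk) {d : nat} (g : R -> 'cV[R]_d -> 'cV[R]_d)
    (t : R) (v : 'cV[R]_d) (h : R) (n : nat) : seq 'cV[R]_d :=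
  if n is i.+1 then
    let ks := rk_k rk g t v h i in
    rcons ks (g (t + rk_c rk i * h)
                (v + h *: \sum_(j < i) rk_a rk i j *: ks`_j))
  else [::].

Definition rk_increment (rk : explicit_rk) {d : nat}
    (g : R -> 'cV[R]_d -> 'cV[R]_d) (t : R) (v : 'cV[R]_d) (h : R) :
    'cV[R]_d :=
  h *: \sum_(j < rk_stages rk)
         rk_b rk j *: (rk_k rk g t v h (rk_stages rk))`_j.

(* Order at least k: the local truncation error is O(h^(k+1)) for every
   initial value problem with smooth right-hand side, in every dimension. *)
Definition rk_order (rk : explicit_rk) (k : nat) : Prop :=
  forall (m : nat) (g : R -> 'cV[R]_m -> 'cV[R]_m),
    (forall l, classC l setT setT g) ->
  forall (tau eps : R) (v0 : 'cV[R]_m) (v : R -> 'cV[R]_m), 0 < eps ->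
    ode_solution g setT tau (tau + eps) v0 v ->
  exists K h0 : R, 0 < h0 <= eps /\ forall h, 0 < h <= h0 ->
    `|v (tau + h) - (v0 + rk_increment rk g tau v0 h)| <= K * h ^+ k.+1.

End RungeKutta.

Arguments explicit_rk R : clear implicits.

Section Scheme.
Context {R : realType} {d : nat}.

Definition is_partition (t0 T h : R) (N : nat) (t : nat -> R) : Prop :=
  [/\ t 0%N = t0, t N = T
    & forall n, (n < N)%N -> 0 < t n.+1 - t n <= h].

Definition stage_times_in (rk : explicit_rk R) (t0 T : R) (N : nat)
    (t : nat -> R) : Prop :=
  forall n i, (n < N)%N -> (i < rk_stages rk)%N ->
    t0 <= t n + rk_c rk i * (t n.+1 - t n) <= T.

Definition llrk_scheme (rk : explicit_rk R) (I : set R)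
    (f : R -> 'cV[R]_d -> 'cV[R]_d) (ph : R -> 'cV[R]_d -> R -> 'cV[R]_d)
    (x0 : 'cV[R]_d) (N : nat) (t : nat -> R) (y : nat -> 'cV[R]_d) : Prop :=
  y 0%N = x0 /\ forall n, (n < N)%N ->
    let hn := t n.+1 - t n in
    y n.+1 = y n + ph (t n) (y n) hn
             + rk_increment rk (aux_rhs I f ph (t n) (y n)) (t n) 0 hn.

Definition llrk_global_error (rk : explicit_rk R) (t0 T : R)
    (f : R -> 'cV[R]_d -> 'cV[R]_d) (ph : R -> 'cV[R]_d -> R -> 'cV[R]_d)
    (x0 : 'cV[R]_d) (x : R -> 'cV[R]_d) (nu : 'cV[R]_d -> R) (k : nat) : Prop :=
  exists M h0 : R, 0 < M /\ 0 < h0 /\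
  forall h : R, 0 < h < 1 -> h < h0 ->
  forall (N : nat) (t : nat -> R),
    is_partition t0 T h N t -> stage_times_in rk t0 T N t ->
  forall y : nat -> 'cV[R]_d, llrk_scheme rk `[t0, T] f ph x0 N t y ->
  forall n, (n <= N)%N -> nu (x (t n) - y n) <= M * h ^+ k.

End Scheme.

(* Main.v *)
(* The local error is only needed along the exact solution, since the scheme is
   Lipschitz in y with constant 1 + O(h_n); a discrete Gronwall argument, which
   also keeps the numerical solution in a tube around x, then gives the bound.

   Order condition for a field of finite smoothness, uniformly in the base point:
   near (t, x(t)), f is a polynomial W up to O(r^k), Picard iteration on W yields
   a polynomial X with x(t + s) - x(t) = X(s) + O(s^(k+1)), and the Pade
   approximation agrees with a Taylor polynomial Phi up to O(s^(k+1)). Correcting W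
   by terms of order O(s^k) makes X - Phi the exact solution of a polynomial
   auxiliary field, to which the order condition applies. The resulting error is a
   polynomial in h: its coefficients up to h^gamma vanish for each base point, the
   others are bounded uniformly in the base point. *)
Require Import Defs.
From mathcomp Require Import all_boot all_order all_algebra.
From mathcomp Require Import all_classical all_reals all_analysis.
From mathcomp Require Import ring lra.

Set Implicit Arguments.
Unset Strict Implicit.
Unset Printing Implicit Defensive.

Import Order.TTheory GRing.Theory Num.Theory.
Import numFieldNormedType.Exports.

Local Open Scope classical_set_scope.
Local Open Scope ring_scope.

(** * Matrix norms *)

Section MatrixNorm.
Context {R : realType}.

(** The condition [rk_order] concerns one smooth field on the whole space at a time, with constants
    [K] and [h0] depending on that field, whereas the auxiliary field varies with the base point,
    has finitely many derivatives and is controlled only near the solution, relative to [[t0, T]].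
    Polynomial fields are smooth everywhere, and they make the Runge-Kutta increment a polynomial in
    [h], since explicit stages only compose and combine. The corrected field is [G(s, xi) = W(s, Phi
    + xi) - W(s, X) + (X - Phi)']: at [xi = X - Phi] its first two terms cancel.

    The exponent [scaling] is integer-valued and jumps as the matrix varies; but it is 0 for small
    matrices, so for small steps the scaled and squared map is the plain Pade quotient, which is
    Lipschitz near 0.

    The Gronwall argument confines the numerical solution only if [h^k] tends to 0, that is if
    [k > 0]. For [p + q = 0] the claim is that the error is bounded, which is proved separately.

    All estimates use the largest absolute entry as norm; [nu] and the norm defining the scaling
    enter through equivalence of norms. *)

Lemma coord_norm_le m n (A : 'M[R]_(m, n)) i j : `|A i j| <= `|A|.
Proof.
rewrite [leRHS]/Num.Def.normr/= mx_normrE.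
exact: (@le_bigmax _ _ _ _ (fun ij => `|A ij.1 ij.2|) (i, j)).
Qed.

Lemma mx_norm_le m n (A : 'M[R]_(m, n)) (c : R) :
  0 <= c -> (forall i j, `|A i j| <= c) -> `|A| <= c.
Proof.
move=> c0 h; rewrite /Num.Def.normr/= mx_normrE.
by rewrite bigmax_le// => i _; exact: h.
Qed.

Lemma cV_norm_le n (v : 'cV[R]_n) (c : R) :
  0 <= c -> (forall i, `|v i 0| <= c) -> `|v| <= c.
Proof. by move=> c0 h; apply: mx_norm_le => // i j; rewrite ord1. Qed.

(** The largest absolute entry is not a submultiplicative norm: an entry of the product is a sum of
    [n] terms, hence the factor. *)
Lemma mulmx_norm_le m n p (A : 'M[R]_(m, n)) (B : 'M[R]_(n, p)) :
  `|A *m B| <= n%:R * `|A| * `|B|.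
Proof.
apply: mx_norm_le => [|i j]; first by rewrite !mulr_ge0.
rewrite mxE (le_trans (ler_norm_sum _ _ _))//.
apply: (@le_trans _ _ (\sum_(k < n) `|A| * `|B|)); last first.
  by rewrite sumr_const card_ord -mulrA mulr_natl.
by apply: ler_sum => k _; rewrite normrM ler_pM// coord_norm_le.
Qed.

Lemma vector_norm_ge0 m (nu : 'cV[R]_m -> R) : vector_norm nu ->
  forall v, 0 <= nu v.
Proof.
move=> [tri sc _] v; have := tri v (- v).
have -> : nu (- v) = nu v by rewrite -scaleN1r sc normrN1 mul1r.
have -> : nu (v - v) = 0 by rewrite subrr -(scale0r 0) sc normr0 mul0r.
by lra.
Qed.

Lemma vector_norm_le m (nu : 'cV[R]_m -> R) : vector_norm nu ->
  exists C : R, 0 <= C /\ forall v, nu v <= C * `|v|.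
Proof.
move=> hnu; have nu_ge0 := vector_norm_ge0 hnu; case: hnu => tri sc _.
exists (\sum_i nu (delta_mx i 0)); split; first exact: sumr_ge0.
move=> v; have -> : nu v = nu (\sum_i v i 0 *: delta_mx i 0).
  congr nu; rewrite {1}[v]matrix_sum_delta; apply: eq_bigr => i _.
  by rewrite big_ord_recl big_ord0 addr0.
rewrite mulr_suml.
elim/big_ind2: _ => [|a b c e ab ce|i _].
- by rewrite -(scale0r 0) sc normr0 mul0r.
- by rewrite (le_trans (tri _ _))// lerD.
- by rewrite sc mulrC ler_wpM2l// coord_norm_le.
Qed.

Lemma lip_continuous m n (F : 'M[R]_(m, n) -> R) (C : R) :
  (forall u v, `|F u - F v| <= C * `|u - v|) -> continuous F.
Proof.
move=> lip u; apply/(@cvgrPdist_le _ _ _ (nbhs u) _ F (F u)) => e e0.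
apply/nbhs_ballP; exists (e / (`|C| + 1)) => /=; first by rewrite divr_gt0.
move=> v; rewrite -ball_normE /ball_ /= ltr_pdivlMr// => uv.
apply: (le_trans (lip _ _)).
have := ler_norm C; have : 0 <= `|u - v| by [].
by nra.
Qed.

(** Equivalence of norms by compactness: [nu] is Lipschitz, hence has a minimum on the unit sphere,
    positive because [nu] vanishes only at 0; the inverse of this minimum is the constant. The
    sphere is taken in row vectors to fit the extreme value theorem that is applied. *)
Lemma norm_le_vector_norm m (nu : 'cV[R]_m -> R) : vector_norm nu ->
  exists C : R, 0 <= C /\ forall v, `|v| <= C * nu v.
Proof.
move=> hnu; have [C [C0 hC]] := vector_norm_le hnu.
have nu_ge0 := vector_norm_ge0 hnu; case: hnu => tri sc sep.
have nuN v : nu (- v) = nu v by rewrite -scaleN1r sc normrN1 mul1r.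
pose S := [set w : 'rV[R]_m | `|w| = 1].
have nuc : continuous (fun w : 'rV[R]_m => nu w^T).
  have lip u v : `|nu u^T - nu v^T| <= C * `|u - v|.
    have trN (w : 'rV[R]_m) : `|w^T| <= `|w|.
      by apply: mx_norm_le => // i j; rewrite mxE coord_norm_le.
    have h1 := tri (u^T - v^T) v^T; have h2 := tri (v^T - u^T) u^T.
    rewrite !subrK in h1 h2.
    have e : nu (v^T - u^T) = nu (u^T - v^T) by rewrite -nuN opprB.
    have h3 := hC (u^T - v^T).
    have h4 : `|u^T - v^T| <= `|u - v| by rewrite -linearB trN.
    have := ler_wpM2l C0 h4; rewrite e in h2.
    by rewrite ler_norml => h; apply/andP; split; lra.
  exact: lip_continuous lip.
have Sc : compact S.
  apply: bounded_closed_compact.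
    by exists 1; split=> // M M1 w /= ->; exact: ltW.
  have -> : S = (fun w : 'rV[R]_m => `|w|) @^-1` [set 1] by [].
  by apply: closed_comp => [w _|]; [exact: norm_continuous | exact: closed_eq].
have scv (v : 'cV[R]_m) : v != 0 -> S (`|v|^-1 *: v^T).
  move=> v0; rewrite /S /= normrZ normfV normr_id.
  have -> : `|v^T| = `|v|.
    by apply/eqP; rewrite eq_le; apply/andP; split;
      apply: mx_norm_le => // i j; rewrite ?mxE ?coord_norm_le//;
      have := coord_norm_le v^T j i; rewrite mxE.
  by rewrite mulVf// normr_eq0.
(* In dimension 0 the sphere is empty and every vector is 0. *)
have [[w Sw]|/forallNP noS] := pselect (exists w, S w); last first.
  exists 0; split => // v; have [->|v0] := eqVneq v 0; first by rewrite normr0 mul0r.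
  by case: (noS (`|v|^-1 *: v^T)); exact: scv.
have [| | |c Sc' hc] := @EVT_min_rV _ _ (fun w : 'rV[R]_m => nu w^T) S.
  by exists w.
  exact: Sc.
  exact: continuous_subspaceT.
have c0 : 0 < nu c^T.
  rewrite lt_neqAle nu_ge0 andbT eq_sym; apply/eqP => /sep c0.
  have : c = 0 by rewrite -[c]trmxK c0 trmx0.
  by move: Sc' => /set_mem /=; rewrite /S /= => + ce; rewrite ce normr0 => /eqP;
    rewrite eq_sym oner_eq0.
exists (nu c^T)^-1; split; first by rewrite invr_ge0 ltW.
move=> v; have [->|v0] := eqVneq v 0; first by rewrite normr0 mulr_ge0// invr_ge0.
have := hc (`|v|^-1 *: v^T) (mem_set (scv _ v0)).
rewrite linearZ /= trmxK sc normfV normr_id => h.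
have v1 : 0 < `|v| by rewrite normr_gt0.
by rewrite mulrC ler_pdivlMr// mulrC -ler_pdivlMr// mulrC.
Qed.

(** When [A] is small the exponent 0 already meets the condition on the induced norm, so it is the
    smallest one. The constant comes from [nu (A v) <= C |A v| <= C m |A| c] for [nu v = 1]. *)
Lemma scaling_eq0 m (nu : 'cV[R]_m -> R) : vector_norm nu ->
  exists e : R, 0 < e /\ forall A : 'M[R]_m, `|A| <= e -> scaling nu A = 0%N.
Proof.
move=> hnu; have [C [C0 hC]] := vector_norm_le hnu.
have [c [c0 hc]] := norm_le_vector_norm hnu.
pose K := C * (m%:R * c); have K0 : 0 <= K by rewrite !mulr_ge0.
exists (2^-1 / (K + 1)); split; first by rewrite divr_gt0// ltr_wpDl.
move=> A hA.
have h0 : induced_norm nu (2%:R ^- 0 *: A) <= 2^-1.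
  rewrite expr0 invr1 scale1r /induced_norm.
  (* Without a vector of norm 1 the supremum is over the empty set, where [sup] is 0. *)
  have [[v nuv]|/forallNP no] := pselect (exists v, nu v = 1); last first.
    by rewrite (_ : [set _ | _ in _] = set0) ?sup0 ?invr_ge0//;
      apply/seteqP; split=> // z [v /= /no].
  apply: ge_sup; first by exists (nu (A *m v)); exists v.
  move=> _ [u /= nuu <-]; apply: (le_trans (hC _)).
  have := mulmx_norm_le A u; have := hc u; rewrite nuu mulr1 => hu hAu.
  have : C * `|A *m u| <= K * `|A|.
    rewrite /K -mulrA ler_wpM2l// (le_trans hAu)// -!mulrA ler_wpM2l//.
    by rewrite mulrC ler_wpM2r.
  move=> /le_trans; apply.
  move: hA; rewrite ler_pdivlMr; last by lra.
  by have : 0 <= `|A| by []; nra.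
rewrite /scaling; case: xgetP => [k _ [_ /(_ 0%N h0)]|].
  by rewrite leqn0 => /eqP.
by move=> /(_ 0%N) []; split.
Qed.

(** From [|X| <= |A X| + |(A - 1) X| <= |A X| + |X| / 2] follows that [A] is injective, and the same
    inequality at [X = A^-1] bounds the inverse. *)
Lemma near1_unitmx m (A : 'M[R]_m) : m%:R * `|A - 1%:M| <= 2^-1 ->
  A \in unitmx /\ `|invmx A| <= 2.
Proof.
move=> hA.
have key p (X : 'M[R]_(m, p)) : `|X| <= `|A *m X| + 2^-1 * `|X|.
  have := mulmx_norm_le (A - 1%:M) X; rewrite mulmxBl mul1mx => h.
  have h1 := ler_normB (A *m X) (A *m X - X).
  have h2 := ler_wpM2r (normr_ge0 X) hA.
  by move: h1; rewrite opprB addrCA subrr addr0; lra.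
have uA : A \in unitmx.
  rewrite -unitmx_tr -row_free_unit -kermx_eq0; apply/eqP/row_matrixP => i.
  have : row i (kermx A^T) *m A^T = 0 by rewrite -row_mul mulmx_ker row0.
  set v := row i _ => /(congr1 trmx); rewrite trmx_mul trmxK trmx0 => Av.
  have := key _ v^T; rewrite Av normr0 => hv.
  have /eqP : `|v^T| = 0 by have : 0 <= `|v^T| by []; lra.
  by rewrite normr_eq0 => /eqP /(congr1 trmx); rewrite trmxK trmx0 row0.
split=> //; have := key _ (invmx A); rewrite mulmxV// => h.
have : `|1%:M : 'M[R]_m| <= 1.
  by apply: mx_norm_le => // i j; rewrite mxE; case: eqP; rewrite ?normr1 ?normr0.
by lra.
Qed.

End MatrixNorm.

(** * Pade approximation *)

Section PadeTheory.
Context {R : realType}.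

(** Inclusion-exclusion for the [m]-subsets of a set of [p + q] points that avoid [q] given ones.
    The induction uses Pascal's rule: the sum at [(q+1, p, m+1)] is the one at [(q, p+1, m+1)] minus
    the one at [(q, p, m)]. *)
Lemma alternating_binomial_sum (q p m : nat) :
  \sum_(j < m.+1) (-1) ^+ j * 'C(q, j)%:R * 'C(p + q - j, m - j)%:R
    = 'C(p, m)%:R :> R.
Proof.
elim: q p m => [|q IH] p m.
  rewrite big_ord_recl /= expr0 bin0 !mul1r addn0 !subn0 big1 ?addr0// => i _.
  by rewrite bin0n mulr0 mul0r.
case: m => [|m].
  by rewrite big_ord_recl big_ord0 /= expr0 !bin0 !mul1r addr0.
have := IH p.+1 m.+1; rewrite big_ord_recl [in RHS]binS natrD => e1.
have e2 := IH p m.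
rewrite big_ord_recl /=.
transitivity ('C(p, m.+1)%:R + 'C(p, m)%:R - 'C(p, m)%:R : R); last first.
  by rewrite addrK.
rewrite -e1 -[X in _ - X]e2 -sumrN -addrA; congr (_ + _).
  by rewrite !bin0 addSnnS.
rewrite -big_split /=; apply: eq_bigr => i _.
rewrite /bump /= !add1n binS natrD addnS addSn !subSS exprS.
by ring.
Qed.

Lemma ffactnD n j i : (n ^_ (j + i) = n ^_ j * (n - j) ^_ i)%N.
Proof.
elim: i => [|i IH]; first by rewrite addn0 ffactn0 muln1.
by rewrite addnS !ffactnSr IH subnDA mulnA.
Qed.

(** The defining property of the Pade approximation: [D_{p,q}(z) e^z] and [N_{p,q}(z)] have the same
    coefficients up to degree [p + q]. Multiplying by the falling factorial [(p + q) ^_ m] turns the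
    convolution into the alternating binomial sum. *)
Lemma pade_coef_conv (p q m : nat) : (m <= p + q)%N ->
  \sum_(j < m.+1) ((-1) ^+ j * ((q ^_ j)%:R / ((p + q) ^_ j)%:R / j`!%:R)) /
     (m - j)`!%:R = (p ^_ m)%:R / ((q + p) ^_ m)%:R / m`!%:R :> R.
Proof.
move=> mpq.
have ff (n j : nat) : (j <= n)%N -> (n ^_ j)%:R != 0 :> R.
  by move=> jn; rewrite pnatr_eq0 -lt0n ffact_gt0.
have f0 (n : nat) : n`!%:R != 0 :> R by rewrite pnatr_eq0 -lt0n fact_gt0.
apply: (mulIf (ff _ _ mpq)); rewrite mulr_suml (addnC q) mulrAC.
rewrite divfK ?ff//.
transitivity ('C(p, m)%:R : R); last first.
  by rewrite -bin_ffact natrM mulfK.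
rewrite -(alternating_binomial_sum q p m); apply: eq_bigr => -[j /= jm] _.
rewrite ltnS in jm.
have -> : (p + q) ^_ m = ((p + q) ^_ j * (p + q - j) ^_ (m - j))%N.
  by rewrite -{1}(subnKC jm) ffactnD.
rewrite -(bin_ffact q j) -(bin_ffact (p + q - j) (m - j)) !natrM.
have h1 := ff _ _ (leq_trans jm mpq); have h2 := f0 j; have h3 := f0 (m - j)%N.
by field; rewrite h1 h2 h3.
Qed.

Lemma mulmx_norm_le2 m n r (A : 'M[R]_(m, n)) (B : 'M[R]_(n, r)) (a b : R) :
  `|A| <= a -> `|B| <= b -> `|A *m B| <= n%:R * a * b.
Proof.
move=> ha hb; apply: (le_trans (mulmx_norm_le _ _)).
by rewrite ler_pM ?mulr_ge0// ler_wpM2l.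
Qed.

Lemma expmx_norm_le m (A : 'M[R]_m) j : `|A ^+ j| <= (m%:R * `|A|) ^+ j.
Proof.
elim: j => [|j IH].
  rewrite !expr0; apply: mx_norm_le => // a b.
  by rewrite mxE; case: eqP; rewrite ?normr1 ?normr0.
rewrite !exprS; apply: (le_trans (mulmx_norm_le _ _)).
by rewrite ler_wpM2l// mulr_ge0.
Qed.

Lemma expmx_lip m j : exists C : R, 0 <= C /\ forall A B : 'M[R]_m,
  `|A| <= 1 -> `|B| <= 1 -> `|A ^+ j - B ^+ j| <= C * `|A - B|.
Proof.
elim: j => [|j [C [C0 IH]]].
  by exists 0; split=> // A B _ _; rewrite !expr0 subrr normr0 mul0r.
exists (m%:R * m%:R ^+ j + m%:R * C); split; first by rewrite addr_ge0 ?mulr_ge0.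
move=> A B A1 B1.
have -> : A ^+ j.+1 - B ^+ j.+1 = (A - B) * A ^+ j + B * (A ^+ j - B ^+ j).
  by rewrite !exprS mulrBl mulrBr addrA subrK.
apply: (le_trans (ler_normD _ _)).
have pA : `|A ^+ j| <= m%:R ^+ j.
  rewrite (le_trans (expmx_norm_le _ _))// lerXn2r ?nnegrE ?mulr_ge0//.
  by rewrite ler_piMr.
have h1 := mulmx_norm_le2 (lexx `|A - B|) pA.
have h2 := mulmx_norm_le2 B1 (IH _ _ A1 B1).
apply: (le_trans (lerD h1 h2)); rewrite le_eqVlt; apply/orP; left; apply/eqP.
by ring.
Qed.

Lemma mxpoly_lip m n (c : nat -> R) : exists C : R, 0 <= C /\
  forall A B : 'M[R]_m, `|A| <= 1 -> `|B| <= 1 ->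
  `|\sum_(j < n) c j *: A ^+ j - \sum_(j < n) c j *: B ^+ j| <= C * `|A - B|.
Proof.
elim: n => [|n [C [C0 IH]]].
  by exists 0; split=> // A B _ _; rewrite !big_ord0 subrr normr0 mul0r.
have [K [K0 hK]] := expmx_lip m n.
exists (C + `|c n| * K); split; first by rewrite addr_ge0 ?mulr_ge0.
move=> A B A1 B1; rewrite !big_ord_recr /= opprD addrACA -scalerBr mulrDl.
apply: (le_trans (ler_normD _ _)); rewrite lerD ?IH//.
by rewrite normrZ -mulrA ler_wpM2l// hK.
Qed.

Lemma mxpoly_bound m n (c : nat -> R) : exists C : R, 0 <= C /\
  forall A : 'M[R]_m, `|A| <= 1 -> `|\sum_(j < n) c j *: A ^+ j| <= C.
Proof.
exists (\sum_(j < n) `|c j| * m%:R ^+ j); split.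
  by apply: sumr_ge0 => i _; rewrite mulr_ge0.
move=> A A1; apply: (le_trans (ler_norm_sum _ _ _)); apply: ler_sum => j _.
rewrite normrZ ler_wpM2l// (le_trans (expmx_norm_le _ _))//.
by rewrite lerXn2r ?nnegrE ?mulr_ge0// ler_piMr.
Qed.

Lemma pade_num0 p q m : pade_num p q (0 : 'M[R]_m) = 1.
Proof.
rewrite /pade_num big_ord_recl /= expr0 !ffactn0 fact0 !divr1 scale1r big1 ?addr0//.
by move=> i _; rewrite expr0n /= scaler0.
Qed.

Lemma pade0 p q m : pade p q (0 : 'M[R]_m) = 1.
Proof. by rewrite /pade /pade_den oppr0 !pade_num0 invmx1 mulmx1. Qed.

(** The denominator is 1 at the zero matrix and Lipschitz near it, so on a small ball it is close
    enough to 1 for [near1_unitmx]. *)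
Lemma pade_den_inv p q m : exists e : R, 0 < e <= 1 /\
  forall A : 'M[R]_m, `|A| <= e ->
    pade_den p q A \in unitmx /\ `|invmx (pade_den p q A)| <= 2.
Proof.
have [C [C0 hC]] := mxpoly_lip m q.+1
  (fun j => (q ^_ j)%:R / ((p + q) ^_ j)%:R / j`!%:R).
pose K := m%:R * C.
have K0 : 0 <= K by rewrite mulr_ge0.
exists (2^-1 / (K + 1)); split.
  apply/andP; split; first by rewrite divr_gt0// ltr_wpDl.
  rewrite ler_pdivrMr; first by nra.
  by rewrite ltr_wpDl.
move=> A hA; apply: near1_unitmx.
move: hA; rewrite ler_pdivlMr ?ltr_wpDl// => hA.
have A0 : 0 <= `|A| by [].
have A1 : `|- A| <= 1 by rewrite normrN; nra.
have := hC (- A) 0 A1; rewrite normr0 subr0 normrN => /(_ ler01) h.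
have := pade_num0 q p m; rewrite {1}/pade_num => e; rewrite e in h.
have := ler_wpM2l (ler0n R m) h; rewrite mulrA => h1.
apply: (le_trans h1); rewrite -/K; nra.
Qed.

Lemma invmx_sub m (A B : 'M[R]_m) : A \in unitmx -> B \in unitmx ->
  invmx A - invmx B = invmx A *m (B - A) *m invmx B.
Proof.
move=> uA uB; rewrite mulmxBr mulmxBl -mulmxA mulmxV// mulmx1.
by rewrite mulVmx// mul1mx.
Qed.

(** The quotient is treated as a product, the inverses of the denominators being compared through
    [A^-1 - B^-1 = A^-1 (B - A) B^-1]. *)
Lemma pade_lip p q m : exists e C : R, [/\ 0 < e, e <= 1, 0 <= C &
  forall A B : 'M[R]_m, `|A| <= e -> `|B| <= e ->
    `|pade p q A - pade p q B| <= C * `|A - B|].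
Proof.
have [e [/andP[e0 e1] he]] := pade_den_inv p q m.
have [Cn [Cn0 hCn]] := mxpoly_lip m p.+1
  (fun j => (p ^_ j)%:R / ((q + p) ^_ j)%:R / j`!%:R).
have [Bn [Bn0 hBn]] := mxpoly_bound m p.+1
  (fun j => (p ^_ j)%:R / ((q + p) ^_ j)%:R / j`!%:R).
have [Cd [Cd0 hCd]] := mxpoly_lip m q.+1
  (fun j => (q ^_ j)%:R / ((p + q) ^_ j)%:R / j`!%:R).
exists e, (m%:R * Cn * 2 + m%:R * Bn * (m%:R * (m%:R * 2 * Cd) * 2)).
split=> //; first by rewrite addr_ge0// !mulr_ge0.
move=> A B Ae Be.
have [uA nA] := he _ Ae; have [uB nB] := he _ Be.
have A1 := le_trans Ae e1; have B1 := le_trans Be e1.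
have -> : pade p q A - pade p q B =
    (pade_num p q A - pade_num p q B) *m invmx (pade_den p q A)
    + pade_num p q B *m (invmx (pade_den p q A) - invmx (pade_den p q B)).
  by rewrite /pade mulmxBl mulmxBr addrA subrK.
apply: (le_trans (ler_normD _ _)).
have h1 := mulmx_norm_le2 (hCn _ _ A1 B1) nA.
have A1' : `|- A| <= 1 by rewrite normrN.
have B1' : `|- B| <= 1 by rewrite normrN.
have h2 : `|pade_den p q B - pade_den p q A| <= Cd * `|A - B|.
  by apply: (le_trans (hCd _ _ B1' A1')); rewrite opprK addrC.
have h3 := mulmx_norm_le2 (hBn _ B1)
  (mulmx_norm_le2 (mulmx_norm_le2 nA h2) nB).
rewrite invmx_sub//; apply: (le_trans (lerD h1 h3)).
by lra.
Qed.

Lemma horner_mx_poly m (A : 'M[R]_m.+1) n (c : nat -> R) :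
  horner_mx A (\poly_(j < n) c j) = \sum_(j < n) c j *: A ^+ j.
Proof.
rewrite poly_def rmorph_sum; apply: eq_bigr => j _.
by rewrite /= horner_mxZ rmorphXn /= horner_mx_X.
Qed.

(** With [E] the exponential series cut after degree [k], the polynomial [N - D E] is divisible by
    [X^(k+1)]. Substituting [A] and dividing by the denominator leaves the error
    [Q(A) A^(k+1) D(A)^-1]. *)
Lemma pade_exp_error p q m k : (k <= p + q)%N -> exists e C : R,
  [/\ 0 < e, 0 <= C & forall A : 'M[R]_m, `|A| <= e ->
  `|pade p q A - \sum_(j < k.+1) (j`!%:R)^-1 *: A ^+ j| <= C * `|A| ^+ k.+1].
Proof.
(* Polynomials are evaluated by [horner_mx] at matrices of positive size, so size 0 is set apart. *)
move=> kpq; case: m => [|m].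
  by exists 1, 0; split=> // A _; rewrite mul0r [X in `|X|](flatmx0 _) normr0.
have [e [/andP[e0 e1] he]] := pade_den_inv p q m.+1.
pose cN j : R := (p ^_ j)%:R / ((q + p) ^_ j)%:R / j`!%:R.
pose cD j : R := (-1) ^+ j * ((q ^_ j)%:R / ((p + q) ^_ j)%:R / j`!%:R).
pose cE j : R := (j`!%:R)^-1.
pose N := \poly_(j < p.+1) cN j.
pose D := \poly_(j < q.+1) cD j.
pose E := \poly_(j < k.+1) cE j.
have Ncoef j : N`_j = cN j.
  by rewrite coef_poly ltnS; case: leqP => // jp; rewrite /cN ffact_small// !mul0r.
have Dcoef j : D`_j = cD j.
  rewrite coef_poly ltnS; case: leqP => // jq.
  by rewrite /cD ffact_small// !mul0r mulr0.
pose Q := drop_poly k.+1 (N - D * E).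
have NDE : N = D * E + Q * 'X^(k.+1).
  suff h : take_poly k.+1 (N - D * E) = 0.
    by rewrite -[X in _ = _ + X]add0r -h poly_take_drop addrC subrK.
  apply/polyP => j; rewrite coef_take_poly coef0 ltnS; case: leqP => // jk.
  rewrite coefB coefM Ncoef; apply/eqP; rewrite subr_eq0 eq_sym; apply/eqP.
  rewrite /cN -pade_coef_conv ?(leq_trans jk)//; apply: eq_bigr => i _.
  by rewrite Dcoef coef_poly ltnS (leq_trans (leq_subr _ _) jk).
have [B [B0 hB]] := mxpoly_bound m.+1 (size Q) (fun j => Q`_j).
exists e, (m.+1%:R * (m.+1%:R * B * m.+1%:R ^+ k.+1) * 2).
split=> // [|A Ae]; first by rewrite !mulr_ge0// exprn_ge0.
have [uA nA] := he _ Ae; have A1 := le_trans Ae e1.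
have eN : pade_num p q A = horner_mx A N by rewrite horner_mx_poly.
have eD : pade_den p q A = horner_mx A D.
  rewrite horner_mx_poly; apply: eq_bigr => j _.
  by rewrite -scaleN1r exprZn scalerA mulrC.
have eQ : `|horner_mx A Q| <= B.
  by rewrite -[Q]coefK horner_mx_poly hB.
rewrite -(horner_mx_poly A k.+1 cE) -/E.
have -> : pade p q A - horner_mx A E =
    horner_mx A Q *m A ^+ k.+1 *m invmx (pade_den p q A).
  rewrite /pade eN NDE mulrC rmorphD /= !rmorphM /= rmorphXn /= horner_mx_X.
  rewrite -eD mulmxDl -[X in X + _ - _]mulmxA mulmxV// mulmx1.
  by rewrite addrAC subrr add0r.
have h := mulmx_norm_le2 (mulmx_norm_le2 eQ (expmx_norm_le A k.+1)) nA.
apply: (le_trans h); rewrite exprMn le_eqVlt; apply/orP; left; apply/eqP.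
by ring.
Qed.

End PadeTheory.

(** * Derivatives relative to a set, and tubes around a curve *)

Section WithinCalculus.
Context {R : realType}.

Lemma within_nbhsP (X V : normedModType R) (f : X -> V) (A : set X) (x : X) (l : V) :
  f y @[y --> within A (nbhs x)] --> l <->
  forall e : R, 0 < e -> exists2 r : R, 0 < r &
    forall y, A y -> `|x - y| < r -> `|l - f y| <= e.
Proof.
split=> [/cvgrPdist_le h e e0|h].
  have /nbhs_ballP[r r0 hr] := h e e0.
  by exists r => // y Ay xy; apply: hr => //; rewrite -ball_normE.
apply/cvgrPdist_le => e /h[r r0 hr]; apply/nbhs_ballP; exists r => // y.
by rewrite -ball_normE => xy Ay; exact: hr.
Qed.

Lemma within_dnbhsP (V : normedModType R) (f : R -> V) (A : set R) (x : R) (l : V) :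
  f y @[y --> within A x^'] --> l <->
  forall e : R, 0 < e -> exists2 r : R, 0 < r &
    forall y, A y -> y != x -> `|x - y| < r -> `|l - f y| <= e.
Proof.
split=> [/cvgrPdist_le h e e0|h].
  have /nbhs_ballP[r r0 hr] := h e e0.
  by exists r => // y Ay yx xy; apply: hr => //; rewrite -ball_normE.
apply/cvgrPdist_le => e /h[r r0 hr]; apply/nbhs_ballP; exists r => // y.
by rewrite -ball_normE => xy yx Ay; exact: hr.
Qed.

Lemma within_continuousP (X V : normedModType R) (f : X -> V) (A : set X) :
  {within A, continuous f} <->
  forall x, A x -> forall e : R, 0 < e -> exists2 r : R, 0 < r &
    forall y, A y -> `|x - y| < r -> `|f x - f y| <= e.
Proof.
rewrite subspace_continuousP; split=> h x Ax; last exact/within_nbhsP/h.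
by have /within_nbhsP := h x Ax.
Qed.

(** The derivative as a relation carrying its value: [lim] says something only once convergence is
    known, and the value is unique only at limit points of [J]. *)
Definition has_derive_within {V : normedModType R} (J : set R) (u : R -> V)
    (t : R) (l : V) : Prop :=
  (s - t)^-1 *: (u s - u t) @[s --> within J t^'] --> l.

Lemma derive_withinP {V : normedModType R} (J : set R) (u : R -> V) (t : R) :
  derivable_within J u t -> has_derive_within J u t (derive_within J u t).
Proof. by []. Qed.

Lemma has_derive_within_continuous {V : normedModType R} (J : set R) (u : R -> V)
    (t : R) (l : V) : has_derive_within J u t l ->
  forall e : R, 0 < e -> exists2 r : R, 0 < r &
    forall s, J s -> `|t - s| < r -> `|u t - u s| <= e.
Proof.
move=> /within_dnbhsP h e e0; have [r r0 hr] := h 1 ltr01.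
have L0 : 0 < `|l| + 1 by rewrite ltr_wpDl.
exists (Num.min r (e / (`|l| + 1))); first by rewrite lt_min r0 divr_gt0.
move=> s Js; rewrite lt_min ltr_pdivlMr// => /andP[tsr tse].
have [->|st] := eqVneq s t; first by rewrite subrr normr0 ltW.
have := hr s Js st tsr; rewrite distrC => h1.
have : `|(s - t)^-1 *: (u s - u t)| <= `|l| + 1.
  by have := lerB_normD ((s - t)^-1 *: (u s - u t)) (- l); rewrite normrN; lra.
rewrite normrZ normfV ler_pdivrMl; last by rewrite normr_gt0 subr_eq0.
rewrite (distrC s) (distrC (u s)) => /le_trans; apply.
exact: ltW.
Qed.

Lemma has_derive_within_coord m (J : set R) (u : R -> 'cV[R]_m) t (l : 'cV[R]_m) i :
  has_derive_within J u t l -> has_derive_within J (fun s => u s i 0) t (l i 0).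
Proof.
move=> /within_dnbhsP h; apply/within_dnbhsP => e /h[r r0 hr].
exists r => // s Js st ts; apply: le_trans (hr s Js st ts).
by have := coord_norm_le (l - (s - t)^-1 *: (u s - u t)) i 0; rewrite !mxE.
Qed.

Lemma has_derive_within_cV m (J : set R) (u : R -> 'cV[R]_m) t (l : 'cV[R]_m) :
  (forall i, has_derive_within J (fun s => u s i 0) t (l i 0)) ->
  has_derive_within J u t l.
Proof.
move=> h; apply/within_dnbhsP => e e0.
have /choice[r hr] : forall i, exists r : R, 0 < r /\ forall y, J y -> y != t ->
    `|t - y| < r -> `|l i 0 - (y - t)^-1 * (u y i 0 - u t i 0)| <= e.
  by move=> i; have /within_dnbhsP/(_ e e0)[r r0 hr] := h i; exists r.
exists (\big[Num.min/1]_i r i).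
  by apply/bigmin_gtP; split=> // i _; have [] := hr i.
move=> s Js st ts; apply: cV_norm_le => [|i]; first exact: ltW.
rewrite !mxE; have [_ ] := hr i; apply=> //.
by apply: (lt_le_trans ts); exact: bigmin_le_cond.
Qed.

Lemma derive_epsP (X V : normedModType R) (g : X -> V) (a v : X) :
  derivable g a v <-> forall e : R, 0 < e -> exists2 r : R, 0 < r &
    forall h, h != 0 -> `|h| < r ->
      `|'D_v g a - h^-1 *: (g (h *: v + a) - g a)| <= e.
Proof.
split=> [/cvgrPdist_le dg e e0|dg].
  have /nbhs_ballP[r r0 hr] := dg e e0.
  exists r => // h h0 hr'; apply: hr => //; rewrite -ball_normE /ball_ /=.
  by rewrite sub0r normrN.
apply/cvg_ex; exists ('D_v g a); apply/cvgrPdist_le => e /dg[r r0 hr].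
apply/nbhs_ballP; exists r => // h; rewrite -ball_normE /ball_ /= sub0r normrN.
by move=> hr0 h0; exact: hr.
Qed.

Lemma is_derive_eps (X V : normedModType R) (g : X -> V) (a v : X) (l : V) :
  (forall e : R, 0 < e -> exists2 r : R, 0 < r &
    forall h, h != 0 -> `|h| < r -> `|l - h^-1 *: (g (h *: v + a) - g a)| <= e) ->
  is_derive a v g l.
Proof.
move=> dg.
have cl : (fun h => h^-1 *: ((g \o shift a) (h *: v) - g a)) @ 0^' --> l.
  apply/cvgrPdist_le => e /dg[r r0 hr].
  apply/nbhs_ballP; exists r => // h; rewrite -ball_normE /ball_ /= sub0r normrN.
  by move=> hr0 h0; exact: hr.
by apply: DeriveDef; [apply/cvg_ex; exists l | exact: cvg_lim cl].
Qed.

Lemma has_derive_within_line (X V : normedModType R) (g : X -> V) (y v : X) (s : R) :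
  derivable g (s *: v + y) v ->
  has_derive_within setT (fun s => g (s *: v + y)) s ('D_v g (s *: v + y)).
Proof.
move=> /derive_epsP dg; apply/within_dnbhsP => e /dg[r r0 hr]; exists r => //.
move=> s' _ ss' s'r; have := hr (s' - s).
by rewrite subr_eq0 distrC scalerBl addrA subrK; apply.
Qed.

Lemma has_derive_within_interior (J : set R) (u : R -> R) (l : R) (a b t : R) :
  (forall s, a <= s <= b -> J s) -> a < t < b -> has_derive_within J u t l ->
  is_derive t 1 u l.
Proof.
move=> abJ /andP[ta tb] /within_dnbhsP h; apply: is_derive_eps => e /h[r r0 hr].
exists (Num.min r (Num.min (t - a) (b - t))); first by rewrite !lt_min r0 !subr_gt0 ta.
move=> k k0; rewrite !lt_min => /andP[kr /andP[ka kb]].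
have := hr (k *: 1 + t); rewrite addrK scaler1 => hk; apply: hk.
- apply: abJ; move: ka kb; rewrite !ltr_norml.
  by move=> /andP[? ?] /andP[? ?]; apply/andP; split; lra.
- by rewrite -subr_eq0 addrK.
- by rewrite distrC addrK.
Qed.

Lemma has_derive_within_horner (J : set R) (p : {poly R}) t :
  has_derive_within J (horner p) t p^`().[t].
Proof.
have /derive_epsP d := @derivable_horner _ p t.
apply/within_dnbhsP => e /d[r r0 hr]; exists r => // s _ st ts.
have := hr (s - t); rewrite subr_eq0 distrC scaler1 subrK => /(_ st ts).
by rewrite derivE derive1E.
Qed.

Lemma has_derive_withinB (V : normedModType R) J (u v : R -> V) t l m :
  has_derive_within J u t l -> has_derive_within J v t m ->
  has_derive_within J (fun s => u s - v s) t (l - m).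
Proof.
move=> hu hv; rewrite /has_derive_within.
have e s : u s - v s - (u t - v t) = (u s - u t) - (v s - v t).
  by rewrite !opprB addrACA [RHS]addrACA [- v s - _]addrC.
under eq_fun do rewrite e scalerBr.
exact: cvgB hu hv.
Qed.

(** The mean value theorem for [u - p]: inside the segment the derivative relative to [J] is the
    ordinary one, and at the end points continuity suffices. It stands in for integration, both in
    the Taylor estimates and in the Picard iteration. *)
Lemma mean_value_poly (J : set R) (u u' : R -> R) (p : {poly R}) (a b e : R) :
  (forall s, Num.min a b <= s <= Num.max a b -> J s) ->
  (forall s, Num.min a b <= s <= Num.max a b -> has_derive_within J u s (u' s)) ->
  (forall s, Num.min a b <= s <= Num.max a b -> `|u' s - p^`().[s]| <= e) ->
  `|u b - u a - (p.[b] - p.[a])| <= e * `|b - a|.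
Proof.
wlog ab : a b / a <= b => [hw|].
  have [ab|ba] := orP (le_total a b); first exact: hw.
  rewrite minC maxC => h1 h2 h3; rewrite distrC.
  have := hw b a ba h1 h2 h3.
  by rewrite (distrC a) -[u b - u a]opprB -[p.[b] - _]opprB opprK addrC.
rewrite min_l// max_r// => abJ du hp.
pose w s := u s - p.[s].
have dw s : a <= s <= b -> has_derive_within J w s (u' s - p^`().[s]).
  by move=> sab; apply: has_derive_withinB; [exact: du|exact: has_derive_within_horner].
have [||c cab ec] := @MVT_segment R w (fun s => u' s - p^`().[s]) a b ab.
- move=> s; rewrite in_itv /= => sab.
  apply: (has_derive_within_interior abJ sab); apply: dw.
  by case/andP: sab => /ltW -> /ltW ->.
- apply/within_continuousP => s; rewrite /= in_itv /= => sab k k0.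
  have [r r0 hr] := has_derive_within_continuous (dw s sab) k0.
  by exists r => // y; rewrite in_itv /= => yab ys; apply: hr => //; exact: abJ.
have -> : u b - u a - (p.[b] - p.[a]) = w b - w a by rewrite /w; ring.
by rewrite ec normrM ler_wpM2r// hp.
Qed.

End WithinCalculus.

Section Box.
Context {R : realType} {d : nat}.
Implicit Types (f : R -> 'cV[R]_d -> 'cV[R]_d) (D : set 'cV[R]_d).

(** Words of length at most [k] form a finite type, so a minimum of radii and a sum of bounds serve
    all partial derivatives at once. *)
Lemma classC_local_bound (k : nat) (I : set R) D f (t : R) (y : 'cV[R]_d) :
  open D -> classC k I D f -> I t -> D y ->
  exists r B : R, [/\ 0 < r, 0 < B & forall s z, I s -> `|s - t| < r ->
    `|z - y| < r -> D z /\ forall w, (size w <= k)%N ->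
      `|foldr (pderive I) f w s z| <= B].
Proof.
move=> oD hf It Dy.
have [rD rD0 hD] : exists2 r : R, 0 < r & forall z, `|z - y| < r -> D z.
  have /nbhs_ballP[r r0 hr] : nbhs y D by move: oD; rewrite openE => /(_ _ Dy).
  by exists r => // z zy; apply: hr; rewrite -ball_normE /ball_ /= distrC.
pose G (w : seq (option 'I_d)) := foldr (pderive I) f w.
have /choice[r hr] : forall w : k.-bseq (option 'I_d), exists r : R, 0 < r /\
    forall s z, I s -> `|s - t| < r -> `|z - y| < r -> D z ->
      `|G w s z| <= `|G w t y| + 1.
  move=> w; have [+ _] := hf w (size_bseq w).
  move/within_continuousP => /(_ (t, y) (conj It Dy) 1 ltr01)[r r0 hr].
  exists r; split=> // s z Is st zy Dz.
  have : `|(t, y) - (s, z)| < r by rewrite prod_normE /= gt_max !(distrC _ s, distrC _ z) st.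
  move=> /(hr (s, z) (conj Is Dz)) /=; rewrite -/(G w) => h.
  by have := lerB_dist (G w s z) (G w t y); rewrite (distrC (G w s z)); lra.
exists (Num.min rD (\big[Num.min/1]_(w : k.-bseq (option 'I_d)) r w)),
  (1 + \sum_(w : k.-bseq (option 'I_d)) (`|G (w) t y| + 1)); split.
- rewrite lt_min rD0 /=; apply/bigmin_gtP; split=> // w _.
  by have [] := hr w.
- by rewrite ltr_pwDl// sumr_ge0// => w _; rewrite addr_ge0.
move=> s z Is; rewrite !lt_min => /andP[_ sr] /andP[zD zr].
have Dz := hD _ zD; split=> // w wk.
have rle : \big[Num.min/1]_(v : k.-bseq (option 'I_d)) r v <= r (Bseq wk).
  exact: bigmin_le_cond.
have := (hr (Bseq wk)).2 s z Is (lt_le_trans sr rle) (lt_le_trans zr rle) Dz.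
move=> /le_trans; apply.
by rewrite (bigD1 (Bseq wk)) //= -/(G w) addrCA lerDl addr_ge0// sumr_ge0.
Qed.

Lemma classC_tube_bound (k : nat) (t0 T : R) D f (x : R -> 'cV[R]_d) :
  open D -> classC k `[t0, T] D f ->
  (forall t, t0 <= t <= T -> D (x t)) ->
  (forall t, t0 <= t <= T -> forall e : R, 0 < e -> exists2 r : R, 0 < r &
     forall s, t0 <= s <= T -> `|t - s| < r -> `|x t - x s| <= e) ->
  exists rho B : R, [/\ 0 < rho, 0 < B & forall t s y, t0 <= t <= T ->
    t0 <= s <= T -> `|s - t| <= rho -> `|y - x t| <= rho -> D y /\
    forall w, (size w <= k)%N -> `|foldr (pderive `[t0, T]) f w s y| <= B].
Proof.
move=> oD hf Dx cx.
(* A single parameter [i] acts as radius and, through [i^-1], as bound, so that compactness of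
   [[t0, T]] has one small quantity to make uniform. *)
pose P (i t : R) := forall s y, t0 <= s <= T -> `|s - t| <= i ->
  `|y - x t| <= i -> D y /\ forall w, (size w <= k)%N ->
  `|foldr (pderive `[t0, T]) f w s y| <= i^-1.
have /compact_near_coveringP/near_covering_withinP cov := @segment_compact R t0 T.
have itvE (s : R) : `[t0, T]%classic s = (t0 <= s <= T) by rewrite /= in_itv.
have cover : forall t, `[t0, T]%classic t ->
    \forall t' \near t & i \near 0^'+, `[t0, T]%classic t' -> P i t'.
  move=> t; rewrite itvE => tI.
  have tI' : `[t0, T]%classic t by rewrite itvE.
  have [r [B [r0 B0 hrB]]] := classC_local_bound oD hf tI' (Dx t tI).
  (* One quarter of [r] for passing from [t] to [t'], in time and along [x], and one for passing
     from [t'] to [s] and from [x t'] to [y]. *)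
  have r4 : 0 < r / 4 by rewrite divr_gt0.
  have [q q0 hq] := cx t tI _ r4.
  exists (ball t (Num.min q (r / 4)), [set i | 0 < i < Num.min (r / 4) B^-1]).
    split => /=; first by apply: nbhsx_ballx; rewrite lt_min q0.
    have c0 : 0 < Num.min (r / 4) B^-1 by rewrite lt_min r4 invr_gt0.
    near=> i; apply/andP; split; near: i; first exact: nbhs_right_gt.
    exact: nbhs_right_lt.
  move=> [t' i] /= [+ /andP[i0 +]]; rewrite -ball_normE /ball_ /= !lt_min.
  move=> /andP[tq tr] /andP[ir iB]; rewrite in_itv /= => t'I s y sI st yx.
  have xx := hq t' t'I tq.
  have sI' : `[t0, T]%classic s by rewrite itvE.
  have [||Dy hw] := hrB s y sI'.
  - have := ler_normD (s - t') (t' - t); rewrite subrKA (distrC t') => h.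
    by apply: (le_lt_trans h); lra.
  - have := ler_normD (y - x t') (x t' - x t); rewrite subrKA (distrC (x t')) => h.
    by apply: (le_lt_trans h); lra.
  split=> // w wk; apply: (le_trans (hw w wk)).
  by rewrite -[B]invrK lef_pV2 ?posrE ?invr_gt0// ltW.

have [i [/= ipos iP]] := filter_ex (filterI (@nbhs_right_gt R 0) (cov R 0^'+ P _ cover)).
exists i, i^-1; split=> //; first by rewrite invr_gt0.
move=> t s y tI sI st yx; have /iP : `[t0, T]%classic t by rewrite itvE.
exact.
Unshelve. all: by end_near. Qed.

End Box.

(** * Multivariate Taylor polynomials *)

Section PolynomialTerms.
Context {R : realType} {I : finType}.
Implicit Types (P : seq (R * seq I)).

(** A polynomial is a list of terms, each a coefficient with the word of its variables, without
    normal form. Bounds on [pweight] and on the word lengths are what remains uniform when the base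
    point varies. *)
Definition peval P (z : I -> R) : R := \sum_(c <- P) c.1 * \prod_(a <- c.2) z a.

Definition ppeval P (z : I -> {poly R}) : {poly R} :=
  \sum_(c <- P) c.1 *: \prod_(a <- c.2) z a.

Definition pweight P : R := \sum_(c <- P) `|c.1|.

Lemma horner_ppeval P z h : (ppeval P z).[h] = peval P (fun i => (z i).[h]).
Proof.
rewrite /ppeval /peval horner_sum; apply: eq_bigr => c _.
by rewrite hornerZ horner_prod.
Qed.

Definition upd (z : I -> R) (i : I) (s : R) : I -> R :=
  fun j => if j == i then s else z j.

Lemma prod_count (z : I -> R) (i : I) (u : seq I) :
  \prod_(a <- u) z a = z i ^+ count_mem i u * \prod_(a <- u | a != i) z a.
Proof.
rewrite (bigID (pred1 i)) /=; congr (_ * _).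
rewrite -big_filter (eq_big_seq (fun=> z i)).
  by rewrite big_const_seq count_predT size_filter iter_mulr_1.
by move=> a; rewrite mem_filter => /andP[/eqP ->].
Qed.

(* Primitive along coordinate i, on the face where the coordinates of rank larger
   than that of i vanish: only the terms free of those coordinates survive. *)
Definition pint (i : I) P : seq (R * seq I) :=
  [seq (c.1 / (count_mem i c.2).+1%:R, i :: c.2) |
     c <- P & all (fun a => (enum_rank a <= enum_rank i)%N) c.2].

Lemma pweight_pint i P : pweight (pint i P) <= pweight P.
Proof.
rewrite /pweight /pint big_map big_filter [leRHS](bigID (fun c : R * seq I =>
  all (fun a => (enum_rank a <= enum_rank i)%N) c.2)) /=.
rewrite -[leLHS]addr0 lerD ?sumr_ge0//; apply: ler_sum => c _.
by rewrite normrM ler_piMr// ger0_norm ?invr_ge0// invf_le1// ler1n.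
Qed.

Definition ptrunc (z : I -> R) (l : nat) : I -> R :=
  fun j => if (enum_rank j < l)%N then z j else 0.

(** [pint i P] seen as a polynomial in coordinate [i] alone, the other coordinates being frozen at
    [z]: the form needed by a mean value inequality in one variable. *)
Definition pint_poly (i : I) P (z : I -> R) : {poly R} :=
  \sum_(c <- P | all (fun a => (enum_rank a <= enum_rank i)%N) c.2)
    (c.1 / (count_mem i c.2).+1%:R * \prod_(a <- c.2 | a != i) z a)
      *: 'X^((count_mem i c.2).+1).

Lemma pint_poly0 i P z : (pint_poly i P z).[0] = 0.
Proof.
rewrite /pint_poly horner_sum big1// => c _.
by rewrite hornerZ hornerXn expr0n mulr0.
Qed.

Lemma pint_polyE i P z : (pint_poly i P z).[z i] = peval (pint i P) z.
Proof.
rewrite /pint_poly /peval /pint big_map big_filter horner_sum.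
apply: eq_bigr => c _; rewrite hornerZ hornerXn /= big_cons (prod_count z i c.2).
by rewrite exprS; ring.
Qed.

(** A term with a coordinate of larger rank vanishes on the face where those coordinates are 0,
    which justifies its absence from [pint]; in the other terms the exponent produced by
    differentiation cancels the divisor. *)
Lemma deriv_pint_poly i P z s :
  (pint_poly i P z)^`().[s] = peval P (upd (ptrunc z (enum_rank i)) i s).
Proof.
rewrite /pint_poly /peval raddf_sum horner_sum.
rewrite [RHS](bigID (fun c : R * seq I =>
  all (fun a => (enum_rank a <= enum_rank i)%N) c.2)) /=.
rewrite [X in _ = _ + X]big1 ?addr0; last first.
  move=> c /allPn[a ac ari]; apply/eqP; rewrite mulf_eq0 prodf_seq_eq0; apply/orP; right.
  apply/hasP; exists a => //=; rewrite /upd /ptrunc.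
  have [ai|_] := eqVneq a i; first by rewrite ai leqnn in ari.
  by rewrite ltnNge ltnW ?eqxx// ltnNge.
apply: eq_bigr => c /allP call.
rewrite derivZ derivXn hornerZ hornerMn hornerXn /=.
rewrite (prod_count _ i) /upd eqxx.
have -> : \prod_(a <- c.2 | a != i) (if a == i then s else ptrunc z (enum_rank i) a)
    = \prod_(a <- c.2 | a != i) z a.
  rewrite [LHS]big_seq_cond [RHS]big_seq_cond; apply: eq_bigr => a /andP[ac ai].
  rewrite (negbTE ai) /ptrunc ltn_neqAle call// andbT.
  by rewrite (inj_eq val_inj) (inj_eq enum_rank_inj) ai.
have : (count_mem i c.2).+1%:R != 0 :> R by rewrite pnatr_eq0.
by rewrite -mulr_natr; set K := (_.+1)%:R => K0; field.
Qed.

Lemma upd_ptrunc (z : I -> R) (i : I) :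
  upd (ptrunc z (enum_rank i)) i (z i) = ptrunc z (enum_rank i).+1.
Proof.
apply/funext => j; rewrite /upd /ptrunc ltnS [in RHS]leq_eqVlt (inj_eq val_inj).
by rewrite (inj_eq enum_rank_inj); case: eqP => [->|].
Qed.

Lemma upd_ptrunc0 (z : I -> R) (i : I) :
  upd (ptrunc z (enum_rank i)) i 0 = ptrunc z (enum_rank i).
Proof.
apply/funext => j; rewrite /upd /ptrunc; case: eqP => [->|//].
by rewrite ltnn.
Qed.

Lemma ptrunc0 (z : I -> R) : ptrunc z 0 = (fun=> 0).
Proof. by apply/funext => j. Qed.

Lemma ptrunc_full (z : I -> R) : ptrunc z #|I| = z.
Proof. by apply/funext => j; rewrite /ptrunc ltn_ord. Qed.

Lemma telescope_ptrunc (G : (I -> R) -> R) (z : I -> R) :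
  G z - G (fun=> 0) = \sum_(l < #|I|) (G (ptrunc z l.+1) - G (ptrunc z l)).
Proof.
rewrite -{1}(ptrunc_full z) -(ptrunc0 z).
by rewrite -(telescope_sumr (fun l => G (ptrunc z l)))// big_mkord.
Qed.

Section Taylor.
Variables (N : nat) (H : seq I -> (I -> R) -> R) (J : I -> set R) (B : R).
Hypothesis J0 : forall i, J i 0.
Hypothesis HB : forall w z, (size w <= N)%N -> (forall i, J i (z i)) -> `|H w z| <= B.
(** Expresses that [H (i :: w)] is the partial derivative of [H w] along [i], in the form of a mean
    value inequality against a polynomial primitive. *)
Hypothesis HM : forall w i z (p : {poly R}) (a b e : R), (size w < N)%N ->
  (forall i, J i (z i)) -> J i a -> J i b ->
  (forall s, Num.min a b <= s <= Num.max a b -> J i s ->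
     `|H (i :: w) (upd z i s) - p^`().[s]| <= e) ->
  `|H w (upd z i b) - H w (upd z i a) - (p.[b] - p.[a])| <= e * `|b - a|.

Fixpoint taylor_weight (k : nat) : R :=
  if k is k'.+1 then B + #|I|%:R * taylor_weight k' else 0.

(* Joining 0 to z one coordinate at a time needs neither the chain rule nor the
   symmetry of second derivatives. *)
Lemma taylor_poly (k : nat) (w : seq I) : (size w + k <= N)%N ->
  exists P, [/\ pweight P <= taylor_weight k,
    all (fun c : R * seq I => size c.2 <= k)%N P &
    forall z r, (forall i, J i (z i)) -> (forall i, `|z i| <= r) ->
      `|H w z - peval P z| <= #|I|%:R ^+ k * B * r ^+ k].
Proof.
elim: k w => [|k IH] w wN.
  exists [::]; split=> //; first by rewrite /pweight big_nil.
  move=> z r Jz zr; rewrite /peval big_nil subr0 !expr0 mul1r mulr1.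
  by apply: HB; rewrite // -(addn0 (size w)).
have /choice[P hP] : forall i, exists P, [/\ pweight P <= taylor_weight k,
    all (fun c : R * seq I => size c.2 <= k)%N P &
    forall z r, (forall i, J i (z i)) -> (forall i, `|z i| <= r) ->
      `|H (i :: w) z - peval P z| <= #|I|%:R ^+ k * B * r ^+ k].
  by move=> i; apply: IH; rewrite /= addSnnS.
(* The value at 0 and, for each coordinate, the primitive of the polynomial that approximates the
   partial derivative along it. *)
exists ((H w (fun=> 0), [::]) :: flatten [seq pint i (P i) | i <- enum I]); split.
- rewrite /pweight big_cons /= lerD//.
    by apply: HB => //; rewrite (leq_trans _ wN)// leq_addr.
  rewrite big_flatten big_map big_enum /=.
  apply: (@le_trans _ _ (\sum_(i : I) taylor_weight k)).
    apply: ler_sum => i _; apply: le_trans (pweight_pint _ _) _.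
    by have [] := hP i.
  by rewrite sumr_const mulr_natl.
- rewrite /=; apply/allP => c /flattenP[u /mapP[i _ ->]].
  rewrite /pint => /mapP[c']; rewrite mem_filter => /andP[_ c'P] -> /=.
  by have [_ /allP/(_ _ c'P)] := hP i.
move=> z r Jz zr.
have -> : peval ((H w (fun=> 0), [::]) :: flatten [seq pint i (P i) | i <- enum I]) z
    = H w (fun=> 0) + \sum_(l < #|I|) peval (pint (enum_val l) (P (enum_val l))) z.
  rewrite /peval big_cons /= big_nil mulr1 big_flatten big_map big_enum /=.
  congr (_ + _); rewrite [RHS](reindex enum_rank) /=; last first.
    by apply: onW_bij; exact: enum_rank_bij.
  by apply: eq_bigr => i _; rewrite enum_rankK.
rewrite opprD addrA telescope_ptrunc -sumrB.
apply: (le_trans (ler_norm_sum _ _ _)).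
apply: (@le_trans _ _ (\sum_(l < #|I|) #|I|%:R ^+ k * B * r ^+ k.+1)); last first.
  by rewrite sumr_const card_ord (exprS #|I|%:R) -!mulrA mulr_natl.
apply: ler_sum => l _; set i := enum_val l.
have li : enum_rank i = l by rewrite /i enum_valK.
have Jt m j : J j (ptrunc z m j) by rewrite /ptrunc; case: ifP.
have r0 : 0 <= r by apply: le_trans (zr i).
have B0 : 0 <= B by apply: (le_trans (normr_ge0 _) (HB (leq0n N : size [::] <= N)%N J0)).
have wN' : (size w < N)%N by rewrite (leq_trans _ wN)// addnS ltnS leq_addr.
(* Moving coordinate [i] from 0 to [z i] multiplies the error on the derivative by [|z i| <= r],
   whence one more power of [r]. *)
have := HM (p := pint_poly i (P i) z) (z := ptrunc z (enum_rank i)) (a := 0)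
  (b := z i) (e := #|I|%:R ^+ k * B * r ^+ k) wN' (Jt _) (J0 i) (Jz i).
rewrite upd_ptrunc upd_ptrunc0 li pint_poly0 pint_polyE !subr0 => h.
apply: (le_trans (h _)).
  move=> s s0 Js; rewrite deriv_pint_poly li.
  have sz : `|s| <= `|z i|.
    move: s0; have [zi|zi] := orP (le_total 0 (z i)).
      by rewrite min_l// max_r// => /andP[s0 sz]; rewrite !ger0_norm.
    by rewrite min_r// max_l// => /andP[s0 sz]; rewrite !ler0_norm// lerN2.
  have [_ _ hPi] := hP i; apply: hPi => j; rewrite /upd.
    by have [->|_] := eqVneq j i; [exact: Js|exact: Jt].
  have [_|_] := eqVneq j i; first exact: le_trans sz (zr i).
  by rewrite /ptrunc; case: ifP; rewrite ?normr0.
rewrite exprSr mulrA ler_wpM2l//.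
by rewrite !mulr_ge0// exprn_ge0.
Qed.

Let pmix (z z' : I -> R) (l : nat) : I -> R :=
  fun j => if (enum_rank j < l)%N then z j else z' j.

(** [pmix] leads from [z'] to [z] one coordinate at a time; on each piece [HM] is used with the zero
    polynomial. *)
Lemma partials_lipschitz (w : seq I) (z z' : I -> R) : (size w < N)%N ->
  (forall i, J i (z i)) -> (forall i, J i (z' i)) ->
  `|H w z - H w z'| <= B * \sum_i `|z i - z' i|.
Proof.
move=> wN Jz Jz'.
have e1 : z = pmix z z' #|I| by apply/funext => j; rewrite /pmix ltn_ord.
have e0 : z' = pmix z z' 0 by apply/funext => j; rewrite /pmix ltn0.
have -> : H w z - H w z' =
    \sum_(l < #|I|) (H w (pmix z z' l.+1) - H w (pmix z z' l)).
  rewrite -(big_mkord xpredT (fun l => H w (pmix z z' l.+1) - H w (pmix z z' l))).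
  by rewrite telescope_sumr// -e1 -e0.
apply: (le_trans (ler_norm_sum _ _ _)).
rewrite mulr_sumr [leLHS](reindex (@enum_rank I)) /=; last first.
  by apply: onW_bij; exact: enum_rank_bij.
apply: ler_sum => i _; set l := enum_rank i.
have Jt m j : J j (pmix z z' m j) by rewrite /pmix; case: ifP.
have := HM (p := 0) (z := pmix z z' l) (a := z' i) (b := z i) (e := B) wN (Jt _)
  (Jz' i) (Jz i).
have -> : upd (pmix z z' l) i (z i) = pmix z z' l.+1.
  apply/funext => j; rewrite /upd /pmix ltnS [in RHS]leq_eqVlt (inj_eq val_inj).
  by rewrite (inj_eq enum_rank_inj); have [->|] := eqVneq j i.
have -> : upd (pmix z z' l) i (z' i) = pmix z z' l.
  apply/funext => j; rewrite /upd /pmix; have [->|//] := eqVneq j i.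
  by rewrite ltnn.
rewrite !horner0 subrr subr0; apply => s _ Js.
rewrite deriv0 horner0 subr0; apply: HB => // j; rewrite /upd.
by have [->|_] := eqVneq j i; [exact: Js|exact: Jt].
Qed.

End Taylor.
End PolynomialTerms.

(** * Taylor polynomials and Lipschitz bounds in a tube around the solution *)

Section Tube.
Context {R : realType} {d : nat}.
Variables (t0 T : R) (D : set 'cV[R]_d) (f : R -> 'cV[R]_d -> 'cV[R]_d).
Variables (N : nat) (x : R -> 'cV[R]_d) (rho B : R).
Hypothesis hf : classC N `[t0, T] D f.
Hypothesis rho0 : 0 < rho.
Hypothesis tubeP : forall t s y, t0 <= t <= T -> t0 <= s <= T ->
  `|s - t| <= rho -> `|y - x t| <= rho -> D y /\
  forall w, (size w <= N)%N -> `|foldr (pderive `[t0, T]) f w s y| <= B.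

Local Notation F w := (foldr (pderive `[t0, T]) f w).

Definition coords (s : R) (v : 'cV[R]_d) : option 'I_d -> R :=
  fun a => if a is Some j then v j 0 else s.

Let H (t : R) (i0 : 'I_d) (w : seq (option 'I_d)) (z : option 'I_d -> R) : R :=
  F w (t + z None) (x t + \col_j z (Some j)) i0 0.

(** The time side of the box also keeps [t + s] in [[t0, T]], outside of which nothing is known
    about [f]. *)
Let J (t : R) (a : option 'I_d) : set R :=
  if a is Some _ then [set s | `|s| <= rho]
  else [set s | `|s| <= rho /\ t0 <= t + s <= T].

Let box_norm (t : R) z : (forall a, J t a (z a)) -> `|\col_j z (Some j) : 'cV[R]_d| <= rho.
Proof.
move=> Jz; apply: cV_norm_le => [|i]; first exact: ltW.
by rewrite mxE; exact: (Jz (Some i)).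
Qed.

Let J0 t : t0 <= t <= T -> forall a, J t a 0.
Proof.
have r0 := ltW rho0.
by move=> tI [j|]; rewrite /J /= ?addr0 normr0.
Qed.

Let HB t i0 : t0 <= t <= T -> forall w z, (size w <= N)%N ->
  (forall a, J t a (z a)) -> `|H t i0 w z| <= B.
Proof.
move=> tI w z wN Jz; apply: le_trans (coord_norm_le _ _ _) _.
have [n1 n2] := Jz None.
have [||_] := tubeP tI n2 (y := x t + \col_j z (Some j)).
- by rewrite addrAC subrr add0r.
- by rewrite addrAC subrr add0r (box_norm Jz).
by apply.
Qed.

Let HM t i0 : t0 <= t <= T -> forall w i z (p : {poly R}) (a b e : R), (size w < N)%N ->
  (forall i, J t i (z i)) -> J t i a -> J t i b ->
  (forall s, Num.min a b <= s <= Num.max a b -> J t i s ->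
     `|H t i0 (i :: w) (upd z i s) - p^`().[s]| <= e) ->
  `|H t i0 w (upd z i b) - H t i0 w (upd z i a) - (p.[b] - p.[a])| <= e * `|b - a|.
Proof.
move=> tI w i z p a b e wN Jz Ja Jb hyp.
have Dbox z' : (forall a, J t a (z' a)) -> D (x t + \col_j z' (Some j)).
  move=> Jz'; have [n1 n2] := Jz' None.
  have [|//|//] := tubeP tI n2 (y := x t + \col_j z' (Some j)).
    by rewrite addrAC subrr add0r.
  by rewrite addrAC subrr add0r (box_norm Jz').
have Jupd s : J t i s -> forall a, J t a (upd z i s a).
  by move=> Js c; rewrite /upd; have [->|] := eqVneq c i.
have bet s : Num.min a b <= s <= Num.max a b -> J t i s.
  have nb : `|a| <= rho -> `|b| <= rho -> Num.min a b <= s <= Num.max a b -> `|s| <= rho.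
    rewrite !ler_norml ge_min le_max => /andP[? ?] /andP[? ?].
    by move=> /andP[/orP[?|?] /orP[?|?]]; apply/andP; split; lra.
  case: (i) Ja Jb => [j|] /=; first exact: nb.
  move=> [ha1 /andP[ha2 ha3]] [hb1 /andP[hb2 hb3]] sab; split; first exact: nb.
  move: sab; rewrite ge_min le_max.
  by move=> /andP[/orP[?|?] /orP[?|?]]; apply/andP; split; lra.
have [_ hder] := hf (ltnW wN).
case: i Ja Jb hyp Jupd bet => [j|] Ja Jb hyp Jupd bet.
(* A space coordinate moves the argument along a line of direction [delta_mx j 0]; in the other
   case, that of time, the polynomial [p] is translated by [t]. *)
- have [_ tzI] := Jz None.
  pose Y := x t + \col_k (upd z (Some j) 0) (Some k).
  pose tau := t + z None.
  have eY s : x t + \col_k (upd z (Some j) s) (Some k) = s *: delta_mx j 0 + Y.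
    rewrite /Y addrCA; congr (_ + _); apply/colP => k; rewrite !mxE /upd /=.
    rewrite (inj_eq Some_inj) eqxx andbT.
    by have [_|_] := eqVneq k j; rewrite ?mulr1 ?addr0// mulr0 add0r.
  have eH w' s : H t i0 w' (upd z (Some j) s) = F w' tau (s *: delta_mx j 0 + Y) i0 0.
    by rewrite /H eY.
  rewrite !eH.
  apply: (mean_value_poly (J := setT)
    (u := fun s => F w tau (s *: delta_mx j 0 + Y) i0 0)
    (u' := fun s => F (Some j :: w) tau (s *: delta_mx j 0 + Y) i0 0)) => // s sab.
    apply: (has_derive_within_coord (u := fun s => F w tau (s *: delta_mx j 0 + Y))).
    apply: has_derive_within_line.
    apply: (hder wN (Some j)); first by rewrite /= in_itv.
    by rewrite -eY; apply: Dbox; apply: Jupd; exact: bet.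
  by rewrite -eH; apply: hyp => //; exact: bet.
- pose Y := x t + \col_k z (Some k).
  have eH w' s : H t i0 w' (upd z None s) = F w' (t + s) Y i0 0 by [].
  rewrite !eH.
  pose p' := p \Po ('X - t%:P).
  have ep s : p.[s] = p'.[t + s].
    by rewrite /p' horner_comp !hornerE addrAC subrr add0r.
  have ep' s : p'^`().[s] = p^`().[s - t].
    by rewrite /p' deriv_comp derivXsubC mulr1 horner_comp !hornerE.
  rewrite !ep.
  have -> : b - a = (t + b) - (t + a) by rewrite opprD addrACA subrr add0r.
  have sh s : Num.min (t + a) (t + b) <= s <= Num.max (t + a) (t + b) ->
      J t None (s - t).
    move=> sab; apply: bet; move: sab; rewrite !ge_min !le_max.
    by move=> /andP[/orP[?|?] /orP[?|?]]; apply/andP; split; apply/orP;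
      (by left; lra) || (by right; lra).
  apply: (mean_value_poly (J := `[t0, T])
    (u := fun s => F w s Y i0 0)
    (u' := fun s => F (None :: w) s Y i0 0)) => // s sab.
  + by have [_] := sh s sab; rewrite /= in_itv /= (addrC t) subrK.
  + apply: (has_derive_within_coord (u := fun s => F w s Y)).
    apply: derive_withinP; apply: (hder wN None).
      by have [_] := sh s sab; rewrite /= in_itv /= (addrC t) subrK.
    exact: Dbox.
  + rewrite ep'; have := hyp (s - t) _ (sh s sab); rewrite eH (addrC t) subrK.
    apply; move: sab; rewrite !ge_min !le_max.
    by move=> /andP[/orP[?|?] /orP[?|?]]; apply/andP; split; apply/orP;
      (by left; lra) || (by right; lra).
Qed.

(** [C] is fixed before [t]: the base point changes the coefficients of [P], but neither the bound
    on their weight nor the error constant. *)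
Lemma tube_taylor k : (k <= N)%N -> exists C : R, 0 <= C /\
  forall t, t0 <= t <= T -> forall i : 'I_d,
  exists P : seq (R * seq (option 'I_d)), [/\ pweight P <= C,
    all (fun c => size c.2 <= k)%N P &
    forall s v r, t0 <= t + s <= T -> `|s| <= r -> `|v| <= r -> r <= rho ->
      `|f (t + s) (x t + v) i 0 - peval P (coords s v)| <= C * r ^+ k].
Proof.
move=> kN; pose n : R := #|{: option 'I_d}|%:R.
exists (`|taylor_weight (I := option 'I_d) B k| + `|n ^+ k * B|).
split=> [|t tI i]; first by rewrite addr_ge0.
have [|P [P1 P2 P3]] := taylor_poly (J0 tI) (@HB t i tI) (@HM t i tI) (k := k) (w := [::]).
  by rewrite add0n.
exists P; split=> //.
  by rewrite (le_trans P1)// (le_trans (ler_norm _))// lerDl.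
move=> s v r sI sr vr rr.
have r0 : 0 <= r by rewrite (le_trans _ sr).
have := P3 (coords s v) r.
have -> : H t i [::] (coords s v) = f (t + s) (x t + v) i 0.
  by rewrite /H /=; congr (f _ (_ + _) i 0); apply/colP => j; rewrite mxE.
move=> h; apply: (le_trans (h _ _)).
- case=> [j|] /=; last by split=> //; rewrite (le_trans sr).
  by rewrite (le_trans (coord_norm_le _ _ _))// (le_trans vr).
- case=> [j|] //=; exact: le_trans (coord_norm_le _ _ _) vr.
rewrite ler_wpM2r ?exprn_ge0// -/n (le_trans (ler_norm _))// lerDr//.
Qed.

Lemma tube_lipschitz : exists C : R, 0 <= C /\ forall w, (size w < N)%N ->
  forall t s s' y y', t0 <= t <= T -> t0 <= s <= T -> t0 <= s' <= T ->
  `|s - t| <= rho -> `|s' - t| <= rho -> `|y - x t| <= rho -> `|y' - x t| <= rho ->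
  `|F w s y - F w s' y'| <= C * (`|s - s'| + `|y - y'|).
Proof.
pose n : R := #|{: option 'I_d}|%:R.
exists (`|B| * n); split=> [|w wN t s s' y y' tI sI s'I st s't yx y'x].
  by rewrite mulr_ge0.
have S0 : 0 <= `|s - s'| + `|y - y'| by rewrite addr_ge0.
apply: cV_norm_le => [|i]; first by rewrite !mulr_ge0.
have Jc r z : t0 <= r <= T -> `|r - t| <= rho -> `|z - x t| <= rho ->
    forall a, J t a (coords (r - t) (z - x t) a).
  move=> rI rt zx [j|] /=; first by rewrite (le_trans (coord_norm_le _ _ _)).
  by rewrite (addrC t) subrK.
have := partials_lipschitz (@HB t i tI) (@HM t i tI) wN (Jc _ _ sI st yx) (Jc _ _ s'I s't y'x).
have eH r z : H t i w (coords (r - t) (z - x t)) = F w r z i 0.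
  rewrite /H (_ : x t + _ = z) /= ?(addrC t) ?subrK//.
  by apply/colP => j; rewrite !mxE addrC subrK.
rewrite !eH !mxE => h; apply: (le_trans h).
apply: (@le_trans _ _ (`|B| * \sum_(a : option 'I_d) (`|s - s'| + `|y - y'|))); last first.
  by rewrite sumr_const -mulrA mulr_natl.
apply: ler_pM; rewrite ?sumr_ge0 ?ler_norm//.
  by apply: (le_trans (normr_ge0 _) (HB i tI (leq0n N : size [::] <= N)%N (J0 tI))).
apply: ler_sum => -[j|] _ /=.
  rewrite !mxE opprB addrA subrK ler_wpDl//.
  by have := coord_norm_le (y - y') j 0; rewrite !mxE.
by rewrite opprB addrA subrK lerDl.
Qed.

End Tube.

(** * Polynomials with uniformly bounded coefficients *)

Section Majorant.
Context {R : realType}.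
Implicit Types p q : {poly R}.

(** The majorant relation of power series, for polynomials. One [q] that majorizes a whole family
    expresses a uniform bound on coefficients and degrees. *)
Definition maj p q := forall i, `|p`_i| <= q`_i.

Lemma maj_ge0 p q : maj p q -> forall i, 0 <= q`_i.
Proof. by move=> pq i; exact: le_trans (normr_ge0 _) (pq i). Qed.

Lemma majD p1 p2 q1 q2 : maj p1 q1 -> maj p2 q2 -> maj (p1 + p2) (q1 + q2).
Proof.
move=> h1 h2 i; rewrite !coefD (le_trans (ler_normD _ _))//.
exact: lerD (h1 i) (h2 i).
Qed.

Lemma majN p q : maj p q -> maj (- p) q.
Proof. by move=> h i; rewrite coefN normrN. Qed.

Lemma majM p1 p2 q1 q2 : maj p1 q1 -> maj p2 q2 -> maj (p1 * p2) (q1 * q2).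
Proof.
move=> h1 h2 i; rewrite !coefM (le_trans (ler_norm_sum _ _ _))//.
by apply: ler_sum => j _; rewrite normrM ler_pM.
Qed.

Lemma majC (c C : R) : `|c| <= C -> maj c%:P C%:P.
Proof. by move=> cC i; rewrite !coefC; case: ifP; rewrite ?normr0. Qed.

Lemma majX : maj 'X 'X.
Proof. by move=> i; rewrite coefX; case: eqP; rewrite ?normr1 ?normr0. Qed.

Lemma maj0 q : (forall i, 0 <= q`_i) -> maj 0 q.
Proof. by move=> h i; rewrite coef0 normr0. Qed.

Lemma maj_sum (J : Type) (r : seq J) (P : pred J) (F G : J -> {poly R}) :
  (forall j, P j -> maj (F j) (G j)) ->
  maj (\sum_(j <- r | P j) F j) (\sum_(j <- r | P j) G j).
Proof.
move=> h; elim/big_ind2: _ => //; first by apply: maj0 => i; rewrite coef0.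
by move=> *; exact: majD.
Qed.

Lemma maj_comp_scale p q (c : R) : maj p q ->
  maj (p \Po (c *: 'X)) (q \Po (`|c| *: 'X)).
Proof.
move=> h i; have e (b : R) (u : {poly R}) : (u \Po (b *: 'X))`_i = u`_i * b ^+ i.
  rewrite comp_polyE coef_sum; have [iu|ui] := ltnP i (size u).
    rewrite (bigD1 (Ordinal iu)) //= exprZn !coefZ coefXn eqxx mulr1 big1 ?addr0//.
    move=> j /negbTE ji; rewrite exprZn !coefZ coefXn -[i == j]/(Ordinal iu == j :> 'I__).
    by rewrite eq_sym ji !mulr0.
  rewrite big1 ?nth_default ?mul0r// => j _.
  rewrite exprZn !coefZ coefXn; case: eqP => [ij|]; last by rewrite !mulr0.
  by move: (ltn_ord j); rewrite -ij ltnNge ui.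
by rewrite !e normrM normrX ler_wpM2r ?exprn_ge0.
Qed.

(** At [i = 0] the divisor is 0, whose inverse is 0 by convention, so the constant term vanishes. *)
Definition antideriv p : {poly R} := \poly_(i < (size p).+1) (p`_i.-1 / i%:R).

Lemma coef_antideriv p i : (antideriv p)`_i = if i is j.+1 then p`_j / j.+1%:R else 0.
Proof.
rewrite coef_poly ltnS; case: i => [|i]; first by rewrite invr0 mulr0.
by case: ltnP => // pi; rewrite nth_default// mul0r.
Qed.

Lemma deriv_antideriv p : (antideriv p)^`() = p.
Proof.
by apply/polyP => i; rewrite coef_deriv coef_antideriv -[_ *+ _]mulr_natr divfK.
Qed.

Lemma antideriv0 p : (antideriv p).[0] = 0.
Proof. by rewrite horner_coef0 coef_antideriv. Qed.

Lemma maj_antideriv p q : maj p q -> maj (antideriv p) ('X * q).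
Proof.
move=> h i; rewrite coef_antideriv coefXM; case: i => [|i] /=; first by rewrite normr0.
rewrite normrM normfV normr_nat (le_trans _ (h i))// ler_piMr//.
by rewrite invf_le1// ler1n.
Qed.

Lemma maj_deriv p q : maj p q -> maj p^`() q^`().
Proof. by move=> h i; rewrite !coef_deriv normrMn lerMn2r h orbT. Qed.

Lemma maj1 : maj 1 1.
Proof. by move=> i; rewrite coef1; case: eqP; rewrite ?normr1 ?normr0. Qed.

(** [1 + q] majorizes both 1 and every [z a], so a product of at most [k] factors, padded with ones,
    is majorized by [(1 + q)^k]. *)
Lemma maj_ppeval (I : finType) (P : seq (R * seq I)) (z : I -> {poly R}) q k C :
  (forall i, 0 <= q`_i) -> (forall a, maj (z a) q) -> pweight P <= C ->
  all (fun c : R * seq I => size c.2 <= k)%N P ->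
  maj (ppeval P z) (C *: (1 + q) ^+ k).
Proof.
move=> q0 zq PC Pk; pose Q := 1 + q.
have one_Q : maj 1 Q.
  by move=> i; rewrite coefD (le_trans (maj1 i))// lerDl.
have zQ a : maj (z a) Q.
  by move=> i; rewrite coefD (le_trans (zq a i))// lerDr (maj_ge0 maj1).
have prodQ n (u : seq I) : (size u <= n)%N -> maj (\prod_(a <- u) z a) (Q ^+ n).
  elim: n u => [|n IH] [|a u] //= un.
  - by rewrite big_nil expr0; exact: maj1.
  - by rewrite exprS -(mulr1 (\prod_(_ <- _) _)) mulrC; apply: majM => //; exact: IH.
  - by rewrite big_cons exprS; apply: majM => //; exact: IH.
have Qk := maj_ge0 (prodQ k [::] (leq0n k)).
move=> i; rewrite coefZ (le_trans _ (ler_wpM2r (Qk i) PC))//.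
rewrite /ppeval coef_sum (le_trans (ler_norm_sum _ _ _))// /pweight mulr_suml.
rewrite big_seq [leRHS]big_seq; apply: ler_sum => c cP.
by rewrite coefZ normrM ler_wpM2l// prodQ// (allP Pk _ cP).
Qed.

Lemma horner_maj p q h : maj p q -> 0 <= h <= 1 -> `|p.[h]| <= q.[1].
Proof.
move=> pq /andP[h0 h1]; have pq' : (size p <= size q)%N.
  apply/leq_sizeP => j jq; apply/eqP; rewrite -normr_eq0 eq_le normr_ge0 andbT.
  by have := pq j; rewrite [q`_j]nth_default.
rewrite (horner_coef_wide _ pq') horner_coef (le_trans (ler_norm_sum _ _ _))//.
apply: ler_sum => i _; rewrite expr1n mulr1 normrM normrX (ger0_norm h0).
by rewrite (le_trans _ (pq i))// ler_piMr// exprn_ile1.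
Qed.

Lemma horner_maj_low p q h n : maj p q -> (forall i, (i < n)%N -> p`_i = 0) ->
  0 <= h <= 1 -> `|p.[h]| <= q.[1] * h ^+ n.
Proof.
move=> pq p0 h01; have q0 := maj_ge0 pq.
rewrite -(poly_take_drop n p) hornerD (_ : take_poly n p = 0); last first.
  by apply/polyP => i; rewrite coef_take_poly coef0; case: ifP => // /p0.
have h0 : 0 <= h by case/andP: h01.
rewrite horner0 add0r hornerM hornerXn normrM normrX (ger0_norm h0).
rewrite ler_wpM2r ?exprn_ge0//.
have -> : q.[1] = (take_poly n q).[1] + (drop_poly n q).[1].
  by rewrite -{1}(poly_take_drop n q) hornerD hornerM hornerXn expr1n mulr1.
apply: (@le_trans _ _ (drop_poly n q).[1]).
  by apply: horner_maj => // i; rewrite !coef_drop_poly.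
rewrite lerDr horner_coef sumr_ge0// => i _.
by rewrite expr1n mulr1 coef_take_poly; case: ifP.
Qed.

Lemma horner_bounded p : exists C : R, forall h, 0 <= h <= 1 -> `|p.[h]| <= C.
Proof.
have m : maj p (\poly_(i < size p) `|p`_i|).
  move=> i; rewrite coef_poly; case: ltnP => // pi.
  by rewrite nth_default// normr0.
by exists (\poly_(i < size p) `|p`_i|).[1] => h; exact: horner_maj.
Qed.

(** The constant coefficient is [O(h)], hence 0; then [p] is divided by [h], which lowers [n] by
    one. *)
Lemma bigO_coef_eq0 n p (K h0 : R) : 0 < h0 ->
  (forall h, 0 < h <= h0 -> `|p.[h]| <= K * h ^+ n) ->
  forall i, (i < n)%N -> p`_i = 0.
Proof.
elim: n p K h0 => [//|n IH] p K h0 h00 hp.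
pose p1 := drop_poly 1 p.
have ep h : p.[h] = p`_0 + p1.[h] * h.
  rewrite -{1}(poly_take_drop 1 p) hornerD hornerM hornerXn expr1.
  rewrite (_ : take_poly 1 p = (p`_0)%:P) ?hornerC//.
  by apply/polyP => i; rewrite coef_take_poly coefC ltnS leqn0; case: eqP => [->|].
have [C hC] := horner_bounded p1.
have p00 : p`_0 = 0.
  apply/eqP; rewrite -normr_eq0 eq_le normr_ge0 andbT leNgt; apply/negP => p0.
  pose L := `|K| + `|C| + 1; have L0 : 0 < L by rewrite ltr_wpDl// addr_ge0.
  (* For this [h] the constant coefficient, bounded by [(|K| + |C|) h], would be at most half of
     itself in absolute value. *)
  pose h := Num.min (Num.min h0 1) (`|p`_0| / (2 * L)).
  have hpos : 0 < h by rewrite !lt_min h00 ltr01 divr_gt0// mulr_gt0.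
  have hh0 : h <= h0 by rewrite /h !ge_min lexx.
  have hh1 : h <= 1 by rewrite /h !ge_min lexx orbT.
  have hL : h * (2 * L) <= `|p`_0|.
    by rewrite -ler_pdivlMr ?mulr_gt0// /h ge_min lexx orbT.
  have := hp h; rewrite hpos hh0 => /(_ isT) h1.
  have := hC h; rewrite (ltW hpos) hh1 => /(_ isT) h2.
  have h3 : `|p`_0| <= `|p.[h]| + `|p1.[h]| * h.
    have -> : p`_0 = p.[h] - p1.[h] * h by rewrite ep addrK.
    by rewrite (le_trans (ler_normB _ _))// normrM (gtr0_norm hpos).
  have h4 : `|K| * h ^+ n.+1 <= `|K| * h.
    by rewrite ler_wpM2l// exprS ler_piMr ?exprn_ile1// ltW.
  have h5 : K * h ^+ n.+1 <= `|K| * h ^+ n.+1.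
    by rewrite ler_wpM2r ?ler_norm// exprn_ge0// ltW.
  have h6 : `|p1.[h]| * h <= `|C| * h.
    by rewrite ler_wpM2r ?(ltW hpos)// (le_trans h2)// ler_norm.
  have h7 : 0 <= `|K| * h by rewrite mulr_ge0// ltW.
  have h8 : 0 <= `|C| * h by rewrite mulr_ge0// ltW.
  by move: hL; rewrite /L; lra.
have := IH p1 K h0 h00; move=> IH1 [_|i iltn] //.
have := IH1 _ i iltn; rewrite coef_drop_poly addn1; apply=> h hh.
have h1 : 0 < h by case/andP: hh.
have := hp h hh; rewrite ep p00 add0r normrM (gtr0_norm h1) exprSr mulrA.
by rewrite ler_pM2r.
Qed.

Lemma horner_ext p q : (forall h, p.[h] = q.[h]) -> p = q.
Proof.
move=> e; apply/polyP => i; apply/eqP; rewrite -subr_eq0 -coefB; apply/eqP.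
apply: (@bigO_coef_eq0 i.+1 (p - q) 0 1) => // h _.
by rewrite hornerD hornerN e subrr normr0 mul0r.
Qed.

End Majorant.

(** * Polynomial vector fields and polynomial solutions *)

Section PolynomialFields.
Context {R : realType} {d : nat}.

(** Polynomial functions of [(s, y)], given by generators so that closure under partial derivatives
    is an induction. *)
Inductive polyfun : (R -> 'cV[R]_d -> R) -> Prop :=
| polyfun_cst c : polyfun (fun _ _ => c)
| polyfun_time : polyfun (fun s _ => s)
| polyfun_coord j : polyfun (fun _ v => v j 0)
| polyfun_add u v : polyfun u -> polyfun v -> polyfun (fun s y => u s y + v s y)
| polyfun_mul u v : polyfun u -> polyfun v -> polyfun (fun s y => u s y * v s y).

Lemma polyfun_ext u v : polyfun u -> (forall s y, u s y = v s y) -> polyfun v.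
Proof. by move=> pu uv; rewrite (_ : v = u)//; apply/funext => s; apply/funext => y. Qed.

Lemma polyfun_sum (J : Type) (r : seq J) (F : J -> R -> 'cV[R]_d -> R) :
  (forall j, polyfun (F j)) -> polyfun (fun s y => \sum_(j <- r) F j s y).
Proof.
move=> h; elim: r => [|j r IH].
  by apply: polyfun_ext (polyfun_cst 0) _ => s y; rewrite big_nil.
by apply: polyfun_ext (polyfun_add (h j) IH) _ => s y; rewrite big_cons.
Qed.

Lemma polyfun_prod (J : Type) (r : seq J) (F : J -> R -> 'cV[R]_d -> R) :
  (forall j, polyfun (F j)) -> polyfun (fun s y => \prod_(j <- r) F j s y).
Proof.
move=> h; elim: r => [|j r IH].
  by apply: polyfun_ext (polyfun_cst 1) _ => s y; rewrite big_nil.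
by apply: polyfun_ext (polyfun_mul (h j) IH) _ => s y; rewrite big_cons.
Qed.

Lemma polyfun_horner (p : {poly R}) u : polyfun u -> polyfun (fun s y => p.[u s y]).
Proof.
move=> pu; elim/poly_ind: p => [|p c IH].
  by apply: polyfun_ext (polyfun_cst 0) _ => s y; rewrite horner0.
apply: polyfun_ext (polyfun_add (polyfun_mul IH pu) (polyfun_cst c)) _ => s y.
by rewrite !hornerE.
Qed.

Lemma polyfun_opp u : polyfun u -> polyfun (fun s y => - u s y).
Proof.
move=> pu; apply: polyfun_ext (polyfun_mul (polyfun_cst (-1)) pu) _ => s y.
by rewrite mulN1r.
Qed.

Lemma polyfun_peval (I : finType) (P : seq (R * seq I)) (z : R -> 'cV[R]_d -> I -> R) :
  (forall a, polyfun (fun s y => z s y a)) -> polyfun (fun s y => peval P (z s y)).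
Proof.
move=> h; apply: polyfun_sum => c; apply: polyfun_mul; first exact: polyfun_cst.
exact: polyfun_prod.
Qed.

Lemma polyfun_continuous u : polyfun u ->
  continuous (fun z : R * 'cV[R]_d => u z.1 z.2).
Proof.
elim=> [c||j|v w _ hv _ hw|v w _ hv _ hw] z.
- exact: cvg_cst.
- exact: cvg_fst.
- apply: (@continuous_comp _ _ _ snd (fun v : 'cV[R]_d => v j 0)).
    exact: cvg_snd.
  exact: coord_continuous.
- exact: cvgD (hv z) (hw z).
- exact: cvgM (hv z) (hw z).
Qed.

Definition polyfun_derivative (i : option 'I_d) (u u' : R -> 'cV[R]_d -> R) : Prop :=
  forall s y, if i is Some j then is_derive y (delta_mx j 0) (u s) (u' s y)
              else is_derive s 1 (u^~ y) (u' s y).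

Lemma polyfun_derivable u i : polyfun u ->
  exists u', polyfun u' /\ polyfun_derivative i u u'.
Proof.
elim=> [c||j|v w pv [v' [pv' hv]] pw [w' [pw' hw]]|v w pv [v' [pv' hv]] pw [w' [pw' hw]]].
- exists (fun _ _ => 0); split; first exact: polyfun_cst.
  by move=> s y; case: i => [k|]; exact: is_derive_cst.
- exists (fun _ _ => if i is Some _ then 0 else 1); split; first exact: polyfun_cst.
  by move=> s y; case: i => [k|]; [exact: is_derive_cst|exact: is_derive_id].
- exists (fun _ _ => if i is Some k then (j == k)%:R else 0); split.
    exact: polyfun_cst.
  move=> s y; case: i => [k|]; last exact: is_derive_cst.
  apply: is_derive_eps => e e0; exists 1 => // h h0 _.
  rewrite !mxE addrK eqxx andbT /GRing.scale /= mulrA mulVf// mul1r.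
  by rewrite subrr normr0 ltW.
- exists (fun s y => v' s y + w' s y); split; first exact: polyfun_add.
  move=> s y; case: i hv hw => [k|] hv hw.
    exact: (is_deriveD (hv s y) (hw s y)).
  exact: (is_deriveD (hv s y) (hw s y)).
- exists (fun s y => v s y * w' s y + w s y * v' s y); split.
    by apply: polyfun_add; exact: polyfun_mul.
  move=> s y; case: i hv hw => [k|] hv hw.
    exact: (is_deriveM (hv s y) (hw s y)).
  exact: (is_deriveM (hv s y) (hw s y)).
Qed.

Lemma is_derive_within (V : normedModType R) (J : set R) (u : R -> V) (t : R) (l : V) :
  is_derive t 1 u l -> has_derive_within J u t l.
Proof.
move=> [/derive_epsP du <-]; apply/within_dnbhsP => e /du[r r0 hr]; exists r => //.
move=> s _ st ts; have := hr (s - t).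
by rewrite subr_eq0 distrC scaler1 subrK; exact.
Qed.

(** The first hypothesis makes [t] a limit point of [J], so that the value chosen by [lim] must be
    [l]. *)
Lemma has_derive_within_unique (V : normedModType R) (J : set R) (u : R -> V) (t : R) (l : V) :
  (forall r : R, 0 < r -> exists s, [/\ J s, s != t & `|t - s| < r]) ->
  has_derive_within J u t l -> derivable_within J u t /\ derive_within J u t = l.
Proof.
move=> Jt du; have cu : derivable_within J u t by apply/cvg_ex; exists l.
split=> //; have := derive_withinP cu; move: du.
move=> /within_dnbhsP h1 /within_dnbhsP h2; apply/eqP; rewrite -subr_eq0 -normr_eq0.
rewrite eq_le normr_ge0 andbT; apply/ler_addgt0Pr => e e0; rewrite add0r.
have [|r1 r10 hr1] := h1 (e / 2); first by rewrite divr_gt0.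
have [|r2 r20 hr2] := h2 (e / 2); first by rewrite divr_gt0.
have [|s [Js st]] := Jt (Num.min r1 r2); first by rewrite lt_min r10.
rewrite lt_min => /andP[sr1 sr2].
have := hr1 s Js st sr1; have := hr2 s Js st sr2.
set q := _ *: _ => k2 k1; have := ler_normB (derive_within J u t - q) (l - q).
by rewrite opprB addrA subrK; lra.
Qed.

Lemma interval_limit_point (a b t r : R) : a < b -> a <= t <= b -> 0 < r ->
  exists s, [/\ `[a, b]%classic s, s != t & `|t - s| < r].
Proof.
move=> ab tI r0; pose c := Num.min (r / 2) ((b - a) / 2).
have c0 : 0 < c by rewrite lt_min !divr_gt0// subr_gt0.
have cr : c <= r / 2 by rewrite ge_min lexx.
have ce : c <= (b - a) / 2 by rewrite ge_min lexx orbT.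
have [tm|tm] := leP t ((a + b) / 2).
- exists (t + c); split.
  + by rewrite /= in_itv /=; case/andP: tI => ? ?; apply/andP; split; lra.
  + by rewrite -subr_eq0 addrAC subrr add0r gt_eqF.
  + by rewrite opprD addrA subrr add0r normrN gtr0_norm//; lra.
- exists (t - c); split.
  + by rewrite /= in_itv /=; case/andP: tI => ? ?; apply/andP; split; lra.
  + by rewrite -subr_eq0 addrAC subrr add0r oppr_eq0 gt_eqF.
  + by rewrite opprB addrC subrK gtr0_norm//; lra.
Qed.

Lemma polyfield_pderive (g : R -> 'cV[R]_d -> 'cV[R]_d) i :
  (forall k, polyfun (fun s y => g s y k 0)) ->
  (forall s y, pderivable setT i g s y) /\
  forall k, polyfun (fun s y => pderive setT i g s y k 0).
Proof.
move=> pg.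
have /choice[g' hg'] : forall k, exists u', polyfun u' /\
    polyfun_derivative i (fun s y => g s y k 0) u'.
  by move=> k; exact: polyfun_derivable.
have lim_setT (t r : R) : 0 < r -> exists s : R, [/\ setT s, s != t & `|t - s| < r].
  move=> r0; exists (t + r / 2); split=> //.
    by rewrite -subr_eq0 addrAC subrr add0r gt_eqF// divr_gt0.
  by rewrite opprD addrA subrr add0r normrN gtr0_norm ?divr_gt0//; lra.
case: i hg' => [j|] hg' /=.
- have dg s y : derivable (g s) y (delta_mx j 0).
    apply/derivable_mxP => k c; rewrite ord1.
    by have := (hg' k).2 s y => -[].
  split=> // k; apply: polyfun_ext (hg' k).1 _ => s y.
  by rewrite derive_mx// mxE; have := (hg' k).2 s y => -[].
- have hd s y : has_derive_within setT (g^~ y) s (\col_k g' k s y).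
    apply: has_derive_within_cV => k; rewrite mxE; apply: is_derive_within.
    exact: (hg' k).2.
  have hu s y := has_derive_within_unique (lim_setT s) (hd s y).
  split=> [s y|k]; first by have [] := hu s y.
  by apply: polyfun_ext (hg' k).1 _ => s y; have [_ ->] := hu s y; rewrite mxE.
Qed.

(** Iterated partial derivatives of a polynomial field are again polynomial, so they exist and are
    continuous at every order; this is the smoothness asked for by [rk_order]. *)
Lemma polyfield_classC (g : R -> 'cV[R]_d -> 'cV[R]_d) l :
  (forall k, polyfun (fun s y => g s y k 0)) -> classC l setT setT g.
Proof.
move=> pg.
have pw w : forall k, polyfun (fun s y => foldr (pderive setT) g w s y k 0).
  by elim: w => [//|i w IH] /=; have [] := polyfield_pderive i IH.
move=> w _; split.
  apply: continuous_subspaceT => z; apply/cvgrPdist_le => e e0.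
  near=> z'; apply: cV_norm_le => [|k]; first exact: ltW.
  rewrite !mxE; move: k; near: z'; apply: filter_forall => k.
  have /(_ z)/cvgrPdist_le := polyfun_continuous (pw w k); exact.
move=> _ i t y _ _; have [h _] := polyfield_pderive i (pw w); exact: h.
Unshelve. all: by end_near. Qed.

Lemma poly_curve_solution (g : R -> 'cV[R]_d -> 'cV[R]_d) (V : 'I_d -> {poly R}) (tau eps : R) :
  0 < eps ->
  (forall s k, (V k)^`().[s] = g s (\col_k (V k).[s]) k 0) ->
  ode_solution g setT tau (tau + eps) (\col_k (V k).[tau]) (fun s => \col_k (V k).[s]).
Proof.
move=> e0 hV; split=> // t tI.
have lim_pt (r : R) : 0 < r ->
    exists s, [/\ `[tau, tau + eps]%classic s, s != t & `|t - s| < r].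
  by apply: interval_limit_point => //; rewrite ltrDl.
have hd : has_derive_within `[tau, tau + eps]%classic (fun s => \col_k (V k).[s]) t
    (g t (\col_k (V k).[t])).
  apply: has_derive_within_cV => k; rewrite -hV.
  have -> : (fun s => (\col_k0 (V k0).[s]) k 0) = horner (V k).
    by apply/funext => s; rewrite mxE.
  exact: has_derive_within_horner.
by have [h1 h2] := has_derive_within_unique lim_pt hd; split.
Qed.

End PolynomialFields.

(** * Runge-Kutta schemes *)

Section RKStages.
Context {R : realType} (rk : explicit_rk R) {d : nat}.
Implicit Types (g : R -> 'cV[R]_d -> 'cV[R]_d) (t h : R) (v : 'cV[R]_d).

Definition rk_stage g t v h (i : nat) : 'cV[R]_d := (rk_k rk g t v h i.+1)`_i.

Lemma size_rk_k g t v h n : size (rk_k rk g t v h n) = n.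
Proof. by elim: n => //= n IH; rewrite size_rcons IH. Qed.

(** A stage does not depend on how many later stages are computed, which allows stages to be indexed
    without the list. *)
Lemma nth_rk_k g t v h n i : (i < n)%N -> (rk_k rk g t v h n)`_i = rk_stage g t v h i.
Proof.
elim: n => // n IH; rewrite ltnS leq_eqVlt => /orP[/eqP ->//|ilt].
by rewrite /= nth_rcons size_rk_k ilt IH.
Qed.

Lemma rk_stageE g t v h i : rk_stage g t v h i =
  g (t + rk_c rk i * h) (v + h *: \sum_(j < i) rk_a rk i j *: rk_stage g t v h j).
Proof.
rewrite /rk_stage /= nth_rcons size_rk_k ltnn eqxx; congr (g _ (_ + _ *: _)).
by apply: eq_bigr => j _; rewrite nth_rk_k.
Qed.

Lemma rk_incrementE g t v h : rk_increment rk g t v h =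
  h *: \sum_(j < rk_stages rk) rk_b rk j *: rk_stage g t v h j.
Proof.
by rewrite /rk_increment; congr (_ *: _); apply: eq_bigr => j _; rewrite nth_rk_k.
Qed.

Definition rk_asum : R :=
  \sum_(i < rk_stages rk) \sum_(j < i) `|rk_a rk i j|.

Lemma rk_asum_row i : (i < rk_stages rk)%N -> \sum_(j < i) `|rk_a rk i j| <= rk_asum.
Proof.
move=> si; rewrite /rk_asum (bigD1 (Ordinal si)) //= lerDl sumr_ge0// => k _.
exact: sumr_ge0.
Qed.

(** A Gronwall estimate over the stages. The bound [M] confines the stage arguments to the ball of
    radius [rk_asum * M * h] where the fields are compared, and the gap at stage [i] is at most
    [alpha * Q ^+ i]. As [C] depends on [M] and [beta] only, the lemma serves for consistency
    (auxiliary against polynomial field), for stability (two base values) and for comparison with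
    the zero field. *)
Lemma rk_compare (M beta : R) : 0 <= M -> 0 <= beta -> exists C : R, 0 <= C /\
  forall g g' t t' h alpha, 0 <= h <= 1 -> 0 <= alpha ->
  (forall i xi xi', (i < rk_stages rk)%N ->
     `|xi| <= rk_asum * M * h -> `|xi'| <= rk_asum * M * h ->
     [/\ `|g (t + rk_c rk i * h) xi| <= M, `|g' (t' + rk_c rk i * h) xi'| <= M &
       `|g (t + rk_c rk i * h) xi - g' (t' + rk_c rk i * h) xi'|
         <= alpha + beta * `|xi - xi'|]) ->
  `|rk_increment rk g t 0 h - rk_increment rk g' t' 0 h| <= C * h * alpha.
Proof.
move=> M0 b0; pose Q : R := 1 + beta * rk_asum.
have A0 : 0 <= rk_asum by apply: sumr_ge0 => i _; exact: sumr_ge0.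
have Q1 : 1 <= Q by rewrite lerDl mulr_ge0.
exists ((\sum_(j < rk_stages rk) `|rk_b rk j|) * Q ^+ rk_stages rk); split.
  by rewrite mulr_ge0 ?sumr_ge0// exprn_ge0// (le_trans ler01).
move=> g g' t t' h alpha /andP[h0 h1] al0 hyp.
have comb (K : nat -> 'cV[R]_d) (c : R) i : (i < rk_stages rk)%N -> 0 <= c ->
    (forall j, (j < i)%N -> `|K j| <= c) ->
    `|h *: \sum_(j < i) rk_a rk i j *: K j| <= rk_asum * c * h.
  move=> si c0 hK; rewrite normrZ ger0_norm// mulrC ler_wpM2r//.
  rewrite (le_trans (ler_norm_sum _ _ _))//.
  apply: (@le_trans _ _ ((\sum_(j < i) `|rk_a rk i j|) * c)); last first.
    by rewrite ler_wpM2r// rk_asum_row.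
  by rewrite mulr_suml; apply: ler_sum => j _; rewrite normrZ ler_wpM2l// hK.
pose K := rk_stage g t 0 h; pose K' := rk_stage g' t' 0 h.
have stage i : (i < rk_stages rk)%N ->
    [/\ `|K i| <= M, `|K' i| <= M & `|K i - K' i| <= alpha * Q ^+ i].
  elim/ltn_ind: i => i IH si.
  have IH' j : (j < i)%N -> [/\ `|K j| <= M, `|K' j| <= M
      & `|K j - K' j| <= alpha * Q ^+ j].
    by move=> ji; apply: IH => //; exact: ltn_trans si.
  have bK : forall j, (j < i)%N -> `|K j| <= M by move=> j /IH'[].
  have bK' : forall j, (j < i)%N -> `|K' j| <= M by move=> j /IH'[].
  have [k1 k2 k3] := hyp i _ _ si (comb K M i si M0 bK) (comb K' M i si M0 bK').
  rewrite /K /K' !rk_stageE !add0r; split=> //; apply: (le_trans k3).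
  rewrite -scalerBr -sumrB.
  have -> : \sum_(j < i) (rk_a rk i j *: K j - rk_a rk i j *: K' j)
      = \sum_(j < i) rk_a rk i j *: (K j - K' j).
    by apply: eq_bigr => j _; rewrite scalerBr.
  (* Stage 0 has no inner sum. For stage [i.+1] all earlier gaps are at most [alpha * Q ^+ i], and
     the factor [1 + beta * rk_asum] is [Q]. *)
  case: i IH si IH' bK bK' k1 k2 k3 => [|i] _ si IH' _ _ _ _ _.
    by rewrite big_ord0 scaler0 normr0 mulr0 addr0 expr0 mulr1.
  have Qi1 : 1 <= Q ^+ i by rewrite exprn_ege1.
  have hK j : (j < i.+1)%N -> `|K j - K' j| <= alpha * Q ^+ i.
    move=> ji; have [_ _ h3] := IH' j ji; apply: (le_trans h3).
    by rewrite ler_wpM2l// ler_weXn2l.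
  have c0 : 0 <= alpha * Q ^+ i by rewrite mulr_ge0// (le_trans ler01).
  have hc := comb (fun j => K j - K' j) _ _ si c0 hK.
  have := ler_wpM2l b0 hc => h2.
  have h3 : beta * (rk_asum * (alpha * Q ^+ i) * h) <= beta * (rk_asum * (alpha * Q ^+ i)).
    by rewrite ler_wpM2l// ler_piMr// mulr_ge0.
  have h4 : alpha <= alpha * Q ^+ i by rewrite ler_peMr.
  apply: (le_trans (lerD h4 (le_trans h2 h3))).
  by rewrite exprS /Q le_eqVlt; apply/orP; left; apply/eqP; ring.
rewrite !rk_incrementE -scalerBr -sumrB normrZ ger0_norm//.
rewrite [leRHS]mulrAC [leRHS]mulrC ler_wpM2l//.
rewrite (le_trans (ler_norm_sum _ _ _))// -mulrA mulr_suml.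
apply: ler_sum => j _; rewrite -scalerBr normrZ ler_wpM2l//.
have [_ _ h3] := stage j (ltn_ord j); apply: (le_trans h3).
by rewrite mulrC ler_wpM2r// ler_weXn2l// ltnW.
Qed.

End RKStages.

(** * Polynomials in the step size, uniformly in a parameter *)

Section UniformPolynomials.
Context {R : realType} {P : Type} (S : set P).
Implicit Types F : P -> R -> R.

(** The representing polynomial is hidden behind the values of [F]; it is determined by them, by
    [horner_ext], which is how derivatives and primitives are handled. *)
Definition upoly F := exists q : {poly R}, (forall i, 0 <= q`_i) /\
  forall s, S s -> exists p, maj p q /\ forall h, F s h = p.[h].

Lemma upoly_ext F F' : upoly F -> (forall s h, S s -> F s h = F' s h) -> upoly F'.
Proof.
move=> [q [q0 hq]] e; exists q; split=> // s Ss; have [p [pq hp]] := hq s Ss.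
by exists p; split=> // h; rewrite -e.
Qed.

Lemma upoly_cst (c : P -> R) (C : R) : 0 <= C -> (forall s, S s -> `|c s| <= C) ->
  upoly (fun s _ => c s).
Proof.
move=> C0 cC; exists C%:P; split=> [i|s Ss]; first by rewrite coefC; case: ifP.
by exists (c s)%:P; split=> [|h]; [exact: majC (cC _ Ss)|rewrite hornerC].
Qed.

Lemma upoly_id : upoly (fun _ h => h).
Proof.
exists 'X; split=> [i|s Ss]; first by rewrite coefX.
by exists 'X; split=> [|h]; [exact: majX|rewrite hornerX].
Qed.

Lemma upolyD F G : upoly F -> upoly G -> upoly (fun s h => F s h + G s h).
Proof.
move=> [q [q0 hq]] [r [r0 hr]]; exists (q + r); split=> [i|s Ss].
  by rewrite coefD addr_ge0.
have [p [pq ep]] := hq s Ss; have [p' [pq' ep']] := hr s Ss.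
by exists (p + p'); split=> [|h]; [exact: majD|rewrite ep ep' hornerD].
Qed.

Lemma upolyM F G : upoly F -> upoly G -> upoly (fun s h => F s h * G s h).
Proof.
move=> [q [q0 hq]] [r [r0 hr]]; exists (q * r); split=> [i|s Ss].
  by rewrite coefM sumr_ge0// => j _; rewrite mulr_ge0.
have [p [pq ep]] := hq s Ss; have [p' [pq' ep']] := hr s Ss.
by exists (p * p'); split=> [|h]; [exact: majM|rewrite ep ep' hornerM].
Qed.

Lemma upolyN F : upoly F -> upoly (fun s h => - F s h).
Proof.
move=> [q [q0 hq]]; exists q; split=> // s Ss; have [p [pq ep]] := hq s Ss.
by exists (- p); split=> [|h]; [exact: majN|rewrite ep hornerN].
Qed.

Lemma upoly_sum (n : nat) (F : 'I_n -> P -> R -> R) :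
  (forall j, upoly (F j)) -> upoly (fun s h => \sum_(j < n) F j s h).
Proof.
move=> hF; have [q hq] := choice hF.
exists (\sum_j q j); split=> [i|s Ss].
  by rewrite coef_sum sumr_ge0// => j _; exact: (hq j).1.
have /choice[p hp] : forall j, exists p, maj p (q j) /\ forall h, F j s h = p.[h].
  by move=> j; exact: (hq j).2.
exists (\sum_j p j); split=> [|h]; first by apply: maj_sum => j _; exact: (hp j).1.
by rewrite horner_sum; apply: eq_bigr => j _; exact: (hp j).2.
Qed.

Lemma upoly_scale F (c : R) : upoly F -> upoly (fun s h => F s (c * h)).
Proof.
move=> [q [q0 hq]]; have qm : maj q q by move=> i; rewrite ger0_norm.
exists (q \Po (`|c| *: 'X)); split=> [i|s Ss].
  exact: maj_ge0 (maj_comp_scale c qm) i.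
have [p [pq ep]] := hq s Ss; exists (p \Po (c *: 'X)); split.
  exact: maj_comp_scale.
by move=> h; rewrite ep horner_comp hornerZ hornerX.
Qed.

Lemma upoly_antideriv F (G : P -> {poly R}) : upoly F ->
  (forall s, S s -> forall h, F s h = (G s).[h]) ->
  upoly (fun s h => (antideriv (G s)).[h]).
Proof.
move=> [q [q0 hq]] FG; exists ('X * q); split=> [i|s Ss].
  by rewrite coefXM; case: eqP.
have [p [pq ep]] := hq s Ss; exists (antideriv p); split; first exact: maj_antideriv.
suff -> : G s = p by [].
by apply: horner_ext => h; rewrite -FG.
Qed.

Lemma upoly_deriv (G : P -> {poly R}) : upoly (fun s h => (G s).[h]) ->
  upoly (fun s h => (G s)^`().[h]).
Proof.
move=> [q [q0 hq]]; exists q^`(); split=> [i|s Ss].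
  by rewrite coef_deriv mulrn_wge0.
have [p [pq ep]] := hq s Ss; exists p^`(); split; first exact: maj_deriv.
suff -> : G s = p by [].
exact: horner_ext.
Qed.

Lemma upoly_peval (I : finType) (Q : P -> seq (R * seq I)) (z : P -> R -> I -> R)
    (C : R) (k : nat) : 0 <= C ->
  (forall s, S s -> pweight (Q s) <= C /\
     all (fun c : R * seq I => size c.2 <= k)%N (Q s)) ->
  (forall a, upoly (fun s h => z s h a)) -> upoly (fun s h => peval (Q s) (z s h)).
Proof.
move=> C0 hQ hz; have [q hq] := choice hz.
pose q1 := \sum_a q a.
have q10 i : 0 <= q1`_i by rewrite coef_sum sumr_ge0// => a _; exact: (hq a).1.
have q1a a i : (q a)`_i <= q1`_i.
  by rewrite coef_sum (bigD1 a) //= lerDl sumr_ge0// => b _; exact: (hq b).1.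
have main s (p : I -> {poly R}) : S s -> (forall a, maj (p a) (q a)) ->
    maj (ppeval (Q s) p) (C *: (1 + q1) ^+ k).
  move=> Ss pq; have [h1 h2] := hQ s Ss; apply: maj_ppeval => // a i.
  exact: le_trans (pq a i) (q1a a i).
exists (C *: (1 + q1) ^+ k); split=> [i|s Ss].
  rewrite coefZ mulr_ge0//; apply: (@maj_ge0 _ ((1 + q1) ^+ k) _ _ i).
  have m1 : maj (1 + q1) (1 + q1).
    by apply: majD; [exact: maj1|move=> j; rewrite ger0_norm].
  elim: (k) => [|n IH]; first by rewrite expr0; exact: maj1.
  by rewrite exprS; apply: majM.
have /choice[p hp] : forall a, exists p, maj p (q a) /\ forall h, z s h a = p.[h].
  by move=> a; exact: (hq a).2.
exists (ppeval (Q s) p); split; first by apply: main => // a; exact: (hp a).1.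
move=> h; rewrite horner_ppeval; congr peval.
by apply/funext => a; exact: (hp a).2.
Qed.

(** [K] and [h0] may depend on the parameter: they serve to annihilate the coefficients below [n].
    The remaining ones are controlled by the majorant, whence the uniform constant [q(1)] on
    [[0, 1]]. *)
Lemma upoly_bigO F n : upoly F ->
  (forall s, S s -> exists K h0 : R, 0 < h0 /\
     forall h, 0 < h <= h0 -> `|F s h| <= K * h ^+ n) ->
  exists C : R, 0 <= C /\ forall s, S s -> forall h, 0 <= h <= 1 -> `|F s h| <= C * h ^+ n.
Proof.
move=> [q [q0 hq]] hF; exists q.[1]; split.
  by rewrite horner_coef sumr_ge0// => i _; rewrite expr1n mulr1.
move=> s Ss h h01; have [p [pq ep]] := hq s Ss; rewrite ep.
apply: horner_maj_low => //; have [K [h0 [h00 hK]]] := hF s Ss.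
by apply: (bigO_coef_eq0 (K := K) h00) => k hk; rewrite -ep; exact: hK.
Qed.

End UniformPolynomials.

Section UniformOrder.
Context {R : realType} (rk : explicit_rk R) {d : nat} {P : Type} (S : set P).
Variable G : P -> R -> 'cV[R]_d -> 'cV[R]_d.
Hypothesis G_upoly : forall (c : R) (xi : P -> R -> 'cV[R]_d),
  (forall k, upoly S (fun s h => xi s h k 0)) ->
  forall k, upoly S (fun s h => G s (c * h) (xi s h) k 0).

(** A stage of an explicit scheme evaluates [G] at a combination of earlier stages, so strong
    induction applies. *)
Lemma rk_stage_upoly i k : upoly S (fun s h => rk_stage rk (G s) 0 0 h i k 0).
Proof.
elim/ltn_ind: i k => i IH k.
have xi_upoly l : upoly S (fun s h =>
    (h *: \sum_(j < i) rk_a rk i j *: rk_stage rk (G s) 0 0 h j) l 0).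
  have := upolyM (upoly_id S) (upoly_sum (n := i)
    (F := fun j s h => rk_a rk i j * rk_stage rk (G s) 0 0 h j l 0) _).
  move=> h; apply: upoly_ext (h _) _ => [j|s t _].
    apply: upolyM; last exact: IH.
    exact: (upoly_cst (normr_ge0 (rk_a rk i j))).
  by rewrite mxE summxE; congr (_ * _); apply: eq_bigr => j _; rewrite mxE.
apply: upoly_ext (G_upoly (rk_c rk i) xi_upoly k) _ => s h _.
by rewrite rk_stageE !add0r.
Qed.

Lemma rk_increment_upoly k : upoly S (fun s h => rk_increment rk (G s) 0 0 h k 0).
Proof.
have := upolyM (upoly_id S) (upoly_sum (n := rk_stages rk)
  (F := fun j s h => rk_b rk j * rk_stage rk (G s) 0 0 h j k 0) _).
move=> h; apply: upoly_ext (h _) _ => [j|s t _].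
  apply: upolyM; last exact: rk_stage_upoly.
  exact: (upoly_cst (normr_ge0 (rk_b rk j))).
rewrite rk_incrementE mxE summxE; congr (_ * _).
by apply: eq_bigr => j _; rewrite mxE.
Qed.

(* Coefficientwise, the local error is a polynomial in h whose low-order
   coefficients vanish, by the order condition for each fixed parameter, and
   whose other coefficients are bounded uniformly in the parameter. *)
Lemma rk_order_uniform (n : nat) (V : P -> 'I_d -> {poly R}) : rk_order rk n ->
  (forall s, S s -> forall k, polyfun (fun t y => G s t y k 0)) ->
  (forall k, upoly S (fun s h => (V s k).[h])) ->
  (forall s, S s -> forall k, (V s k).[0] = 0) ->
  (forall s, S s -> forall t k, (V s k)^`().[t] = G s t (\col_k (V s k).[t]) k 0) ->
  exists C : R, 0 <= C /\ forall s, S s -> forall h, 0 <= h <= 1 ->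
    `|\col_k (V s k).[h] - rk_increment rk (G s) 0 0 h| <= C * h ^+ n.+1.
Proof.
move=> hrk pG uV V0 dV.
have /choice[C hC] : forall k, exists C : R, 0 <= C /\ forall s, S s ->
    forall h, 0 <= h <= 1 ->
    `|(V s k).[h] + - rk_increment rk (G s) 0 0 h k 0| <= C * h ^+ n.+1.
  move=> k; apply: upoly_bigO.
    by apply: upolyD => //; apply: upolyN; exact: rk_increment_upoly.
  move=> s Ss; have clG l : classC l setT setT (G s) by apply: polyfield_classC; exact: pG.
  have sol := poly_curve_solution 0 ltr01 (dV s Ss).
  have [K [h0 [/andP[h00 _] hK]]] := hrk d (G s) clG 0 1 _ _ ltr01 sol.
  exists K, h0; split=> // h hh; have := hK h hh; rewrite add0r.
  have -> : \col_k (V s k).[0] = 0 by apply/colP => j; rewrite !mxE V0.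
  rewrite add0r; apply: le_trans.
  have := coord_norm_le (\col_k (V s k).[h] - rk_increment rk (G s) 0 0 h) k 0.
  have e (A B : 'cV[R]_d) : (A - B) k 0 = A k 0 - B k 0 by rewrite !mxE.
  by rewrite e mxE.
exists (\sum_k C k); split; first by apply: sumr_ge0 => k _; exact: (hC k).1.
move=> s Ss h h01; have hn : 0 <= h ^+ n.+1 by rewrite exprn_ge0//; case/andP: h01.
apply: cV_norm_le => [|k].
  by rewrite mulr_ge0// sumr_ge0// => k _; exact: (hC k).1.
have e (A B : 'cV[R]_d) : (A - B) k 0 = A k 0 - B k 0 by rewrite !mxE.
rewrite e mxE (le_trans ((hC k).2 s Ss h h01))// ler_wpM2r// (bigD1 k) //= lerDl.
by apply: sumr_ge0 => j _; exact: (hC j).1.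
Qed.

End UniformOrder.

(** * Local error *)

Section PicardPolynomials.
Context {R : realType} {d : nat}.
Variables (t0 T : R) (D : set 'cV[R]_d) (f : R -> 'cV[R]_d -> 'cV[R]_d).
Variables (N : nat) (x : R -> 'cV[R]_d) (rho B : R).
Hypothesis rho0 : 0 < rho.
Hypothesis B0 : 0 <= B.
Hypothesis tubeP : forall t s y, t0 <= t <= T -> t0 <= s <= T ->
  `|s - t| <= rho -> `|y - x t| <= rho -> D y /\
  forall w, (size w <= N)%N -> `|foldr (pderive `[t0, T]) f w s y| <= B.
Hypothesis hx : forall t, t0 <= t <= T ->
  has_derive_within `[t0, T]%classic x t (f t (x t)).

Lemma tube_f_bound t s y : t0 <= t <= T -> t0 <= s <= T ->
  `|s - t| <= rho -> `|y - x t| <= rho -> `|f s y| <= B.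
Proof. by move=> tI sI st yx; have [_ /(_ [::])] := tubeP tI sI st yx; exact. Qed.

(** Plays the role of the integral equation: a bound on [f - p'] along the solution becomes a bound
    on [x - p], with one more factor [|s|]. *)
Lemma solution_poly_error t s i (p : {poly R}) (e : R) :
  t0 <= t <= T -> t0 <= t + s <= T -> p.[0] = 0 ->
  (forall r, `|r| <= `|s| -> t0 <= t + r <= T ->
     `|f (t + r) (x (t + r)) i 0 - p^`().[r]| <= e) ->
  `|x (t + s) i 0 - x t i 0 - p.[s]| <= e * `|s|.
Proof.
move=> tI tsI p0 hp; pose p' := p \Po ('X - t%:P).
have ep r : p'.[t + r] = p.[r].
  by rewrite /p' horner_comp !hornerE addrAC subrr add0r.
have ep' r : p'^`().[r] = p^`().[r - t].
  by rewrite /p' deriv_comp derivXsubC mulr1 horner_comp !hornerE.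
have p't : p'.[t] = 0 by rewrite -[t]addr0 ep.
have bet r : Num.min t (t + s) <= r <= Num.max t (t + s) -> t0 <= r <= T.
  rewrite ge_min le_max; move: tI tsI => /andP[? ?] /andP[? ?].
  by move=> /andP[/orP[?|?] /orP[?|?]]; apply/andP; split; lra.
have := @mean_value_poly R `[t0, T] (fun r => x r i 0) (fun r => f r (x r) i 0)
  p' t (t + s) e.
rewrite ep p't subr0 [t + s]addrC addrK addrC; apply => r hr.
- by rewrite /= in_itv /=; exact: bet.
- by apply: has_derive_within_coord; apply: hx; exact: bet.
- rewrite ep'; have := hp (r - t); rewrite (addrC t) subrK; apply; last exact: bet.
  move: hr; rewrite ge_min le_max ler_norml => hr.
  have := ler_norm s; have := ler_norm (- s); rewrite normrN => ? ?.
  by move: hr => /andP[/orP[?|?] /orP[?|?]]; apply/andP; split; lra.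
Qed.

Lemma solution_lipschitz t s : t0 <= t <= T -> t0 <= t + s <= T ->
  `|x (t + s) - x t| <= B * `|s|.
Proof.
move=> tI tsI; apply: cV_norm_le => [|i]; first by rewrite mulr_ge0.
have := @solution_poly_error t s i 0 B tI tsI; rewrite !horner0 !mxE subr0; apply=> //.
move=> r _ rI; rewrite deriv0 horner0 subr0 (le_trans (coord_norm_le _ _ _))//.
by apply: (tube_f_bound rI rI); rewrite subrr normr0 ltW.
Qed.

Variables (k : nat) (W : R -> 'I_d -> seq (R * seq (option 'I_d))) (CW L : R).
Hypothesis CW0 : 0 <= CW.
Hypothesis L0 : 0 <= L.
Hypothesis hW : forall t, t0 <= t <= T -> forall i : 'I_d,
  [/\ pweight (W t i) <= CW, all (fun c => size c.2 <= k)%N (W t i) &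
    forall s v r, t0 <= t + s <= T -> `|s| <= r -> `|v| <= r -> r <= rho ->
      `|f (t + s) (x t + v) i 0 - peval (W t i) (coords s v)| <= CW * r ^+ k].
Hypothesis hL : forall t s y y', t0 <= t <= T -> t0 <= s <= T ->
  `|s - t| <= rho -> `|y - x t| <= rho -> `|y' - x t| <= rho ->
  `|f s y - f s y'| <= L * `|y - y'|.

Definition pcoords (q : 'I_d -> {poly R}) : option 'I_d -> {poly R} :=
  fun a => if a is Some j then q j else 'X.

(** Picard iterates, in the time elapsed since [t], for the equation whose right-hand side is the
    Taylor polynomial [W t]. *)
Fixpoint picard (m : nat) (t : R) (i : 'I_d) : {poly R} :=
  if m is m'.+1 then antideriv (ppeval (W t i) (pcoords (picard m' t))) else 0.

Definition picard_col m t s : 'cV[R]_d := \col_i (picard m t i).[s].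

Lemma picard_at0 m t i : (picard m t i).[0] = 0.
Proof. by case: m => [|m] /=; rewrite ?horner0 ?antideriv0. Qed.

Lemma picard_deriv m t i s :
  (picard m.+1 t i)^`().[s] = peval (W t i) (coords s (picard_col m t s)).
Proof.
rewrite /= deriv_antideriv horner_ppeval; congr peval; apply/funext => -[j|] /=.
  by rewrite mxE.
by rewrite hornerX.
Qed.

Lemma upoly_taylor (z : R -> R -> option 'I_d -> R) i :
  (forall a, upoly [set t | t0 <= t <= T] (fun t h => z t h a)) ->
  upoly [set t | t0 <= t <= T] (fun t h => peval (W t i) (z t h)).
Proof.
move=> hz; apply: (upoly_peval (C := CW) (k := k)) => // t tI.
by have [] := hW tI i.
Qed.

Lemma picard_upoly m i : upoly [set t | t0 <= t <= T] (fun t h => (picard m t i).[h]).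
Proof.
elim: m i => [|m IH] i /=.
  apply: upoly_ext (@upoly_cst _ _ _ (fun=> 0) 0 _ _) _ => // [t _|t h _].
    by rewrite normr0.
  by rewrite horner0.
apply: (@upoly_antideriv _ _ _ (fun t h => peval (W t i) (coords h (picard_col m t h)))).
  apply: upoly_taylor => -[j|] /=; last exact: upoly_id.
  by apply: upoly_ext (IH j) _ => t h _; rewrite mxE.
by move=> t _ h; rewrite -picard_deriv /= deriv_antideriv.
Qed.

(* Each Picard step gains one order, until the accuracy of the Taylor
   polynomials W is reached. *)
Lemma picard_error m : (m <= k)%N -> exists r C : R, [/\ 0 < r, 0 <= C &
  forall t s, t0 <= t <= T -> t0 <= t + s <= T -> `|s| <= r ->
    [/\ `|x (t + s) - x t - picard_col m t s| <= C * `|s| ^+ m.+1,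
        `|picard_col m t s| <= C * `|s| &
        (0 < m)%N -> forall i,
          `|f (t + s) (x (t + s)) i 0 - (picard m t i)^`().[s]| <= C * `|s| ^+ m]].
Proof.
elim: m => [_|m IH mk].
  exists 1, B; split=> // t s tI tsI s1.
  have -> : picard_col 0 t s = 0 by apply/colP => i; rewrite !mxE horner0.
  rewrite subr0 expr1 normr0; split=> //; last by rewrite mulr_ge0.
  exact: solution_lipschitz.
have [r [C [r0 C0 hC]]] := IH (ltnW mk).
(* The radius [E |s|] contains [s] and the current iterate, and [r'] keeps it below [rho], as the
   Taylor estimate requires. *)
pose E := B + C + 1; have E1 : 1 <= E by rewrite lerDr addr_ge0.
have BE : B <= E by move: B0 => b0; rewrite /E; lra.
have CE : C <= E by move: B0 => b0; rewrite /E; lra.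
have E0 : 0 < E := lt_le_trans ltr01 E1.
pose r' := Num.min (Num.min r 1) (rho / E).
have r'0 : 0 < r' by rewrite !lt_min r0 ltr01 divr_gt0.
pose C' := CW * E ^+ k + L * C.
have C'0 : 0 <= C' by rewrite addr_ge0 ?mulr_ge0// exprn_ge0// ltW.
have dbound t s i : t0 <= t <= T -> t0 <= t + s <= T -> `|s| <= r' ->
    `|f (t + s) (x (t + s)) i 0 - (picard m.+1 t i)^`().[s]| <= C' * `|s| ^+ m.+1.
  move=> tI tsI; rewrite !le_min ler_pdivlMr// => /andP[/andP[sr s1] sE].
  have [e1 e2 _] := hC t s tI tsI sr.
  have s0 : 0 <= `|s| by [].
  have hxs := solution_lipschitz tI tsI.
  have vE : `|picard_col m t s| <= E * `|s|.
    by rewrite (le_trans e2)// ler_wpM2r.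
  have sE' : `|s| <= E * `|s| by rewrite ler_peMl.
  have Er : E * `|s| <= rho by rewrite mulrC.
  have st : `|t + s - t| <= rho by rewrite addrAC subrr add0r (le_trans sE').
  have [_ _ hWt] := hW tI i.
  (* Two errors add up: the Taylor remainder, of order [k], and the effect through [f] of the
     previous iterate's error, of order [m.+1 <= k]. *)
  have w1 := hWt s (picard_col m t s) _ tsI sE' vE Er.
  have w2 : `|f (t + s) (x (t + s)) - f (t + s) (x t + picard_col m t s)|
      <= L * (C * `|s| ^+ m.+1).
    apply: le_trans (hL tI tsI st _ _) _.
    - by rewrite (le_trans hxs)// (le_trans _ Er)// ler_wpM2r.
    - by rewrite addrAC subrr add0r (le_trans vE).
    - by rewrite opprD addrA ler_wpM2l.
  have w3 := le_trans (coord_norm_le _ i 0) w2.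
  rewrite picard_deriv; move: w3; rewrite mxE [X in _ + X]mxE => w3.
  have sk : `|s| ^+ k <= `|s| ^+ m.+1 by rewrite ler_wiXn2l.
  have w4 : CW * (E * `|s|) ^+ k <= CW * E ^+ k * `|s| ^+ m.+1.
    by rewrite exprMn mulrA ler_wpM2l// mulr_ge0// exprn_ge0// ltW.
  rewrite -(subrKA (f (t + s) (x t + picard_col m t s) i 0)).
  rewrite (le_trans (ler_normD _ _))// (le_trans (lerD w3 (le_trans w1 w4)))//.
  by rewrite /C'; lra.
have vbound t s : t0 <= t <= T -> t0 <= t + s <= T -> `|s| <= r' ->
    `|x (t + s) - x t - picard_col m.+1 t s| <= C' * `|s| ^+ m.+2.
  move=> tI tsI sr; apply: cV_norm_le => [|i]; first by rewrite mulr_ge0// exprn_ge0.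
  rewrite exprSr mulrA; have := @solution_poly_error t s i (picard m.+1 t i)
    (C' * `|s| ^+ m.+1) tI tsI (picard_at0 _ _ _).
  rewrite !mxE; apply=> q qs qI; apply: (le_trans (dbound _ _ _ tI qI (le_trans qs sr))).
  by rewrite ler_wpM2l// lerXn2r.
exists r', (C' + B); split=> [//||t s tI tsI sr]; first by rewrite addr_ge0.
have s0 n : 0 <= `|s| ^+ n by rewrite exprn_ge0.
have v := vbound t s tI tsI sr.
split.
- by apply: (le_trans v); rewrite ler_wpM2r// lerDl.
- have hxs := solution_lipschitz tI tsI.
  have := ler_normB (x (t + s) - x t) (x (t + s) - x t - picard_col m.+1 t s).
  rewrite opprB addrC subrK => h; apply: (le_trans h).
  have s1 : `|s| <= 1 by apply: (le_trans sr); rewrite /r' !ge_min lexx orbT.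
  have e3 : C' * `|s| ^+ m.+2 <= C' * `|s|.
    by rewrite ler_wpM2l// exprS ler_piMr// exprn_ile1.
  by rewrite mulrDl [leRHS]addrC lerD// (le_trans v).
- move=> _ i; apply: (le_trans (dbound t s i tI tsI sr)).
  by rewrite ler_wpM2r// lerDl.
Qed.

End PicardPolynomials.

Lemma affine_field_sub (R : comPzRingType) d (J J' : 'M[R]_d)
    (u u' p p' b b' e e' : 'cV[R]_d) (s : R) :
  u - J *m p - s *: b - e - (u' - J' *m p' - s *: b' - e')
  = (u - u') - ((J - J') *m p + J' *m (p - p')) - s *: (b - b') - (e - e').
Proof.
have -> : (J - J') *m p + J' *m (p - p') = J *m p - J' *m p'.
  by rewrite mulmxBl mulmxBr addrA subrK.
move: (J *m p) (J' *m p') => v v'.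
by apply/colP => i; rewrite !mxE; ring.
Qed.

(** * Bounds on the auxiliary right-hand side *)

Section AuxiliaryField.
Context {R : realType} {d : nat}.
Variables (t0 T : R) (D : set 'cV[R]_d) (f : R -> 'cV[R]_d -> 'cV[R]_d).
Variables (N : nat) (x : R -> 'cV[R]_d) (rho B : R).
Hypothesis hf : classC N `[t0, T] D f.
Hypothesis N1 : (1 < N)%N.
Hypothesis rho0 : 0 < rho.
Hypothesis B0 : 0 <= B.
Hypothesis tubeP : forall t s y, t0 <= t <= T -> t0 <= s <= T ->
  `|s - t| <= rho -> `|y - x t| <= rho -> D y /\
  forall w, (size w <= N)%N -> `|foldr (pderive `[t0, T]) f w s y| <= B.

Local Notation I := `[t0, T]%classic.

Lemma jacobian_bound t y : t0 <= t <= T -> `|y - x t| <= rho ->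
  `|jacobian_x f t y| <= B.
Proof.
move=> tI yx; apply: mx_norm_le => // i j; rewrite mxE.
have tt : `|t - t| <= rho by rewrite subrr normr0 ltW.
have [_ /(_ [:: Some j])] := tubeP tI tI tt yx.
by move=> /(_ (ltnW N1)); apply: le_trans; exact: coord_norm_le.
Qed.

Lemma pderive_t_bound t y : t0 <= t <= T -> `|y - x t| <= rho ->
  `|pderive I None f t y| <= B.
Proof.
move=> tI yx.
have tt : `|t - t| <= rho by rewrite subrr normr0 ltW.
have [_ /(_ [:: None])] := tubeP tI tI tt yx.
by apply; exact: ltnW.
Qed.

(** The last two bounds come from second partial derivatives, hence [1 < N]. *)
Lemma tube_y_lipschitz : exists L : R, 0 <= L /\
  forall t y y', t0 <= t <= T -> `|y - x t| <= rho -> `|y' - x t| <= rho ->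
  [/\ (forall s, t0 <= s <= T -> `|s - t| <= rho ->
         `|f s y - f s y'| <= L * `|y - y'|),
      `|jacobian_x f t y - jacobian_x f t y'| <= L * `|y - y'| &
      `|pderive I None f t y - pderive I None f t y'| <= L * `|y - y'|].
Proof.
have [L [L0 hL]] := tube_lipschitz hf rho0 tubeP.
exists L; split=> // t y y' tI yx y'x.
have tt : `|t - t| <= rho by rewrite subrr normr0 ltW.
have red w s : (size w < N)%N -> t0 <= s <= T -> `|s - t| <= rho ->
    `|foldr (pderive I) f w s y - foldr (pderive I) f w s y'| <= L * `|y - y'|.
  move=> wN sI st; have := hL w wN t s s y y' tI sI sI st st yx y'x.
  by rewrite subrr normr0 add0r.
split=> [s sI st||].
- by apply: (red [::]) => //; exact: ltnW.
- apply: mx_norm_le => [|i j]; first by rewrite mulr_ge0.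
  have := red [:: Some j] t N1 tI tt; apply: le_trans.
  rewrite [X in `|X|](_ : _ = (foldr (pderive I) f [:: Some j] t y -
    foldr (pderive I) f [:: Some j] t y') i 0); first exact: coord_norm_le.
  by rewrite !mxE.
- exact: (red [:: None]).
Qed.

Variables (ph : R -> 'cV[R]_d -> R -> 'cV[R]_d) (r1 Cp : R).
Hypothesis r10 : 0 < r1.
Hypothesis Cp0 : 0 <= Cp.
Hypothesis ph_lip : forall t s y y', t0 <= t <= T -> `|s| <= r1 ->
  `|y - x t| <= rho -> `|y' - x t| <= rho ->
  `|ph t y s - ph t y' s| <= Cp * `|s| * `|y - y'|.
Hypothesis ph_bound : forall t s y, t0 <= t <= T -> `|s| <= r1 ->
  `|y - x t| <= rho -> `|ph t y s| <= Cp * `|s|.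

Lemma aux_rhsE t y s xi : aux_rhs I f ph t y (t + s) xi =
  f (t + s) (y + ph t y s + xi) - jacobian_x f t y *m ph t y s
  - s *: pderive I None f t y - f t y.
Proof.
by have e : t + s - t = s by [rewrite addrAC subrr add0r]; rewrite /aux_rhs e.
Qed.

(** The base values use up half of the tube. The other half is for [ph t y s + xi], of norm at most
    [r0 (Cp + 1) <= rho / 2], so that [f] is evaluated within [rho] of [x t]. *)
Lemma aux_lipschitz : exists r0 M beta : R, [/\ 0 < r0, r0 <= 1, 0 <= M, 0 <= beta &
  forall t s y y' xi xi', t0 <= t <= T -> t0 <= t + s <= T ->
    `|y - x t| <= rho / 2 -> `|y' - x t| <= rho / 2 ->
    `|s| <= r0 -> `|xi| <= r0 -> `|xi'| <= r0 ->
    `|aux_rhs I f ph t y (t + s) xi| <= M /\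
    `|aux_rhs I f ph t y (t + s) xi - aux_rhs I f ph t y' (t + s) xi'|
      <= beta * (`|y - y'| + `|xi - xi'|)].
Proof.
have [L [L0 hL]] := tube_y_lipschitz.
pose r0 := Num.min (Num.min r1 1) (Num.min rho (rho / 2 / (Cp + 1))).
have C1 : 0 < Cp + 1 by rewrite ltr_wpDl.
have r00 : 0 < r0 by rewrite !lt_min r10 ltr01 rho0 !divr_gt0.
exists r0, (B + d%:R * B * Cp + B + B),
  (L * (1 + Cp) + L + d%:R * (L * Cp + B * Cp) + L + L).
have d0 : 0 <= d%:R :> R by [].
split=> //; rewrite ?addr_ge0 ?mulr_ge0 ?addr_ge0 ?mulr_ge0//.
  by rewrite /r0 !ge_min lexx orbT.
move=> t s y y' xi xi' tI tsI yx y'x sr0 xir xir'.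
have := sr0; rewrite {1}/r0 !le_min => /andP[/andP[sr s1] /andP[srho sC]].
have s0 : 0 <= `|s| by [].
have half : rho / 2 <= rho by move: rho0 => ?; lra.
have yr := le_trans yx half; have y'r := le_trans y'x half.
have rC : r0 * (Cp + 1) <= rho / 2 by rewrite -ler_pdivlMr// /r0 !ge_min lexx !orbT.
have st : `|t + s - t| <= rho by rewrite addrAC subrr add0r.
have inbox z eta : `|z - x t| <= rho / 2 -> `|eta| <= r0 ->
    `|z + ph t z s + eta - x t| <= rho.
  move=> zx er; have hp := ph_bound tI sr (le_trans zx half).
  have -> : z + ph t z s + eta - x t = (z - x t) + (ph t z s + eta).
    by rewrite -!addrA; congr (_ + _); rewrite addrA addrC.
  rewrite (le_trans (ler_normD _ _))// (splitr rho) lerD//.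
  rewrite (le_trans (ler_normD _ _))// (le_trans _ rC)// mulrDr mulr1 lerD//.
  by rewrite (le_trans hp)// mulrC ler_wpM2r.
have bx := inbox y xi yx xir; have bx' := inbox y' xi' y'x xir'.
have tt : `|t - t| <= rho by rewrite subrr normr0 ltW.
have hp := ph_bound tI sr yr; have hp' := ph_bound tI sr y'r.
have pC : `|ph t y s| <= Cp by rewrite (le_trans hp)// ler_piMr.
have hpp := ph_lip tI sr yr y'r.
have dy0 : 0 <= `|y - y'| by [].
have dx0 : 0 <= `|xi - xi'| by [].
have ppC : `|ph t y s - ph t y' s| <= Cp * `|y - y'|.
  by rewrite (le_trans hpp)// ler_wpM2r// ler_piMr.
have [hf1 _ _] := hL t _ _ tI bx bx'.
have [hf2 hj hb] := hL t _ _ tI yr y'r.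
have l1 := hf1 (t + s) tsI st.
have l2 : `|(y + ph t y s + xi) - (y' + ph t y' s + xi')|
    <= (1 + Cp) * `|y - y'| + `|xi - xi'|.
  have -> : (y + ph t y s + xi) - (y' + ph t y' s + xi') =
      (y - y') + (ph t y s - ph t y' s) + (xi - xi').
    by apply/colP => i; rewrite !mxE; ring.
  rewrite (le_trans (ler_normD _ _))// lerD// (le_trans (ler_normD _ _))//.
  by rewrite mulrDl mul1r lerD.
split.
- rewrite aux_rhsE.
  have b1 := tube_f_bound tubeP tI tsI st bx.
  have b2 := mulmx_norm_le2 (jacobian_bound tI yr) pC.
  have b3 : `|s *: pderive I None f t y| <= B.
    by rewrite normrZ (le_trans _ (pderive_t_bound tI yr))// ler_piMl.
  have b4 := tube_f_bound tubeP tI tI tt yr.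
  by rewrite (le_trans (ler_normB _ _))// lerD// (le_trans (ler_normB _ _))// lerD//
    (le_trans (ler_normB _ _))// lerD.
rewrite !aux_rhsE.
set f1 := f (t + s) _ in l1 *; set f1' := f (t + s) _ in l1 *.
set J := jacobian_x f t y in hj *; set J' := jacobian_x f t y' in hj *.
set b := pderive I None f t y in hb *; set b' := pderive I None f t y' in hb *.
have -> : f1 - J *m ph t y s - s *: b - f t y - (f1' - J' *m ph t y' s - s *: b' - f t y')
  = (f1 - f1') - ((J - J') *m ph t y s + J' *m (ph t y s - ph t y' s))
    - s *: (b - b') - (f t y - f t y').
  exact: affine_field_sub.
have m1 := mulmx_norm_le2 hj pC.
have m2 := mulmx_norm_le2 (jacobian_bound tI y'r) ppC.
have m3 : `|s *: (b - b')| <= L * `|y - y'|.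
  by rewrite normrZ (le_trans _ hb)// ler_piMl.
have m4 := hf2 t tI tt.
have l3 := le_trans l1 (ler_wpM2l L0 l2).
rewrite (le_trans (ler_normB _ _))//.
rewrite (le_trans (lerD (le_trans (ler_normB _ _) (lerD (le_trans (ler_normB _ _)
  (lerD l3 (le_trans (ler_normD _ _) (lerD m1 m2)))) m3)) m4))//.
have p1 : 0 <= d%:R * (L * Cp + B * Cp) * `|xi - xi'|.
  by rewrite !mulr_ge0// addr_ge0 ?mulr_ge0.
have p2 : 0 <= L * Cp * `|xi - xi'| by rewrite !mulr_ge0.
have p3 : 0 <= L * `|xi - xi'| by rewrite !mulr_ge0.
have p4 : 0 <= L * `|y - y'| by rewrite !mulr_ge0.
by lra.
Qed.

End AuxiliaryField.

(** * Taylor polynomials of the linearized flow *)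

Section LocalLinearizationTaylor.
Context {R : realType} {d : nat}.
Implicit Types (A : 'M[R]_d) (b v : 'cV[R]_d).

(* Taylor coefficients, up to factorials, of the solution of
   phi' = A phi + s b + v, phi(0) = 0. *)
Fixpoint llphi A b v (j : nat) : 'cV[R]_d :=
  if j is j'.+1 then A *m llphi A b v j' + (j' == 0%N)%:R *: v + (j' == 1%N)%:R *: b
  else 0.

Definition lltaylor (k : nat) A b v (s : R) : 'cV[R]_d :=
  \sum_(j < k.+1) (s ^+ j / j`!%:R) *: llphi A b v j.

Lemma llphi_bound (C : R) j : 0 <= C -> exists K : R, 0 <= K /\
  forall A b v, `|A| <= C -> `|b| <= C -> `|v| <= C -> `|llphi A b v j| <= K.
Proof.
move=> C0; elim: j => [|j [K [K0 IH]]].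
  by exists 0; split=> // A b v _ _ _; rewrite normr0.
exists (d%:R * C * K + C + C); split; first by rewrite !addr_ge0// !mulr_ge0.
move=> A b v hA hb hv /=.
rewrite (le_trans (ler_normD _ _))// lerD//.
  rewrite (le_trans (ler_normD _ _))// lerD//.
    exact: mulmx_norm_le2 hA (IH _ _ _ hA hb hv).
  by rewrite normrZ normr_nat (le_trans _ hv)//; case: eqP; rewrite ?mul1r ?mul0r.
by rewrite normrZ normr_nat (le_trans _ hb)//; case: eqP; rewrite ?mul1r ?mul0r.
Qed.

Definition lltaylor_poly k A b v (i : 'I_d) : {poly R} :=
  \sum_(j < k.+1) (llphi A b v j i 0 / j`!%:R) *: 'X^j.

Lemma lltaylor_polyE k A b v s i : (lltaylor_poly k A b v i).[s] = lltaylor k A b v s i 0.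
Proof.
rewrite /lltaylor summxE horner_sum; apply: eq_bigr => j _.
by rewrite mxE hornerZ hornerXn; ring.
Qed.

Lemma lltaylor0 k A b v : lltaylor k A b v 0 = 0.
Proof.
rewrite /lltaylor big1// => -[[|j] hj] _ /=; first by rewrite scaler0.
by rewrite expr0n mul0r scale0r.
Qed.

(** The truncated series satisfies [phi' = A phi + s b + v] except for the one term beyond the cut.
    For [k = 0] the term [s b] would also be left over. *)
Lemma lltaylor_deriv k A b v s i : (0 < k)%N ->
  (A *m lltaylor k A b v s + v + s *: b) i 0 - (lltaylor_poly k A b v i)^`().[s]
  = s ^+ k / k`!%:R * llphi A b v k.+1 i 0.
Proof.
case: k => // k _.
have -> : (lltaylor_poly k.+1 A b v i)^`().[s] =
    \sum_(j < k.+1) s ^+ j / j`!%:R * llphi A b v j.+1 i 0.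
  rewrite /lltaylor_poly raddf_sum horner_sum big_ord_recl /= derivZ derivXn.
  rewrite mulr0n hornerZ hornerC mulr0 add0r; apply: eq_bigr => j _.
  rewrite derivZ derivXn hornerZ hornerMn hornerXn /bump /= add1n add0n.
  move: (_ i 0) => c.
  have h1 : j`!%:R != 0 :> R by rewrite pnatr_eq0 -lt0n fact_gt0.
  have h2 : (j.+1)%:R != 0 :> R by rewrite pnatr_eq0.
  by rewrite factS natrM; field; rewrite h1 nat1r h2.
have -> : A *m lltaylor k.+1 A b v s + v + s *: b =
    \sum_(j < k.+2) (s ^+ j / j`!%:R) *: llphi A b v j.+1.
  transitivity (\sum_(j < k.+2) ((s ^+ j / j`!%:R) *: (A *m llphi A b v j)
      + (s ^+ j / j`!%:R) *: ((j == 0 :> nat)%:R *: v)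
      + (s ^+ j / j`!%:R) *: ((j == 1 :> nat)%:R *: b))); last first.
    by apply: eq_bigr => j _ /=; rewrite !scalerDr.
  rewrite !big_split /=; congr (_ + _ + _).
  - rewrite /lltaylor mulmx_sumr; apply: eq_bigr => j _.
    by rewrite -scalemxAr.
  - rewrite big_ord_recl /= expr0 fact0 divr1 !scale1r big1 ?addr0// => j _.
    by rewrite scale0r scaler0.
  - rewrite big_ord_recl big_ord_recl /= scale0r scaler0 add0r expr1 factS fact0 muln1 divr1.
    by rewrite scale1r big1 ?addr0// => j _; rewrite scaler0.
rewrite summxE big_ord_recr /= mxE addrAC.
rewrite (_ : \sum_(j < k.+1) _ = \sum_(j < k.+1) s ^+ j / j`!%:R * llphi A b v j.+1 i 0).
  by rewrite subrr add0r.
by apply: eq_bigr => j _; rewrite mxE.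
Qed.

End LocalLinearizationTaylor.

Section LocalError.
Context {R : realType} {d : nat}.
Variables (t0 T : R) (D : set 'cV[R]_d) (f : R -> 'cV[R]_d -> 'cV[R]_d).
Variables (N : nat) (x : R -> 'cV[R]_d) (rho B : R).
Hypothesis hf : classC N `[t0, T] D f.
Hypothesis N1 : (1 < N)%N.
Hypothesis rho0 : 0 < rho.
Hypothesis B0 : 0 <= B.
Hypothesis tubeP : forall t s y, t0 <= t <= T -> t0 <= s <= T ->
  `|s - t| <= rho -> `|y - x t| <= rho -> D y /\
  forall w, (size w <= N)%N -> `|foldr (pderive `[t0, T]) f w s y| <= B.

Local Notation I := `[t0, T]%classic.

Hypothesis hx : forall t, t0 <= t <= T -> has_derive_within I x t (f t (x t)).

Variables (ph : R -> 'cV[R]_d -> R -> 'cV[R]_d) (r1 Cp : R) (k n : nat).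
Hypothesis r10 : 0 < r1.
Hypothesis Cp0 : 0 <= Cp.
Hypothesis ph_lip : forall t s y y', t0 <= t <= T -> `|s| <= r1 ->
  `|y - x t| <= rho -> `|y' - x t| <= rho ->
  `|ph t y s - ph t y' s| <= Cp * `|s| * `|y - y'|.
Hypothesis ph_bound : forall t s y, t0 <= t <= T -> `|s| <= r1 ->
  `|y - x t| <= rho -> `|ph t y s| <= Cp * `|s|.
Hypothesis ph_taylor : forall t s, t0 <= t <= T -> `|s| <= r1 ->
  `|ph t (x t) s - lltaylor k (jacobian_x f t (x t)) (pderive I None f t (x t))
      (f t (x t)) s| <= Cp * `|s| ^+ k.+1.
Variable rk : explicit_rk R.
Hypothesis hrk : rk_order rk n.
Hypothesis k0 : (0 < k)%N.
Hypothesis kN : (k <= N)%N.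
Hypothesis kn : (k <= n)%N.

Let S := [set t | t0 <= t <= T].
Let A t := jacobian_x f t (x t).
Let b t := pderive I None f t (x t).
Let v t := f t (x t).
Let Phi t s := lltaylor k (A t) (b t) (v t) s.
Let tt t : `|x t - x t| <= rho. Proof. by rewrite subrr normr0 ltW. Qed.
Let ss (t : R) : `|t - t| <= rho. Proof. by rewrite subrr normr0 ltW. Qed.

Let llphi_tube j : exists K : R, 0 <= K /\ forall t, S t -> `|llphi (A t) (b t) (v t) j| <= K.
Proof.
have [K [K0 hK]] := @llphi_bound R d B j B0; exists K; split=> // t tI.
apply: hK; first exact: (jacobian_bound N1 rho0 B0 tubeP tI (tt t)).
  exact: (pderive_t_bound N1 rho0 tubeP tI (tt t)).
exact: (tube_f_bound tubeP tI tI (ss t) (tt t)).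
Qed.

Let Phi_upoly i : upoly S (fun t h => (lltaylor_poly k (A t) (b t) (v t) i).[h]).
Proof.
have hj (j : 'I_k.+1) : upoly S (fun t h =>
    llphi (A t) (b t) (v t) j i 0 / j`!%:R * h ^+ j).
  apply: upolyM.
    have [K [K0 hK]] := llphi_tube j.
    apply: (upoly_cst (C := K)) => // t /hK h.
    rewrite normrM normfV normr_nat (le_trans _ (le_trans (coord_norm_le _ i 0) h))//.
    by rewrite ler_piMr// invf_le1 ?ler1n ?fact_gt0// ltr0n fact_gt0.
  elim: (j : nat) => [|m IH].
    by apply: upoly_ext (upoly_cst (c := fun=> 1) (normr_ge0 1) _) _ => // t h _;
      rewrite expr0.
  by apply: upoly_ext (upolyM (upoly_id S) IH) _ => t h _; rewrite exprS.
apply: upoly_ext (upoly_sum hj) _ => t h _.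
by rewrite horner_sum; apply: eq_bigr => j _; rewrite hornerZ hornerXn.
Qed.

Section Field.
Variables (W : R -> 'I_d -> seq (R * seq (option 'I_d))) (CW L : R).
Hypothesis CW0 : 0 <= CW.
Hypothesis L0 : 0 <= L.
Hypothesis hW : forall t, t0 <= t <= T -> forall i : 'I_d,
  [/\ pweight (W t i) <= CW, all (fun c => size c.2 <= k)%N (W t i) &
    forall s v r, t0 <= t + s <= T -> `|s| <= r -> `|v| <= r -> r <= rho ->
      `|f (t + s) (x t + v) i 0 - peval (W t i) (coords s v)| <= CW * r ^+ k].
Hypothesis hL : forall t s y y', t0 <= t <= T -> t0 <= s <= T ->
  `|s - t| <= rho -> `|y - x t| <= rho -> `|y' - x t| <= rho ->
  `|f s y - f s y'| <= L * `|y - y'|.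

Let X t s := picard_col W k t s.
Let Vp t i := picard W k t i - lltaylor_poly k (A t) (b t) (v t) i.

(* A polynomial field with exact solution X - Phi which agrees, up to O(r^k),
   with the right-hand side of the auxiliary equation. *)
Let G t s (xi : 'cV[R]_d) : 'cV[R]_d := \col_i
  (peval (W t i) (coords s (Phi t s + xi)) - peval (W t i) (coords s (X t s))
   + (Vp t i)^`().[s]).

Let G_polyfun t i : polyfun (fun s xi => G t s xi i 0).
Proof.
have c1 : forall a : option 'I_d, polyfun (fun s xi => coords s (Phi t s + xi) a).
  case=> [j|] /=; last exact: polyfun_time.
  apply: polyfun_ext (polyfun_add (polyfun_horner
    (lltaylor_poly k (A t) (b t) (v t) j) (polyfun_time)) (polyfun_coord j)) _ => s xi.
  by rewrite mxE lltaylor_polyE.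
have c2 : forall a : option 'I_d, polyfun (fun s (xi : 'cV[R]_d) => coords s (X t s) a).
  case=> [j|] /=; last exact: polyfun_time.
  apply: polyfun_ext (polyfun_horner (picard W k t j) (polyfun_time)) _ => s xi.
  by rewrite mxE.
apply: polyfun_ext (polyfun_add (polyfun_add (polyfun_peval (W t i) c1)
  (polyfun_opp (polyfun_peval (W t i) c2))) (polyfun_horner (Vp t i)^`() polyfun_time)) _.
by move=> s xi; rewrite mxE.
Qed.

Let Vp_upoly i : upoly S (fun t h => (Vp t i).[h]).
Proof.
apply: upoly_ext (upolyD (picard_upoly CW0 hW k i) (upolyN (Phi_upoly i))) _ => t h _.
by rewrite hornerD hornerN.
Qed.

Let G_upoly (c : R) (xi : R -> R -> 'cV[R]_d) :
  (forall i, upoly S (fun t h => xi t h i 0)) ->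
  forall i, upoly S (fun t h => G t (c * h) (xi t h) i 0).
Proof.
move=> hxi i.
have hc : upoly S (fun _ h => c * h) by exact: (upoly_scale c (upoly_id S)).
have c1 (a : option 'I_d) : upoly S (fun t h => coords (c * h) (Phi t (c * h) + xi t h) a).
  case: a => [j|] //=.
  apply: upoly_ext (upolyD (upoly_scale c (Phi_upoly j)) (hxi j)) _ => t h _.
  by rewrite mxE lltaylor_polyE.
have c2 (a : option 'I_d) : upoly S (fun t h => coords (c * h) (X t (c * h)) a).
  case: a => [j|] //=.
  apply: upoly_ext (upoly_scale c (picard_upoly CW0 hW k j)) _ => t h _.
  by rewrite mxE.
apply: upoly_ext (upolyD (upolyD (upoly_taylor CW0 hW i c1)
  (upolyN (upoly_taylor CW0 hW i c2))) (upoly_scale c (upoly_deriv (Vp_upoly i)))) _.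
by move=> t h _; rewrite mxE.
Qed.

Let V_solution : exists C : R, 0 <= C /\ forall t, S t -> forall h, 0 <= h <= 1 ->
  `|\col_i (Vp t i).[h] - rk_increment rk (G t) 0 0 h| <= C * h ^+ n.+1.
Proof.
apply: (rk_order_uniform G_upoly hrk) => [t _ i|i|t _ i|t _ s i].
- exact: G_polyfun.
- exact: Vp_upoly.
- by rewrite hornerD hornerN picard_at0 lltaylor_polyE lltaylor0 mxE subrr.
- rewrite mxE (_ : Phi t s + _ = X t s) ?subrr ?add0r//.
  apply/colP => j; rewrite !mxE hornerD hornerN lltaylor_polyE.
  by rewrite addrC subrK.
Qed.

(** Up to [O(r^k)], the value [W(s, X)], the field [f] along the solution and [X'] agree, while
    [Phi'] agrees with [A Phi + s b + v]. Hence [G] reduces to [f] at [Phi + xi] minus the linear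
    part, that is to the auxiliary right-hand side. *)
Let field_error : exists r0 C : R, [/\ 0 < r0, r0 <= 1, 0 <= C &
  forall t s xi r, t0 <= t <= T -> t0 <= t + s <= T -> `|s| <= r -> `|xi| <= r ->
    r <= r0 -> `|aux_rhs I f ph t (x t) (t + s) xi - G t s xi| <= C * r ^+ k].
Proof.
have [rP [CP [rP0 CP0 hP]]] := picard_error rho0 B0 tubeP hx CW0 L0 hW hL (leqnn k).
have [K [K0 hK]] := llphi_tube k.+1.
(* [E r] bounds [Phi + xi], [X], [ph + xi] and the displacement of the exact solution, so all of
   them lie in the tube as soon as [E r <= rho]. *)
pose E := 2 * Cp + CP + B + 1.
have E1 : 1 <= E by rewrite lerDr !addr_ge0// mulr_ge0.
have E0 : 0 < E := lt_le_trans ltr01 E1.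
have d0 : 0 <= d%:R :> R by [].
pose r0 := Num.min (Num.min r1 1) (Num.min rP (rho / E)).
have r00 : 0 < r0 by rewrite !lt_min r10 ltr01 rP0 divr_gt0.
pose C := CW * E ^+ k + L * Cp + (CW * E ^+ k + L * CP + CP) + (K + d%:R * B * Cp).
have Ek0 : 0 <= E ^+ k by rewrite exprn_ge0// ltW.
exists r0, C; split=> //.
- by rewrite /r0 !ge_min lexx orbT.
- by rewrite !addr_ge0 ?mulr_ge0.
move=> t s xi r tI tsI sr xir rr0.
have := rr0; rewrite {1}/r0 !le_min ler_pdivlMr//.
move=> /andP[/andP[rr1 r_1] /andP[rrP rE]].
have r_0 : 0 <= r by apply: le_trans sr.
have s1 := le_trans sr rr1.
have sE : `|s| <= E * r by rewrite (le_trans sr)// ler_peMl.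
have Er : E * r <= rho by rewrite mulrC.
have st : `|t + s - t| <= rho by rewrite addrAC subrr add0r (le_trans sE).
have rk0 : 0 <= r ^+ k by rewrite exprn_ge0.
have sk : `|s| ^+ k <= r ^+ k by rewrite lerXn2r.
have s_1 : `|s| <= 1 := le_trans sr r_1.
have sk1 : `|s| ^+ k.+1 <= r ^+ k by rewrite (le_trans _ sk)// exprS ler_piMl// exprn_ge0.
have [P1 P2 P3] := hP t s tI tsI (le_trans sr rrP).
have ph1 := ph_bound tI s1 (tt t); have ph2 := ph_taylor tI s1.
rewrite -/(A t) -/(b t) -/(v t) -/(Phi t s) in ph2.
have PhiE : `|Phi t s| <= 2 * Cp * r.
  have := ler_normB (ph t (x t) s) (ph t (x t) s - Phi t s).
  rewrite opprB addrC subrK => h; apply: (le_trans h).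
  have h1 : Cp * `|s| <= Cp * r by rewrite ler_wpM2l.
  have h2 : Cp * `|s| ^+ k.+1 <= Cp * r.
    by rewrite ler_wpM2l// (le_trans _ sr)// exprS ler_piMr// exprn_ile1.
  by have := lerD (le_trans ph1 h1) (le_trans ph2 h2); lra.
have le_E (c : R) : 0 <= c -> c <= E -> c * r <= E * r by move=> *; rewrite ler_wpM2r.
have PxE : `|Phi t s + xi| <= E * r.
  rewrite (le_trans (ler_normD _ _))//.
  apply: (@le_trans _ _ ((2 * Cp + 1) * r)); last by rewrite ler_wpM2r// /E; have := B0; lra.
  by rewrite mulrDl mul1r lerD.
have XE : `|X t s| <= E * r.
  rewrite (le_trans P2)// (@le_trans _ _ (CP * r))// ?ler_wpM2l// ler_wpM2r//.
  by rewrite /E; have := Cp0; have := B0; lra.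
have phxE : `|ph t (x t) s + xi| <= E * r.
  rewrite (le_trans (ler_normD _ _))//.
  apply: (@le_trans _ _ ((Cp + 1) * r)).
    by rewrite mulrDl mul1r lerD// (le_trans ph1)// ler_wpM2l.
  by rewrite ler_wpM2r// /E; have := Cp0; have := B0; lra.
have inT z : `|z| <= E * r -> `|x t + z - x t| <= rho.
  by move=> zE; rewrite addrAC subrr add0r (le_trans zE).
have xsT : `|x (t + s) - x t| <= rho.
  rewrite (le_trans (solution_lipschitz rho0 B0 tubeP hx tI tsI))//.
  rewrite (le_trans _ Er)// (@le_trans _ _ (B * r))// ?ler_wpM2l// ler_wpM2r//.
  by rewrite /E; have := Cp0; lra.
apply: cV_norm_le => [|i].
  by rewrite mulr_ge0// !addr_ge0 ?mulr_ge0.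
have [_ _ hWi] := hW tI i.
have Erk : CW * (E * r) ^+ k = CW * E ^+ k * r ^+ k by rewrite exprMn mulrA.
have q1 := le_trans (coord_norm_le _ i 0) (hL tI tsI st (inT _ phxE) (inT _ PxE)).
have q1' : L * `|x t + (ph t (x t) s + xi) - (x t + (Phi t s + xi))| <= L * (Cp * r ^+ k).
  rewrite ler_wpM2l// [x t + (ph _ _ _ + _)]addrC addrKA opprD addrACA subrr addr0.
  by rewrite (le_trans ph2)// ler_wpM2l.
have q2 := hWi s (Phi t s + xi) _ tsI sE PxE Er.
have q3 := hWi s (X t s) _ tsI sE XE Er.
have q4 := le_trans (coord_norm_le _ i 0) (hL tI tsI st (inT _ XE) xsT).
have q4' : L * `|x t + X t s - x (t + s)| <= L * (CP * r ^+ k).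
  rewrite ler_wpM2l// distrC opprD addrA (le_trans P1)// ler_wpM2l//.
have q5 := P3 k0 i.
have q5' : CP * `|s| ^+ k <= CP * r ^+ k by rewrite ler_wpM2l.
have q6 : `|(A t *m Phi t s + v t + s *: b t) i 0
    - (lltaylor_poly k (A t) (b t) (v t) i)^`().[s]| <= K * r ^+ k.
  rewrite lltaylor_deriv// normrM normrM normrX normfV normr_nat mulrC.
  rewrite ler_pM ?mulr_ge0 ?exprn_ge0 ?invr_ge0//.
    exact: le_trans (coord_norm_le _ _ _) (hK t tI).
  by rewrite (le_trans _ sk)// ler_piMr ?exprn_ge0// invf_le1 ?ler1n ?ltr0n fact_gt0.
have q7 : `|(A t *m (Phi t s - ph t (x t) s)) i 0| <= d%:R * B * Cp * r ^+ k.
  rewrite (le_trans (coord_norm_le _ _ _))// -[leRHS]mulrA.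
  apply: mulmx_norm_le2; first exact: (jacobian_bound N1 rho0 B0 tubeP tI (tt t)).
  by rewrite distrC (le_trans ph2)// ler_wpM2l.
(* The seven differences: [ph] against [Phi] inside [f]; [f] against [W] at [Phi + xi], then at [X];
   [X] against the exact solution inside [f]; [f] along the solution against [X']; the residual of
   [Phi] in its linear equation; [ph] against [Phi] in the Jacobian term. *)
have -> : (aux_rhs I f ph t (x t) (t + s) xi - G t s xi) i 0 =
   (f (t + s) (x t + (ph t (x t) s + xi)) - f (t + s) (x t + (Phi t s + xi))) i 0
   + (f (t + s) (x t + (Phi t s + xi)) i 0 - peval (W t i) (coords s (Phi t s + xi)))
   - (f (t + s) (x t + X t s) i 0 - peval (W t i) (coords s (X t s)))
   + (f (t + s) (x t + X t s) - f (t + s) (x (t + s))) i 0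
   + (f (t + s) (x (t + s)) i 0 - (picard W k t i)^`().[s])
   - ((A t *m Phi t s + v t + s *: b t) i 0
      - (lltaylor_poly k (A t) (b t) (v t) i)^`().[s])
   + (A t *m (Phi t s - ph t (x t) s)) i 0.
  have eG : G t s xi i 0 = peval (W t i) (coords s (Phi t s + xi))
      - peval (W t i) (coords s (X t s)) + ((picard W k t i)^`().[s]
      - (lltaylor_poly k (A t) (b t) (v t) i)^`().[s]).
    by rewrite mxE derivB hornerD hornerN.
  have sub (a c : 'cV[R]_d) : (a - c) i 0 = a i 0 - c i 0 by rewrite !mxE.
  rewrite sub eG aux_rhsE mulmxBr !addrA -/(A t) -/(b t) -/(v t).
  move: (A t *m Phi t s) (A t *m ph t (x t) s) (f (t + s) _) (f (t + s) _).
  move: (f (t + s) _) (f (t + s) _) (b t) (v t) => a1 a2 a3 a4 a5 a6 a7 a8.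
  by rewrite !mxE; ring.
rewrite Erk in q2 q3.
have tri (a1 a2 a3 a4 a5 a6 a7 : R) :
    `|a1 + a2 - a3 + a4 + a5 - a6 + a7| <= `|a1| + `|a2| + `|a3| + `|a4| + `|a5| + `|a6| + `|a7|.
  have h1 := ler_normD (a1 + a2 - a3 + a4 + a5 - a6) a7.
  have h2 := ler_normB (a1 + a2 - a3 + a4 + a5) a6.
  have h3 := ler_normD (a1 + a2 - a3 + a4) a5.
  have h4 := ler_normD (a1 + a2 - a3) a4.
  have h5 := ler_normB (a1 + a2) a3.
  by have h6 := ler_normD a1 a2; lra.
apply: (le_trans (tri _ _ _ _ _ _ _)).
move: (le_trans q1 q1') (le_trans q4 q4') (le_trans q5 q5') => q1'' q4'' q5''.
by rewrite /C; lra.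
Qed.

(** Four gaps of order [h^(k+1)]: the solution against [X], [X - Phi] against the increment for [G],
    [ph] against [Phi], and the increments of the two fields. In the last one [rk_compare] adds a
    factor [h] to the field error [O(h^k)]. *)
Lemma local_error_of_taylor : exists h0 C : R, [/\ 0 < h0, 0 <= C &
  forall t h, t0 <= t <= T -> t0 <= t + h <= T -> 0 <= h <= h0 ->
    (forall i, (i < rk_stages rk)%N -> t0 <= t + rk_c rk i * h <= T) ->
    `|x (t + h) - (x t + ph t (x t) h
        + rk_increment rk (aux_rhs I f ph t (x t)) t 0 h)| <= C * h ^+ k.+1].
Proof.
have [rf [Cf [rf0 rf1 Cf0 hF]]] := field_error.
have [ra [M0 [beta [ra0 ra1 M00 beta0 ha]]]] :=
  aux_lipschitz hf N1 rho0 B0 tubeP r10 Cp0 ph_lip ph_bound.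
have [CV [CV0 hV]] := V_solution.
have [rP [CP [rP0 CP0 hP]]] := picard_error rho0 B0 tubeP hx CW0 L0 hW hL (leqnn k).
pose M := M0 + Cf; have M0' : 0 <= M by rewrite addr_ge0.
have [CR [CR0 hR]] := @rk_compare R rk d M beta M0' beta0.
have A0 : 0 <= rk_asum rk by apply: sumr_ge0 => i _; exact: sumr_ge0.
pose cs := \sum_(i < rk_stages rk) `|rk_c rk i|.
have cs0 : 0 <= cs by exact: sumr_ge0.
(* [E h] bounds the times [c_i h] and the stage arguments, and thus is the radius at which the
   fields are compared. *)
pose E := cs + rk_asum rk * M + 1.
have E1 : 1 <= E by rewrite lerDr addr_ge0// mulr_ge0.
have E0 : 0 < E := lt_le_trans ltr01 E1.
pose h0 := Num.min (Num.min 1 r1) (Num.min rP (Num.min (rf / E) (ra / E))).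
exists h0, (CP + CV + Cp + CR * (Cf * E ^+ k)); split.
- by rewrite !lt_min ltr01 r10 rP0 !divr_gt0.
- by rewrite !addr_ge0// !mulr_ge0// exprn_ge0// ltW.
move=> t h tI thI /andP[hpos]; rewrite !le_min !ler_pdivlMr//.
move=> /andP[/andP[h1 hr1] /andP[hrP /andP[hrf hra]]] stages.
have h01 : 0 <= h <= 1 by rewrite hpos.
have nh : `|h| = h by rewrite ger0_norm.
have Er1 : E * h <= rf by rewrite mulrC.
have Er2 : E * h <= ra by rewrite mulrC.
have ci i : (i < rk_stages rk)%N -> `|rk_c rk i * h| <= E * h.
  move=> si; rewrite normrM nh ler_wpM2r// (@le_trans _ _ cs)//.
    by rewrite /cs (bigD1 (Ordinal si)) //= lerDl sumr_ge0.
  by rewrite /E -addrA lerDl addr_ge0// mulr_ge0.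
have xiE (xi : 'cV[R]_d) : `|xi| <= rk_asum rk * M * h -> `|xi| <= E * h.
  move=> hxi; rewrite (le_trans hxi)// ler_wpM2r// /E -addrA.
  by rewrite ler_wpDl// lerDl.
have xt2 : `|x t - x t| <= rho / 2.
  by rewrite subrr normr0 divr_ge0// ltW.
have cmp : `|rk_increment rk (aux_rhs I f ph t (x t)) t 0 h
    - rk_increment rk (G t) 0 0 h| <= CR * h * (Cf * (E * h) ^+ k).
  apply: hR => //; first by rewrite mulr_ge0// exprn_ge0// mulr_ge0// ltW.
  move=> i xi xi' si hxi hxi'; rewrite add0r.
  have [bnd lip] := ha t (rk_c rk i * h) (x t) (x t) xi xi' tI (stages i si) xt2 xt2
    (le_trans (ci i si) Er2) (le_trans (xiE _ hxi) Er2) (le_trans (xiE _ hxi') Er2).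
  have [bnd' _] := ha t (rk_c rk i * h) (x t) (x t) xi' xi tI (stages i si) xt2 xt2
    (le_trans (ci i si) Er2) (le_trans (xiE _ hxi') Er2) (le_trans (xiE _ hxi) Er2).
  have fe := hF t (rk_c rk i * h) xi' _ tI (stages i si) (ci i si) (xiE _ hxi') Er1.
  have Erk1 : Cf * (E * h) ^+ k <= Cf.
    rewrite ler_piMr// exprn_ile1 ?mulr_ge0 ?(ltW E0)//.
    exact: le_trans Er1 rf1.
  split.
  - by rewrite (le_trans bnd)// /M lerDl.
  - have := ler_normB (aux_rhs I f ph t (x t) (t + rk_c rk i * h) xi')
      (aux_rhs I f ph t (x t) (t + rk_c rk i * h) xi' - G t (rk_c rk i * h) xi').
    rewrite opprB addrC subrK => hh; apply: (le_trans hh).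
    by rewrite /M lerD// (le_trans fe).
  - rewrite -(subrKA (aux_rhs I f ph t (x t) (t + rk_c rk i * h) xi')).
    rewrite (le_trans (ler_normD _ _))// addrC lerD// (le_trans lip)//.
    by rewrite subrr normr0 add0r.
have := hV t tI h h01.
have -> : \col_i (Vp t i).[h] = X t h - Phi t h.
  by apply/colP => j; rewrite !mxE hornerD hornerN lltaylor_polyE.
move=> e2.
have hnP : `|h| <= rP by rewrite nh.
have hn1 : `|h| <= r1 by rewrite nh.
have [e1 _ _] := hP t h tI thI hnP; have e3 := ph_taylor tI hn1.
rewrite nh in e1 e3; rewrite -/(A t) -/(b t) -/(v t) -/(Phi t h) in e3.
have -> : x (t + h) - (x t + ph t (x t) h
    + rk_increment rk (aux_rhs I f ph t (x t)) t 0 h) =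
  (x (t + h) - x t - X t h) + (X t h - Phi t h - rk_increment rk (G t) 0 0 h)
  - (ph t (x t) h - Phi t h)
  - (rk_increment rk (aux_rhs I f ph t (x t)) t 0 h - rk_increment rk (G t) 0 0 h).
  move: (rk_increment rk (G t) 0 0 h) (rk_increment _ _ _ _ _) (Phi t h) (X t h).
  move: (x (t + h)) (x t) (ph _ _ _) => a1 a2 a3 a4 a5 a6 a7.
  by apply/colP => j; rewrite !mxE; ring.
rewrite (le_trans (ler_normB _ _))//.
have e2' : CV * h ^+ n.+1 <= CV * h ^+ k.+1.
  by rewrite ler_wpM2l// ler_wiXn2l.
have := lerD (lerD (lerD e1 (le_trans e2 e2')) e3) cmp => tot.
rewrite (le_trans _ (le_trans tot _))//.
  rewrite lerD2r (le_trans (ler_normB _ _))// lerD2r.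
  exact: ler_normD.
rewrite exprMn (exprS h) !mulrDl le_eqVlt; apply/orP; left; apply/eqP.
by ring.
Qed.

End Field.

Lemma local_error : exists h0 C : R, [/\ 0 < h0, 0 <= C &
  forall t h, t0 <= t <= T -> t0 <= t + h <= T -> 0 <= h <= h0 ->
    (forall i, (i < rk_stages rk)%N -> t0 <= t + rk_c rk i * h <= T) ->
    `|x (t + h) - (x t + ph t (x t) h
        + rk_increment rk (aux_rhs I f ph t (x t)) t 0 h)| <= C * h ^+ k.+1].
Proof.
have [CW [CW0 hCW]] := tube_taylor hf rho0 tubeP kN.
have [L [L0 hL]] := tube_y_lipschitz hf N1 rho0 tubeP.
(* For base times outside [[t0, T]] the empty polynomial is taken. *)
have /choice[W hW] : forall ti : R * 'I_d, exists P, t0 <= ti.1 <= T ->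
  [/\ pweight P <= CW, all (fun c => size c.2 <= k)%N P &
    forall s v r, t0 <= ti.1 + s <= T -> `|s| <= r -> `|v| <= r -> r <= rho ->
      `|f (ti.1 + s) (x ti.1 + v) ti.2 0 - peval P (coords s v)| <= CW * r ^+ k].
  move=> [t i] /=; have [tI|/negP ntI] := boolP (t0 <= t <= T); last by exists [::].
  by have [P hP] := hCW t tI i; exists P.
apply: (@local_error_of_taylor (fun t i => W (t, i)) CW L) => //.
- by move=> t tI i; exact: hW (t, i) tI.
- move=> t s y y' tI sI st yx y'x; have [h _ _] := hL t y y' tI yx y'x.
  exact: h.
Qed.

End LocalError.

(** * Global error *)

Section Partition.
Context {R : realType}.
Variables (t0 T h : R) (N : nat) (t : nat -> R).
Hypothesis ht : is_partition t0 T h N t.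

Lemma partition_mono n m : (n <= m)%N -> (m <= N)%N -> t n <= t m.
Proof.
have [_ _ hs] := ht; elim: m => [|m IH]; first by rewrite leqn0 => /eqP ->.
rewrite leq_eqVlt => /orP[/eqP -> //|nm mN].
have /andP[h1 _] := hs m mN.
by rewrite (le_trans (IH nm (ltnW mN)))// -subr_ge0 ltW.
Qed.

Lemma partition_in n : (n <= N)%N -> t0 <= t n <= T.
Proof.
move=> nN; have [<- <- _] := ht.
by rewrite partition_mono//= partition_mono.
Qed.

End Partition.

Section GlobalError.
Context {R : realType} {d : nat}.
Variables (t0 T : R) (D : set 'cV[R]_d) (f : R -> 'cV[R]_d -> 'cV[R]_d).
Variables (N : nat) (x : R -> 'cV[R]_d) (rho B : R).
Hypothesis hf : classC N `[t0, T] D f.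
Hypothesis N1 : (1 < N)%N.
Hypothesis rho0 : 0 < rho.
Hypothesis B0 : 0 <= B.
Hypothesis tubeP : forall t s y, t0 <= t <= T -> t0 <= s <= T ->
  `|s - t| <= rho -> `|y - x t| <= rho -> D y /\
  forall w, (size w <= N)%N -> `|foldr (pderive `[t0, T]) f w s y| <= B.

Local Notation I := `[t0, T]%classic.

Variables (ph : R -> 'cV[R]_d -> R -> 'cV[R]_d) (r1 Cp : R) (k n : nat).
Hypothesis r10 : 0 < r1.
Hypothesis Cp0 : 0 <= Cp.
Hypothesis ph_lip : forall t s y y', t0 <= t <= T -> `|s| <= r1 ->
  `|y - x t| <= rho -> `|y' - x t| <= rho ->
  `|ph t y s - ph t y' s| <= Cp * `|s| * `|y - y'|.
Hypothesis ph_bound : forall t s y, t0 <= t <= T -> `|s| <= r1 ->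
  `|y - x t| <= rho -> `|ph t y s| <= Cp * `|s|.
Variable rk : explicit_rk R.

Let stages_in (t h : R) :=
  forall i, (i < rk_stages rk)%N -> t0 <= t + rk_c rk i * h <= T.

Definition rk_csum : R := \sum_(i < rk_stages rk) `|rk_c rk i|.

Lemma rk_csum_ge i : (i < rk_stages rk)%N -> `|rk_c rk i| <= rk_csum.
Proof. by move=> si; rewrite /rk_csum (bigD1 (Ordinal si)) //= lerDl sumr_ge0. Qed.

(** The auxiliary fields at [y] and [y'] differ by at most [beta (|y - y'| + |xi - xi'|)], so
    [rk_compare] applies with [alpha = beta |y - y'|], and its factor [h] gives the constant
    [1 + O(h)]. *)
Lemma one_step_stability : exists h0 C : R, [/\ 0 < h0, 0 <= C &
  forall t h y y', t0 <= t <= T -> 0 <= h <= h0 -> stages_in t h ->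
    `|y - x t| <= rho / 2 -> `|y' - x t| <= rho / 2 ->
    `|(y + ph t y h + rk_increment rk (aux_rhs I f ph t y) t 0 h)
      - (y' + ph t y' h + rk_increment rk (aux_rhs I f ph t y') t 0 h)|
    <= (1 + C * h) * `|y - y'|].
Proof.
have [ra [M [beta [ra0 ra1 M0 beta0 ha]]]] :=
  aux_lipschitz hf N1 rho0 B0 tubeP r10 Cp0 ph_lip ph_bound.
have [CR [CR0 hR]] := @rk_compare R rk d M beta M0 beta0.
have A0 : 0 <= rk_asum rk by apply: sumr_ge0 => i _; exact: sumr_ge0.
have cs0 : 0 <= rk_csum by exact: sumr_ge0.
pose E := rk_csum + rk_asum rk * M + 1.
have E0 : 0 < E by rewrite ltr_wpDl// addr_ge0// mulr_ge0.
exists (Num.min (Num.min 1 r1) (ra / E)), (Cp + CR * beta); split.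
- by rewrite !lt_min ltr01 r10 divr_gt0.
- by rewrite addr_ge0// mulr_ge0.
move=> t h y y' tI /andP[hpos]; rewrite !le_min ler_pdivlMr//.
move=> /andP[/andP[h1 hr1] hra] stages yx y'x.
have nh : `|h| = h by rewrite ger0_norm.
have Er : E * h <= ra by rewrite mulrC.
have ci i : (i < rk_stages rk)%N -> `|rk_c rk i * h| <= ra.
  move=> si; rewrite (le_trans _ Er)// normrM nh ler_wpM2r//.
  by rewrite (le_trans (rk_csum_ge si))// /E -addrA lerDl addr_ge0// mulr_ge0.
have xiE (xi : 'cV[R]_d) : `|xi| <= rk_asum rk * M * h -> `|xi| <= ra.
  move=> hxi; rewrite (le_trans hxi)// (le_trans _ Er)// ler_wpM2r// /E -addrA.
  by rewrite ler_wpDl// lerDl.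
have half : rho / 2 <= rho by have := rho0; lra.
have cmp : `|rk_increment rk (aux_rhs I f ph t y) t 0 h
    - rk_increment rk (aux_rhs I f ph t y') t 0 h| <= CR * h * (beta * `|y - y'|).
  apply: hR; rewrite ?hpos ?mulr_ge0// => i xi xi' si hxi hxi'.
  have [b1 l1] := ha t (rk_c rk i * h) y y' xi xi' tI (stages i si) yx y'x
    (ci i si) (xiE _ hxi) (xiE _ hxi').
  have [b2 _] := ha t (rk_c rk i * h) y' y xi' xi tI (stages i si) y'x yx
    (ci i si) (xiE _ hxi') (xiE _ hxi).
  by split=> //; rewrite -mulrDr.
have hn1 : `|h| <= r1 by rewrite nh.
have pl := ph_lip tI hn1 (le_trans yx half) (le_trans y'x half); rewrite nh in pl.
have -> : (y + ph t y h + rk_increment rk (aux_rhs I f ph t y) t 0 h)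
      - (y' + ph t y' h + rk_increment rk (aux_rhs I f ph t y') t 0 h) =
  (y - y') + (ph t y h - ph t y' h) + (rk_increment rk (aux_rhs I f ph t y) t 0 h
    - rk_increment rk (aux_rhs I f ph t y') t 0 h).
  move: (rk_increment _ _ _ _ _) (rk_increment _ _ _ _ _) (ph _ _ _) (ph _ _ _).
  by move=> a1 a2 a3 a4; apply/colP => j; rewrite !mxE; ring.
rewrite (le_trans (ler_normD _ _))//.
rewrite (le_trans (lerD (le_trans (ler_normD _ _) (lerD (lexx _) pl)) cmp))//.
by rewrite le_eqVlt; apply/orP; left; apply/eqP; ring.
Qed.

Hypothesis hx : forall t, t0 <= t <= T -> has_derive_within I x t (f t (x t)).
Hypothesis ph_taylor : forall t s, t0 <= t <= T -> `|s| <= r1 ->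
  `|ph t (x t) s - lltaylor k (jacobian_x f t (x t)) (pderive I None f t (x t))
      (f t (x t)) s| <= Cp * `|s| ^+ k.+1.
Hypothesis hrk : rk_order rk n.
Hypothesis k0 : (0 < k)%N.
Hypothesis kN : (k <= N)%N.
Hypothesis kn : (k <= n)%N.

Lemma global_error : exists h0 C : R, [/\ 0 < h0, 0 <= C &
  forall h, 0 < h < 1 -> h < h0 -> forall (m : nat) (t : nat -> R),
    is_partition t0 T h m t -> stage_times_in rk t0 T m t ->
  forall y, llrk_scheme rk I f ph (x t0) m t y ->
  forall j, (j <= m)%N -> `|x (t j) - y j| <= C * h ^+ k].
Proof.
have [h1 [C1 [h10 C10 stab]]] := one_step_stability.
have [h2 [C2 [h20 C20 loc]]] := local_error hf N1 rho0 B0 tubeP hx r10 Cp0 ph_lip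
  ph_bound ph_taylor hrk k0 kN kn.
pose K := C1 + C2; have K0 : 0 <= K by rewrite addr_ge0.
pose C := expR (K * (T - t0)); have C0 : 0 < C by rewrite expR_gt0.
(* The last bound yields [C h^k <= rho / 2], through [h^k <= h], so the numerical solution never
   leaves the region of the stability estimate. *)
exists (Num.min (Num.min h1 h2) (rho / 2 / C)), C; split.
- by rewrite !lt_min h10 h20 !divr_gt0.
- exact: ltW.
- move=> h /andP[hpos hlt1]; rewrite !lt_min ltr_pdivlMr//.
  move=> /andP[/andP[hh1 hh2] hrho] m t ht stages y [y0 yS] j jm.
  have hk0 : 0 <= h ^+ k by rewrite exprn_ge0// ltW.
  have hk1 : h ^+ k <= h by rewrite -(prednK k0) exprS ler_piMr ?exprn_ile1 ?ltW.
  pose E i := expR (K * (t i - t0)).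
  have EC i : (i <= m)%N -> E i <= C.
    move=> im; rewrite ler_expR ler_wpM2l// lerD2r.
    by have /andP[] := partition_in ht im.
  (* Solves the recursion [e_{i+1} <= (1 + K h_i) e_i + K h_i h^k] by means of [1 + z <= exp z];
     subtracting 1 from [E i] makes room for the local errors. *)
  have main i : (i <= m)%N -> `|x (t i) - y i| <= h ^+ k * (E i - 1).
    elim: i => [|i IH] im.
      have [t00 _ _] := ht.
      by rewrite y0 t00 /E t00 !subrr mulr0 expR0 subrr mulr0 normr0.
    have {}IH := IH (ltnW im).
    pose hi := t i.+1 - t i.
    have [_ _ /(_ i im)/andP[hi0 hih]] := ht; rewrite -/hi in hi0 hih.
    have tiI := partition_in ht (ltnW im); have tSI := partition_in ht im.
    have eS : t i + hi = t i.+1 by rewrite /hi addrC subrK.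
    have st : stages_in (t i) hi by move=> a sa; exact: stages.
    have Ei1 : 1 <= E i.
      by rewrite -expR0 ler_expR mulr_ge0// subr_ge0; case/andP: tiI.
    have EiC : E i - 1 <= C by rewrite (le_trans _ (EC i (ltnW im)))// gerBl.
    have close : `|y i - x (t i)| <= rho / 2.
      rewrite distrC (le_trans IH)// (le_trans _ (ltW hrho))//.
      by rewrite ler_pM// subr_ge0.
    have hi1 : 0 <= hi <= h1 by rewrite ltW//= (le_trans hih)// ltW.
    have hi2 : 0 <= hi <= h2 by rewrite ltW//= (le_trans hih)// ltW.
    have xx : `|x (t i) - x (t i)| <= rho / 2 by rewrite subrr normr0 divr_ge0// ltW.
    have e1 := stab (t i) hi (x (t i)) (y i) tiI hi1 st xx close.
    have e2 := loc (t i) hi tiI; rewrite eS in e2; have {}e2 := e2 tSI hi2 st.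
    have -> : y i.+1 = y i + ph (t i) (y i) hi
      + rk_increment rk (aux_rhs I f ph (t i) (y i)) (t i) 0 hi := yS i im.
    rewrite -(subrKA (x (t i) + ph (t i) (x (t i)) hi
      + rk_increment rk (aux_rhs I f ph (t i) (x (t i))) (t i) 0 hi)).
    rewrite (le_trans (ler_normD _ _))// (le_trans (lerD e2 e1))//.
    have e3 : C2 * hi ^+ k.+1 <= K * hi * h ^+ k.
      rewrite exprS mulrA ler_pM ?mulr_ge0 ?exprn_ge0 ?(ltW hi0)//.
        by rewrite ler_wpM2r ?(ltW hi0)// lerDr.
      by rewrite lerXn2r ?nnegrE ?(ltW hi0) ?(ltW hpos).
    have e4 : (1 + C1 * hi) * `|x (t i) - y i| <= (1 + K * hi) * (h ^+ k * (E i - 1)).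
      by rewrite ler_pM// ?addr_ge0 ?mulr_ge0 ?(ltW hi0)// lerD2l ler_wpM2r ?(ltW hi0)// lerDl.
    have e5 : (1 + K * hi) * E i <= E i.+1.
      have -> : E i.+1 = expR (K * hi) * E i.
        by rewrite /E -expRD; congr expR; rewrite /hi; ring.
      by rewrite ler_wpM2r ?expR_ge0// expR_ge1Dx.
    have e6 := ler_wpM2l hk0 e5.
    rewrite (le_trans (lerD e3 e4))//.
    by lra.
  by rewrite (le_trans (main j jm))// mulrC ler_wpM2r// (le_trans _ (EC j jm))// gerBl.
Qed.

End GlobalError.

(** * The case without linearized part *)

Section ZeroOrder.
Context {R : realType} {d : nat}.
Variables (t0 T : R) (D : set 'cV[R]_d) (f : R -> 'cV[R]_d -> 'cV[R]_d).
Variables (N : nat) (x0 : 'cV[R]_d) (rho B : R).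
Hypothesis hf : classC N `[t0, T] D f.
Hypothesis N1 : (1 < N)%N.
Hypothesis rho0 : 0 < rho.
Hypothesis B0 : 0 <= B.
Hypothesis tubeP : forall t s y, t0 <= t <= T -> t0 <= s <= T ->
  `|s - t| <= rho -> `|y - x0| <= rho -> D y /\
  forall w, (size w <= N)%N -> `|foldr (pderive `[t0, T]) f w s y| <= B.
Hypothesis t0T : t0 <= T.

Local Notation I := `[t0, T]%classic.

Lemma rk_increment0 (rk : explicit_rk R) t h :
  rk_increment rk (fun _ _ => 0 : 'cV[R]_d) t 0 h = 0.
Proof.
rewrite rk_incrementE big1 ?scaler0// => j _.
by rewrite rk_stageE scaler0.
Qed.

(* When p = q = 0 the linearized part of the scheme vanishes, the increments are
   O(h_n^2) and the numerical solution stays close to x0. *)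
Lemma zero_order_bound (rk : explicit_rk R) (ph : R -> 'cV[R]_d -> R -> 'cV[R]_d) :
  (forall t y s, ph t y s = 0) ->
  exists h0 : R, 0 < h0 /\
  forall h, 0 < h < 1 -> h < h0 -> forall (m : nat) (t : nat -> R),
    is_partition t0 T h m t -> stage_times_in rk t0 T m t ->
  forall y, llrk_scheme rk I f ph x0 m t y ->
  forall j, (j <= m)%N -> `|y j - x0| <= rho.
Proof.
move=> ph0; have [L [L0 hL]] := tube_lipschitz hf rho0 tubeP.
pose M := B + B + B; have M0 : 0 <= M by rewrite !addr_ge0.
have [CR [CR0 hR]] := @rk_compare R rk d M 0 M0 (lexx _).
have A0 : 0 <= rk_asum rk by apply: sumr_ge0 => i _; exact: sumr_ge0.
have cs0 : 0 <= rk_csum rk by exact: sumr_ge0.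
pose E := rk_csum rk + rk_asum rk * M + 1.
have E0 : 0 < E by rewrite ltr_wpDl// addr_ge0// mulr_ge0.
pose K := CR * ((2 * L + B) * E).
have K0 : 0 <= K by rewrite !mulr_ge0 ?addr_ge0 ?mulr_ge0// ltW.
have TT : 0 <= T - t0 by rewrite subr_ge0.
have KT : 0 < K * (T - t0) + 1 by rewrite ltr_wpDl// mulr_ge0.
have half : rho / 2 <= rho by have := rho0; lra.
have rho2 : 0 < rho / 2 by rewrite divr_gt0.
(* Three demands: [E h <= 1], stage displacements at most [rho / 2], and total displacement
   [K h (T - t0)] at most [rho / 2]. *)
exists (Num.min (Num.min E^-1 (rho / 2 / E)) (rho / 2 / (K * (T - t0) + 1))); split.
  by rewrite !lt_min invr_gt0 E0 !divr_gt0.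
move=> h /andP[hpos hlt1]; rewrite !lt_min => /andP[/andP[hE1 hE] hK].
have {}hE1 : h * E < 1 by rewrite -ltr_pdivlMr// mul1r.
move: hE hK; rewrite ltr_pdivlMr// => hE; rewrite ltr_pdivlMr// => hK.
move=> m t ht stages y [y0 yS] j jm.
have inc i : (i < m)%N -> `|y i - x0| <= rho / 2 ->
    `|rk_increment rk (aux_rhs I f ph (t i) (y i)) (t i) 0 (t i.+1 - t i)|
    <= K * h * (t i.+1 - t i).
  move=> im yi; set hi := t i.+1 - t i.
  have [_ _ /(_ i im)/andP[hi0 hih]] := ht; rewrite -/hi in hi0 hih.
  have tiI := partition_in ht (ltnW im).
  have Eh : E * hi <= rho / 2.
    by rewrite (le_trans _ (ltW hE))// mulrC ler_wpM2r// ltW.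
  have Eh2 : E * hi <= 1.
    by rewrite (le_trans _ (ltW hE1))// mulrC ler_wpM2r// ltW.
  have Eh1 : 0 <= E * hi by rewrite mulr_ge0 ?ltW.
  have yr : `|y i - x0| <= rho by exact: le_trans half.
  have ss : `|t i - t i| <= rho by rewrite subrr normr0 ltW.
  have alpha0 : 0 <= (2 * L + B) * (E * hi).
    by apply: mulr_ge0 => //; rewrite addr_ge0// mulr_ge0.
  have hi01 : 0 <= hi <= 1 by rewrite ltW//= (le_trans hih)// ltW.
  (* Comparison with the zero field, whose increment is 0: without [ph] the auxiliary right-hand
     side is a difference of values of [f] at nearby points minus a multiple of [s], hence
     [O(h_n)]. *)
  have := hR (aux_rhs I f ph (t i) (y i)) (fun _ _ => 0) (t i) 0 hi _ hi01 alpha0.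
  rewrite rk_increment0 subr0 => hh; apply: (le_trans (hh _)).
    move=> a xi xi' sa hxi hxi'.
    have tsI := stages i a im sa; rewrite -/hi in tsI.
    set s := rk_c rk a * hi in tsI *.
    have sE : `|s| <= E * hi.
      rewrite normrM (gtr0_norm hi0) ler_wpM2r ?(ltW hi0)//.
      by rewrite (le_trans (rk_csum_ge sa))// /E -addrA lerDl addr_ge0// mulr_ge0.
    have xiE : `|xi| <= E * hi.
      rewrite (le_trans hxi)// ler_wpM2r ?(ltW hi0)// /E -addrA.
      by rewrite ler_wpDl// lerDl.
    have s1 : `|s| <= rho by rewrite (le_trans sE)// (le_trans Eh).
    have st : `|t i + s - t i| <= rho by rewrite addrAC subrr add0r.
    have bx : `|y i + xi - x0| <= rho.
      rewrite addrAC (le_trans (ler_normD _ _))// (splitr rho) lerD//.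
      exact: le_trans Eh.
    have b1 := tube_f_bound tubeP tiI tsI st bx.
    have b2 := tube_f_bound tubeP tiI tiI ss yr.
    have b3 := pderive_t_bound N1 rho0 tubeP tiI yr.
    have l1 : `|f (t i + s) (y i + xi) - f (t i) (y i)| <= L * (2 * (E * hi)).
      have N0 : (size (Nil (option 'I_d)) < N)%N by exact: ltnW.
      have := hL [::] N0 (t i) (t i + s) (t i) (y i + xi) (y i) tiI tsI tiI st ss bx yr.
      move=> /le_trans; apply; rewrite ler_wpM2l// addrAC subrr add0r.
      by rewrite [y i + xi]addrC addrK mulr_natl mulr2n lerD.
    have aE : aux_rhs I f ph (t i) (y i) (t i + s) xi =
        f (t i + s) (y i + xi) - f (t i) (y i) - s *: pderive I None f (t i) (y i).
      by rewrite aux_rhsE ph0 addr0 mulmx0 subr0 addrAC.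
    have l2 : `|aux_rhs I f ph (t i) (y i) (t i + s) xi| <= (2 * L + B) * (E * hi).
      rewrite aE (le_trans (ler_normB _ _))// mulrDl [2 * L]mulrC -mulrA lerD//.
      by rewrite normrZ mulrC ler_pM.
    split; rewrite ?normr0 ?subr0 ?mul0r ?addr0//.
    rewrite aE (le_trans (ler_normB _ _))// lerD//.
      by rewrite (le_trans (ler_normB _ _))// lerD.
    by rewrite normrZ (le_trans _ b3)// ler_piMl// (le_trans sE).
  have -> : CR * hi * ((2 * L + B) * (E * hi)) = K * hi * hi by rewrite /K; ring.
  by rewrite ler_wpM2r ?(ltW hi0)// ler_wpM2l.
have main i : (i <= m)%N -> `|y i - x0| <= K * h * (t i - t0).
  elim: i => [|i IH] im.
    by have [t00 _ _] := ht; rewrite y0 t00 !subrr normr0 mulr0.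
  have {}IH := IH (ltnW im).
  have tiI := partition_in ht (ltnW im).
  have yi : `|y i - x0| <= rho / 2.
    rewrite (le_trans IH)// (le_trans _ (ltW hK))// [leRHS]mulrDr mulr1.
    rewrite ler_wpDr ?(ltW hpos)// [K * h]mulrC -mulrA ler_wpM2l ?(ltW hpos)//.
    by rewrite ler_wpM2l// lerD2r; case/andP: tiI.
  have -> : y i.+1 = y i + ph (t i) (y i) (t i.+1 - t i)
      + rk_increment rk (aux_rhs I f ph (t i) (y i)) (t i) 0 (t i.+1 - t i) := yS i im.
  rewrite ph0 addr0 addrAC (le_trans (ler_normD _ _))//.
  rewrite (le_trans (lerD IH (inc i im yi)))//.
  by rewrite le_eqVlt; apply/orP; left; apply/eqP; ring.
rewrite (le_trans (main j jm))// (le_trans _ half)// (le_trans _ (ltW hK))//.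
rewrite [leRHS]mulrDr mulr1 ler_wpDr ?(ltW hpos)// [K * h]mulrC -mulrA ler_wpM2l ?(ltW hpos)//.
by rewrite ler_wpM2l// lerD2r; case/andP: (partition_in ht jm).
Qed.

End ZeroOrder.

(** * Pade map and block matrices *)

Section PadeMap.
Context {R : realType}.

Lemma pade_exp_small p q m (nu : 'cV[R]_m -> R) : vector_norm nu ->
  exists e : R, 0 < e /\ forall A : 'M[R]_m, `|A| <= e ->
    pade_exp p q nu A = pade p q A.
Proof.
move=> hnu; have [e [e0 he]] := scaling_eq0 hnu.
exists e; split=> // A /he h; rewrite /pade_exp h expn0 expr1.
by rewrite expr0 invr1 scale1r.
Qed.

Lemma exprZmx m (s : R) (A : 'M[R]_m) j : (s *: A) ^+ j = s ^+ j *: A ^+ j.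
Proof.
elim: j => [|j IH]; first by rewrite !expr0 scale1r.
rewrite !exprS IH -[LHS]/((s *: A) *m (s ^+ j *: A ^+ j)).
by rewrite -scalemxAl -scalemxAr scalerA.
Qed.

(** For small [s] no scaling takes place and the estimates on [pade] transfer. The factor [|s|] in
    the first comes from [s A - s A']; in the second it comes from comparison with the zero matrix,
    where the value is [l 1 c = 0]. *)
Lemma pade_map_estimates p q m d (l : 'M[R]_(d, m)) (c : 'cV[R]_m)
    (nu : 'cV[R]_m -> R) (BD : R) (k : nat) : vector_norm nu -> l *m c = 0 ->
  0 <= BD -> (k <= p + q)%N ->
  exists r1 C : R, [/\ 0 < r1, 0 <= C &
    [/\ (forall A A' : 'M[R]_m, `|A| <= BD -> `|A'| <= BD -> forall s, `|s| <= r1 ->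
      `|l *m pade_exp p q nu (s *: A) *m c - l *m pade_exp p q nu (s *: A') *m c|
        <= C * `|s| * `|A - A'|),
    (forall A : 'M[R]_m, `|A| <= BD -> forall s, `|s| <= r1 ->
      `|l *m pade_exp p q nu (s *: A) *m c| <= C * `|s|) &
    (forall A : 'M[R]_m, `|A| <= BD -> forall s, `|s| <= r1 ->
      `|l *m pade_exp p q nu (s *: A) *m c
        - \sum_(j < k.+1) (s ^+ j / j`!%:R) *: (l *m (A ^+ j) *m c)|
        <= C * `|s| ^+ k.+1)]].
Proof.
move=> hnu lc0 BD0 kpq.
have [e1 [e10 he1]] := pade_exp_small p q hnu.
have [e2 [C2 [e20 _ C20 hC2]]] := @pade_lip R p q m.
have [e3 [C3 [e30 C30 hC3]]] := @pade_exp_error R p q m k kpq.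
pose e := Num.min e1 (Num.min e2 e3).
have e0 : 0 < e by rewrite !lt_min e10 e20.
have BD1 : 0 < BD + 1 by rewrite ltr_wpDl.
pose K := m%:R * (m%:R * `|l|) * `|c|.
have K0 : 0 <= K by rewrite !mulr_ge0.
have lXc (X : 'M[R]_m) : `|l *m X *m c| <= K * `|X|.
  have h1 := mulmx_norm_le2 (mulmx_norm_le2 (lexx `|l|) (lexx `|X|)) (lexx `|c|).
  by apply: (le_trans h1); rewrite le_eqVlt; apply/orP; left; apply/eqP; rewrite /K; ring.
have small (A : 'M[R]_m) s : `|A| <= BD -> `|s| <= e / (BD + 1) -> `|s *: A| <= e.
  move=> AB; rewrite ler_pdivlMr// => se; rewrite normrZ (le_trans _ se)//.
  by rewrite ler_wpM2l// (le_trans AB)// lerDl.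
exists (e / (BD + 1)), (K * C2 * (1 + BD) + K * C3 * BD ^+ k.+1); split.
- by rewrite divr_gt0.
- by rewrite addr_ge0 ?mulr_ge0 ?exprn_ge0// addr_ge0.
have c1 : K * C2 * (1 + BD) <= K * C2 * (1 + BD) + K * C3 * BD ^+ k.+1.
  by rewrite lerDl !mulr_ge0// exprn_ge0.
split.
- move=> A A' hA hA' s hs.
  have := small _ _ hA hs; have := small _ _ hA' hs.
  rewrite /e !le_min => /andP[a1 /andP[a2 _]] /andP[b1 /andP[b2 _]].
  rewrite !he1// -mulmxBl -mulmxBr (le_trans (lXc _))//.
  have h := hC2 _ _ b2 a2; rewrite -scalerBr normrZ in h.
  have h2 := ler_wpM2l K0 h; apply: (le_trans h2).
  rewrite !mulrA ler_wpM2r// ler_wpM2r// (le_trans _ c1)//.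
  by rewrite ler_peMr ?mulr_ge0// lerDl.
- move=> A hA s hs; have := small _ _ hA hs.
  rewrite /e !le_min => /andP[b1 /andP[b2 _]].
  rewrite he1// -[_ *m c]subr0 -lc0 -{2}(mulmx1 l) -mulmxBl -mulmxBr.
  rewrite (le_trans (lXc _))//.
  have := hC2 _ 0 b2; rewrite normr0 pade0 subr0 normrZ => h.
  have h2 := ler_wpM2l K0 (h (ltW e20)); apply: (le_trans h2).
  have -> : K * (C2 * (`|s| * `|A|)) = K * C2 * `|A| * `|s| by ring.
  rewrite ler_wpM2r// (le_trans _ c1)// ler_wpM2l ?mulr_ge0//.
  by rewrite (le_trans hA)// lerDr.
- move=> A hA s hs; have := small _ _ hA hs.
  rewrite /e !le_min => /andP[b1 /andP[_ b3]].
  rewrite he1//.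
  have -> : \sum_(j < k.+1) (s ^+ j / j`!%:R) *: (l *m (A ^+ j) *m c) =
      l *m (\sum_(j < k.+1) (j`!%:R)^-1 *: (s *: A) ^+ j) *m c.
    rewrite mulmx_sumr mulmx_suml; apply: eq_bigr => j _.
    by rewrite exprZmx scalerA -scalemxAr -scalemxAl mulrC.
  rewrite -mulmxBl -mulmxBr (le_trans (lXc _))//.
  have h := ler_wpM2l K0 (hC3 _ b3); apply: (le_trans h).
  rewrite normrZ exprMn.
  have -> : K * (C3 * (`|s| ^+ k.+1 * `|A| ^+ k.+1)) =
      K * C3 * `|A| ^+ k.+1 * `|s| ^+ k.+1 by ring.
  rewrite ler_wpM2r ?exprn_ge0// ler_wpDl ?mulr_ge0 ?addr_ge0//.
  by rewrite ler_wpM2l ?mulr_ge0// lerXn2r ?nnegrE.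
Qed.

Lemma col_mx_norm_le m1 m2 n (A : 'M[R]_(m1, n)) (B : 'M[R]_(m2, n)) (c : R) :
  0 <= c -> `|A| <= c -> `|B| <= c -> `|col_mx A B| <= c.
Proof.
move=> c0 hA hB; apply: mx_norm_le => // i j; rewrite mxE.
by case: (fintype.split i) => a; [apply: le_trans hA|apply: le_trans hB]; exact: coord_norm_le.
Qed.

Lemma row_mx_norm_le m n1 n2 (A : 'M[R]_(m, n1)) (B : 'M[R]_(m, n2)) (c : R) :
  0 <= c -> `|A| <= c -> `|B| <= c -> `|row_mx A B| <= c.
Proof.
move=> c0 hA hB; apply: mx_norm_le => // i j; rewrite mxE.
by case: (fintype.split j) => a; [apply: le_trans hA|apply: le_trans hB]; exact: coord_norm_le.
Qed.

Lemma block_mx_norm_le m1 m2 n1 n2 (A : 'M[R]_(m1, n1)) (B : 'M[R]_(m1, n2))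
    (C : 'M[R]_(m2, n1)) (E : 'M[R]_(m2, n2)) (c : R) :
  0 <= c -> `|A| <= c -> `|B| <= c -> `|C| <= c -> `|E| <= c ->
  `|block_mx A B C E| <= c.
Proof. by move=> *; apply: col_mx_norm_le => //; apply: row_mx_norm_le. Qed.

End PadeMap.

Section LLMatrices.
Context {R : realType} {d : nat}.

Definition llmat (A : 'M[R]_d) (b v : 'cV[R]_d) : 'M[R]_(d + (1 + 1)) :=
  block_mx A (row_mx b v) 0 (block_mx 0 1 0 0).

Definition llmat_aut (A : 'M[R]_d) (v : 'cV[R]_d) : 'M[R]_(d + 1) :=
  block_mx A v 0 0.

(** Starting from [(0, 0, 1)], the powers give [(v, 1, 0)], then [(A v + b, 0, 0)], then
    multiplication by [A]: the last two entries feed [v] and [b] once each into the recursion for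
    [llphi]. *)
Lemma llmat_pow A b v j : llmat A b v ^+ j *m llr =
  col_mx (llphi A b v j) (col_mx ((j == 1%N)%:R%:M) ((j == 0%N)%:R%:M)).
Proof.
elim: j => [|j IH].
  rewrite expr0 mul1mx /llr /=; congr (col_mx _ (col_mx _ _)).
  by rewrite raddf0.
rewrite exprS -mulmxA IH /llmat mul_block_col mul_row_col mul_block_col.
rewrite !mul0mx !add0r mul1mx !mul_mx_scalar /= addrA.
congr (col_mx _ (col_mx _ _)); last by rewrite raddf0.
by rewrite addrAC.
Qed.

Lemma llmat_aut_pow A v j : llmat_aut A v ^+ j *m llr_aut =
  col_mx (llphi A 0 v j) ((j == 0%N)%:R%:M).
Proof.
elim: j => [|j IH]; first by rewrite expr0 mul1mx /llr_aut.
rewrite exprS -mulmxA IH /llmat_aut mul_block_col.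
by rewrite !mul0mx !add0r mul_mx_scalar /= scaler0 addr0 raddf0.
Qed.

Lemma llL_llmat_pow A b v j : llL *m llmat A b v ^+ j *m llr = llphi A b v j.
Proof. by rewrite -mulmxA llmat_pow /llL mul_row_col mul1mx mul0mx addr0. Qed.

Lemma llL_aut_llmat_pow A v j :
  llL_aut *m llmat_aut A v ^+ j *m llr_aut = llphi A 0 v j.
Proof. by rewrite -mulmxA llmat_aut_pow /llL_aut mul_row_col mul1mx mul0mx addr0. Qed.

Lemma llmat_norm_le A b v (c : R) : 1 <= c -> `|A| <= c -> `|b| <= c -> `|v| <= c ->
  `|llmat A b v| <= c.
Proof.
move=> c1 hA hb hv; have c0 : 0 <= c by exact: le_trans c1.
apply: block_mx_norm_le => //; rewrite ?normr0//; first exact: row_mx_norm_le.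
apply: block_mx_norm_le => //; rewrite ?normr0//.
apply: le_trans c1; apply: mx_norm_le => // i j; rewrite mxE.
by case: (i == j); rewrite ?normr1 ?normr0.
Qed.

Lemma llmat_aut_norm_le A v (c : R) : 0 <= c -> `|A| <= c -> `|v| <= c ->
  `|llmat_aut A v| <= c.
Proof. by move=> *; apply: block_mx_norm_le => //; rewrite normr0. Qed.

Lemma llmat_sub_norm_le A b v A' b' v' (c : R) : 0 <= c ->
  `|A - A'| <= c -> `|b - b'| <= c -> `|v - v'| <= c ->
  `|llmat A b v - llmat A' b' v'| <= c.
Proof.
move=> c0 hA hb hv; rewrite /llmat opp_block_mx add_block_mx.
apply: block_mx_norm_le; rewrite ?subrr ?normr0//.
by rewrite opp_row_mx add_row_mx; apply: row_mx_norm_le.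
Qed.

Lemma llmat_aut_sub_norm_le A v A' v' (c : R) : 0 <= c ->
  `|A - A'| <= c -> `|v - v'| <= c -> `|llmat_aut A v - llmat_aut A' v'| <= c.
Proof.
move=> c0 hA hv; rewrite /llmat_aut opp_block_mx add_block_mx.
by apply: block_mx_norm_le; rewrite ?subrr ?normr0.
Qed.

End LLMatrices.

(** * Global error for both forms of the matrix *)

Section Main.
Context {R : realType} {d : nat}.
Variables (D : set 'cV[R]_d) (x0 : 'cV[R]_d) (t0 T : R) (gamma : nat)
  (f : R -> 'cV[R]_d -> 'cV[R]_d) (x : R -> 'cV[R]_d) (rk : explicit_rk R)
  (nu : 'cV[R]_d -> R).
Hypothesis hD : open D.
Hypothesis t0T : t0 < T.
Hypothesis hgamma : (2 < gamma)%N.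
Hypothesis hf : classC gamma.+1 `[t0, T] D f.
Hypothesis hx : ode_solution f D t0 T x0 x.
Hypothesis hrk : rk_order rk gamma.
Hypothesis hnu : vector_norm nu.

Local Notation I := `[t0, T]%classic.

Let xD t : t0 <= t <= T -> D (x t).
Proof. by move=> tI; have [_ /(_ t tI)[]] := hx. Qed.

Let dx t : t0 <= t <= T -> has_derive_within I x t (f t (x t)).
Proof. by move=> tI; have [_ /(_ t tI)[_ h <-]] := hx; exact: derive_withinP. Qed.

Let cx t : t0 <= t <= T -> forall e : R, 0 < e -> exists2 r : R, 0 < r &
  forall s, t0 <= s <= T -> `|t - s| < r -> `|x t - x s| <= e.
Proof.
move=> tI e e0; have [r r0 hr] := has_derive_within_continuous (dx tI) e0.
by exists r => // s sI; apply: hr; rewrite /= in_itv.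
Qed.

Lemma llrk_global_error_of_bound ph (C h0 : R) (k : nat) : 0 < h0 ->
  (forall h, 0 < h < 1 -> h < h0 -> forall (m : nat) (t : nat -> R),
    is_partition t0 T h m t -> stage_times_in rk t0 T m t ->
   forall y, llrk_scheme rk I f ph x0 m t y ->
   forall j, (j <= m)%N -> `|x (t j) - y j| <= C * h ^+ k) ->
  llrk_global_error rk t0 T f ph x0 x nu k.
Proof.
move=> h00 hC; have [K [K0 hK]] := vector_norm_le hnu.
(* The absolute value and the added 1 make the constant positive. *)
exists (K * `|C| + 1), h0; split; first by rewrite ltr_wpDl// mulr_ge0.
split=> // h h1 hh0 N t ht st y hy n nN.
have hk : 0 <= h ^+ k by rewrite exprn_ge0//; case/andP: h1 => /ltW.
rewrite (le_trans (hK _))// mulrDl mul1r ler_wpDr// -mulrA ler_wpM2l//.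
by rewrite (le_trans (hC h h1 hh0 N t ht st y hy n nN))// ler_wpM2r// ler_norm.
Qed.

(** Both curves stay at bounded distance from [x0]: the numerical one in a tube around the constant
    curve, the exact one because its speed is at most [B] in the tube around [x]. *)
Lemma llrk_global_error_zero ph : (forall t y s, ph t y s = 0) ->
  llrk_global_error rk t0 T f ph x0 x nu 0.
Proof.
move=> ph0.
have x00 : x t0 = x0 by case: hx.
have I0 : t0 <= t0 <= T by rewrite lexx ltW.
have Dx0 : D x0 by rewrite -x00; exact: xD.
have [rho [B [rho0 B0 tube]]] := classC_tube_bound hD hf xD cx.
have cst t : t0 <= t <= T -> forall e : R, 0 < e -> exists2 r : R, 0 < r &
    forall s, t0 <= s <= T -> `|t - s| < r -> `|x0 - x0| <= e.
  by move=> _ e e0; exists 1 => // s _ _; rewrite subrr normr0 ltW.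
have [rho' [B' [rho0' B0' tube']]] :=
  classC_tube_bound (x := fun=> x0) hD hf (fun _ _ => Dx0) cst.
have [h0 [h00 hy]] := zero_order_bound hf (leqW (ltnW hgamma)) rho0'
  (ltW B0') tube' (ltW t0T) rk ph0.
apply: (@llrk_global_error_of_bound _ (B * (T - t0) + rho') h0) => //.
move=> h h1 hh0 m t ht st y sy j jm; rewrite expr0 mulr1.
have tI := partition_in ht jm.
rewrite -(subrKA x0) (le_trans (ler_normD _ _))// lerD//; last first.
  by rewrite distrC (hy h h1 hh0 m t ht st y sy j jm).
have e : t0 + (t j - t0) = t j by rewrite addrC subrK.
have := solution_lipschitz rho0 (ltW B0) tube dx (s := t j - t0) I0.
rewrite e x00 => /(_ tI)/le_trans; apply; rewrite ler_wpM2l ?(ltW B0)//.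
by case/andP: tI => ? ?; rewrite ger0_norm ?subr_ge0// lerD2r.
Qed.

(* Dm is either form of the matrix D_n; only the vectors l Dm^j c matter. *)
Lemma llrk_global_error_pade p q m (l : 'M[R]_(d, m)) (c : 'cV[R]_m)
    (nu2 : 'cV[R]_m -> R) (Dm : R -> 'cV[R]_d -> 'M[R]_m) :
  vector_norm nu2 -> l *m c = 0 ->
  (forall C : R, 1 <= C -> forall t y, `|jacobian_x f t y| <= C ->
     `|pderive I None f t y| <= C -> `|f t y| <= C -> `|Dm t y| <= C) ->
  (forall C : R, 0 <= C -> forall t y y', `|jacobian_x f t y - jacobian_x f t y'| <= C ->
     `|pderive I None f t y - pderive I None f t y'| <= C ->
     `|f t y - f t y'| <= C -> `|Dm t y - Dm t y'| <= C) ->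
  (forall t, t0 <= t <= T -> forall j, l *m (Dm t (x t) ^+ j) *m c =
     llphi (jacobian_x f t (x t)) (pderive I None f t (x t)) (f t (x t)) j) ->
  llrk_global_error rk t0 T f
    (fun t y s => l *m pade_exp p q nu2 (s *: Dm t y) *m c) x0 x nu
    (minn gamma (p + q)).
Proof.
move=> hnu2 lc0 Dbound Dlip Dpow.
(* For [p = q = 0] the Pade quotient is 1, so the linearized part is [l c = 0]. *)
have [pq0|pq0] := posnP (p + q)%N.
  move: pq0 => /eqP; rewrite addn_eq0 => /andP[/eqP -> /eqP ->].
  rewrite minn0; apply: llrk_global_error_zero => t y s.
  rewrite /pade_exp (_ : pade 0 0 _ = 1) ?expr1n ?mulmx1//.
  have num1 (A : 'M[R]_m) : pade_num 0 0 A = 1.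
    by rewrite /pade_num big_ord_recl big_ord0 /= expr0 !ffactn0 fact0 !divr1 scale1r addr0.
  by rewrite /pade /pade_den !num1 invmx1 mulmx1.
set k := minn _ _.
have k0 : (0 < k)%N by rewrite leq_min pq0 (leq_trans _ hgamma).
have N1 : (1 < gamma.+1)%N by rewrite ltnS (leq_trans _ hgamma).
have kg : (k <= gamma)%N by rewrite geq_minl.
have kpq : (k <= p + q)%N by rewrite geq_minr.
have [rho [B [rho0 B0 tube]]] := classC_tube_bound hD hf xD cx.
have B0' := ltW B0.
have [L [L0 hL]] := tube_y_lipschitz hf N1 rho0 tube.
have BD0 : 0 <= B + 1 by rewrite addr_ge0.
have [r1 [C [r10 C0 [e1 e2 e3]]]] := @pade_map_estimates R p q m d l c nu2 (B + 1) k
  hnu2 lc0 BD0 kpq.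
have tt (t : R) : `|t - t| <= rho by rewrite subrr normr0 ltW.
have Db t y : t0 <= t <= T -> `|y - x t| <= rho -> `|Dm t y| <= B + 1.
  move=> tI yx; have BB : B <= B + 1 by rewrite lerDl.
  apply: Dbound; first by rewrite lerDr.
  - exact: le_trans (jacobian_bound N1 rho0 B0' tube tI yx) BB.
  - exact: le_trans (pderive_t_bound N1 rho0 tube tI yx) BB.
  - exact: le_trans (tube_f_bound tube tI tI (tt t) yx) BB.
have xx t : `|x t - x t| <= rho by rewrite subrr normr0 ltW.
(* One constant for the three estimates; the product [C L] comes from composing with the Lipschitz
   dependence of the matrix on [y]. *)
pose Cp := C * (1 + L).
have CCp : C <= Cp by rewrite /Cp ler_peMr// lerDl.
have Cp0 : 0 <= Cp by exact: le_trans CCp.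
pose ph t y s := l *m pade_exp p q nu2 (s *: Dm t y) *m c.
have ph_lip t s y y' : t0 <= t <= T -> `|s| <= r1 ->
    `|y - x t| <= rho -> `|y' - x t| <= rho ->
    `|ph t y s - ph t y' s| <= Cp * `|s| * `|y - y'|.
  move=> tI sr yx y'x; rewrite (le_trans (e1 _ _ (Db t y tI yx) (Db t y' tI y'x) s sr))//.
  have [l1 l2 l3] := hL t y y' tI yx y'x.
  have hd : `|Dm t y - Dm t y'| <= L * `|y - y'|.
    by apply: Dlip; rewrite ?mulr_ge0//; exact: l1.
  have CS : 0 <= C * `|s| by rewrite mulr_ge0.
  rewrite (le_trans (ler_wpM2l CS hd))// mulrA ler_wpM2r// /Cp mulrAC ler_wpM2r//.
  by rewrite ler_wpM2l// lerDr.
have ph_bound t s y : t0 <= t <= T -> `|s| <= r1 -> `|y - x t| <= rho ->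
    `|ph t y s| <= Cp * `|s|.
  move=> tI sr yx; rewrite (le_trans (e2 _ (Db t y tI yx) s sr))//.
  by rewrite ler_wpM2r.
have ph_taylor t s : t0 <= t <= T -> `|s| <= r1 ->
    `|ph t (x t) s - lltaylor k (jacobian_x f t (x t)) (pderive I None f t (x t))
        (f t (x t)) s| <= Cp * `|s| ^+ k.+1.
  move=> tI sr; have := e3 _ (Db t (x t) tI (xx t)) s sr.
  rewrite /lltaylor; under eq_bigr do rewrite Dpow//.
  by move=> h; rewrite (le_trans h)// ler_wpM2r// exprn_ge0.
have [h0 [C' [h00 C'0 hC']]] := global_error hf N1 rho0 B0' tube r10 Cp0 ph_lip ph_bound
  dx ph_taylor hrk k0 (leqW kg) kg.
apply: (@llrk_global_error_of_bound _ C' h0) => //.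
have x00 : x t0 = x0 by case: hx.
by move: hC'; rewrite x00.
Qed.

Lemma pderive_t_autonomous :
  (forall s t y, s \in `[t0, T] -> t \in `[t0, T] -> y \in D -> f s y = f t y) ->
  forall t y, t0 <= t <= T -> D y -> pderive I None f t y = 0.
Proof.
move=> aut t y tI Dy.
have lim_pt (r : R) : 0 < r -> exists s, [/\ I s, s != t & `|t - s| < r].
  exact: interval_limit_point.
have hd : has_derive_within I (f^~ y) t 0.
  apply/within_dnbhsP => e e0; exists 1 => // s Is _ _.
  have It : I t by rewrite /= in_itv.
  by rewrite (aut s t y) ?subrr ?scaler0 ?subr0 ?normr0 ?ltW//; exact: mem_set.
by have [_] := has_derive_within_unique lim_pt hd.
Qed.

End Main.

Theorem proposition16 (R : realType) (d : nat) (D : set 'cV[R]_d)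
    (x0 : 'cV[R]_d) (t0 T : R) (gamma p q : nat)
    (f : R -> 'cV[R]_d -> 'cV[R]_d) (x : R -> 'cV[R]_d)
    (rk : explicit_rk R) (nu : 'cV[R]_d -> R)
    (hD : open D) (hx0 : D x0) (ht : t0 < T) (hgamma : (2 < gamma)%N)
    (hf : classC gamma.+1 `[t0, T] D f)
    (hx : unique_ode_solution f D t0 T x0 x)
    (hrk : rk_order rk gamma)
    (hnu : vector_norm nu) :
  (forall nu2 : 'cV[R]_(d + (1 + 1)) -> R, vector_norm nu2 ->
    llrk_global_error rk t0 T f (phi p q nu2 `[t0, T] f) x0 x nu
      (minn gamma (p + q))) /\
  ((forall s t y, s \in `[t0, T] -> t \in `[t0, T] -> y \in D ->
      f s y = f t y) ->
   forall nu1 : 'cV[R]_(d + 1) -> R, vector_norm nu1 ->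
    llrk_global_error rk t0 T f (phi_aut p q nu1 f) x0 x nu
      (minn gamma (p + q))).
Proof.
have [sol _] := hx.
split=> [nu2 hnu2|aut nu1 hnu1].
- apply: (@llrk_global_error_pade _ _ _ _ _ _ _ _ _ _ _ hD ht hgamma hf sol hrk hnu
    p q _ llL llr nu2 (llD `[t0, T] f)) => //.
  + by rewrite /llL /llr mul_row_col mulmx0 mul0mx addr0.
  + by move=> C C1 t y *; apply: llmat_norm_le.
  + by move=> C C0 t y y' *; apply: llmat_sub_norm_le.
  + by move=> t _ j; exact: llL_llmat_pow.
- apply: (@llrk_global_error_pade _ _ _ _ _ _ _ _ _ _ _ hD ht hgamma hf sol hrk hnu
    p q _ llL_aut llr_aut nu1 (llD_aut f)) => //.
  + by rewrite /llL_aut /llr_aut mul_row_col mulmx0 mul0mx addr0.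
  + by move=> C C1 t y *; apply: llmat_aut_norm_le => //; exact: le_trans C1.
  + by move=> C C0 t y y' *; apply: llmat_aut_sub_norm_le.
  (* The matrix without time coordinate generates the coefficients [llphi] with [b = 0], the right
     ones because [f_t] vanishes along the solution. *)
  + move=> t tI j; rewrite (pderive_t_autonomous ht aut tI); last first.
      by have [_ /(_ t tI)[]] := sol.
    exact: llL_aut_llmat_pow.
Qed.
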